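(* Let $K\subseteq L$ be an extension of real closed valued fields, with value groups $\Gamma$ and $\Delta$ and residue fields $\mathbf{k}$ and $\mathbf{l}$, respectively. There exist embeddings of valued fields $\epsilon_K:K\to\mathbf{k}((\Gamma))$ and $\epsilon_L:L\to\mathbf{l}((\Delta))$ such that $\epsilon_L|_K=\epsilon_K$ (where $\mathbf{k}((\Gamma))$ is regarded as a subfield of $\mathbf{l}((\Delta))$ via the inclusions $\mathbf{k}\subseteq\mathbf{l}$ and $\Gamma\subseteq\Delta$ induced by the extension).
   Context: A real closed valued field is a real closed field $K$ with an order-compatible valuation $v$ (for $0<a<b$ one has $v(b)\leq v(a)$), equivalently with a distinguished convex subring $V_K$ as valuation ring. An extension $K\subseteq L$ of real closed valued fields means $K$ is a subfield of $L$ with $V_L\cap K=V_K$. For a field $\mathbf{k}$ and totally ordered abelian group $\Gamma$, the Hahn series field $\mathbf{k}((\Gamma))$ consists of formal series $\sum_{\gamma\in\Gamma}a_\gamma x^\gamma$ with well-ordered support $\{\gamma: a_\gamma\neq0\}$, with pointwise addition and Cauchy product; its canonical valuation is $\nu(a)=\min\mathrm{supp}(a)$, with residue field $\mathbf{k}$ and value group $\Gamma$. An embedding of valued fields is a field embedding respecting the valuation rings (i.e. preimage of the valuation ring is the valuation ring). *)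

(* Defs.v *)
From HB Require Import structures.
From mathcomp Require Import all_boot all_order all_algebra finmap.
From mathcomp Require Import boolp wochoice classical_sets functions cardinality fsbigop.

Set Implicit Arguments.
Unset Strict Implicit.
Unset Printing Implicit Defensive.

Import Order.TTheory GRing.Theory Num.Theory.

Local Open Scope ring_scope.
Local Open Scope quotient_scope.

(* Totally ordered abelian groups. Mathematical Components has no such
   structure, and Hierarchy Builder cannot join [Order.Total] with
   [GRing.Zmodule] below the already declared [Num.RealDomain]; hence totality
   is a field here and [Order.Total] is recovered by a generic instance. *)
HB.mixin Record isOrderedZmod G of Num.POrderedZmodule G := {
  oz_le_total : total (<=%R : rel G);
  oz_leD2l_subproof : forall x y z : G, y <= z -> x + y <= x + z
}.

#[short(type="orderedZmodType")]
HB.structure Definition OrderedZmod :=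
  { G of isOrderedZmod G & Num.POrderedZmodule G }.

HB.instance Definition _ (G : orderedZmodType) :=
  Order.POrder_isTotal.Build ring_display G oz_le_total.

Section OrderedZmodTheory.
Variable G : orderedZmodType.
Implicit Types x y z : G.

Lemma oz_leD2l x y z : (x + y <= x + z) = (y <= z).
Proof.
apply/idP/idP; last exact: oz_leD2l_subproof.
by move=> /(oz_leD2l_subproof (- x)); rewrite !addKr.
Qed.

Lemma oz_leD2r x y z : (y + x <= z + x) = (y <= z).
Proof. by rewrite ![_ + x]addrC oz_leD2l. Qed.

Lemma oz_ltD2l x y z : (x + y < x + z) = (y < z).
Proof. by rewrite !ltNge oz_leD2l. Qed.

Lemma oz_ltD2r x y z : (y + x < z + x) = (y < z).
Proof. by rewrite !ltNge oz_leD2r. Qed.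

Lemma oz_leN2 x y : (- x <= - y) = (y <= x).
Proof. by rewrite -(oz_leD2l (x + y) (- x)) addrK addrAC subrr add0r. Qed.

Lemma oz_subr_ge0 x y : (0 <= y - x) = (x <= y).
Proof. by rewrite -(oz_leD2r x 0) add0r subrK. Qed.

End OrderedZmodTheory.

(* A valued field is given by its valuation ring; the value group, the valuation
   and the residue field are constructed from it below. *)
HB.mixin Record isValuedField K of GRing.Field K := {
  valring : {pred K};
  valring_subring_subproof : subring_closed valring;
  valringV_subproof : forall x : K, x \notin valring -> x^-1 \in valring
}.

#[short(type="valuedFieldType")]
HB.structure Definition ValuedField := { K of isValuedField K & GRing.Field K }.

Arguments valring {s} : rename.

(* Convexity of the valuation ring is order-compatibility of the valuation, see
   [valuation_order_compat]. *)
HB.mixin Record isOrderValued K of Num.RealClosedField K & ValuedField K := {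
  valring_convex :
    forall x y : K, 0 <= x -> x <= y -> y \in valring -> x \in valring
}.

#[short(type="rcvfType")]
HB.structure Definition RealClosedValuedField :=
  { K of isOrderValued K & Num.RealClosedField K & ValuedField K }.

HB.factory Record isConvexSubring K of Num.RealClosedField K := {
  convex_subring : {pred K};
  convex_subring_subring : subring_closed convex_subring;
  convex_subring_convex : forall x y : K, 0 <= x -> x <= y ->
    y \in convex_subring -> x \in convex_subring
}.

HB.builders Context K of isConvexSubring K.

Lemma convex_subring_total (x : K) :
  x \notin convex_subring -> x^-1 \in convex_subring.
Proof.
have [V1 VB _] := convex_subring_subring.
have V0 : 0 \in convex_subring by rewrite -(subrr 1) VB.
have VN y : `|y| \in convex_subring -> y \in convex_subring.
  case: (ger0P y) => // _ yV; rewrite -[y]opprK -[- - y]add0r.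
  exact: VB.
move=> xV; apply: (VN); apply: (convex_subring_convex (y := 1)) => //.
rewrite normfV invf_le1; last first.
  rewrite normr_gt0; apply: contra xV => /eqP ->; exact: V0.
rewrite leNgt; apply: contra xV => x1; apply: (VN).
by apply: (convex_subring_convex (y := 1)) => //; apply: ltW.
Qed.

HB.instance Definition _ :=
  isValuedField.Build K convex_subring_subring convex_subring_total.
HB.instance Definition _ := isOrderValued.Build K convex_subring_convex.

HB.end.

(* Embeddings of valued fields; an injection [K -> L] of this kind is also how
   an extension of valued fields is represented. Ring morphisms between fields
   are injective, and between real closed fields they preserve the order. *)
HB.mixin Record isValuedMorphism (K L : valuedFieldType) (f : K -> L) := {
  valring_mono_subproof : forall x, (f x \in valring) = (x \in valring)
}.

HB.structure Definition ValuedMorphism (K L : valuedFieldType) :=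
  { f of @GRing.RMorphism K L f & @isValuedMorphism K L f }.

Notation "{ 'vmorphism' K -> L }" := (ValuedMorphism.type K%type L%type)
  (at level 0, K at level 98, L at level 99,
   format "{ 'vmorphism'  K  ->  L }") : type_scope.

Lemma valring_mono (K L : valuedFieldType) (f : {vmorphism K -> L}) (x : K) :
  (f x \in valring) = (x \in valring).
Proof. exact: valring_mono_subproof. Qed.

Section ResidueField.
Variable K : valuedFieldType.

HB.instance Definition _ :=
  GRing.isSubringClosed.Build K (@valring K) valring_subring_subproof.

Lemma valringV (x : K) : x \notin valring -> x^-1 \in valring.
Proof. exact: valringV_subproof. Qed.

Record valint := ValInt { valint_val : K; _ : valint_val \in valring }.

HB.instance Definition _ := [isSub for valint_val].
HB.instance Definition _ := [Choice of valint by <:].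
HB.instance Definition _ := [SubChoice_isSubComNzRing of valint by <:].

(* The maximal ideal: the non-units of the valuation ring. *)
Definition valmax : pred valint :=
  [pred x | (val x == 0) || ((val x)^-1 \notin valring)].

Lemma valmaxE (x : valint) :
  (x \in valmax) = (val x == 0) || ((val x)^-1 \notin valring).
Proof. by []. Qed.

Lemma valmax_idealr : idealr_closed valmax.
Proof.
have maxM (a x : valint) : x \in valmax -> a * x \in valmax.
  rewrite !valmaxE rmorphM /= mulf_eq0 invfM => /orP[->|xV]; first by rewrite orbT.
  have [->//|a0 /=] := eqVneq (val a) 0; rewrite [X in _ || X](_ : _ = true) ?orbT //.
  apply: contra xV => axV.
  by rewrite -[(val x)^-1](mulVKf a0) rpredM ?(valP a).
have maxD (x y : valint) : val y / val x \in valring ->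
    x \in valmax -> y \in valmax -> x + y \in valmax.
  have [x0|x0] := eqVneq (val x) 0.
    by have -> : x = 0 by [exact: val_inj]; rewrite add0r.
  move=> yxV xm _; rewrite (_ : x + y = ValInt (rpredD (rpred1 _) yxV) * x) ?maxM //.
  by apply: val_inj; rewrite /= mulrDl mul1r divfK.
split=> [||a u v um vm]; first by rewrite valmaxE eqxx.
  by rewrite valmaxE rmorph1 oner_eq0 invr1 rpred1.
have [uvV|] := boolP (val v / val (a * u) \in valring).
  by rewrite maxD ?maxM.
by move=> /valringV; rewrite invf_div => vuV; rewrite addrC maxD ?maxM.
Qed.

HB.instance Definition _ := isIdealr.Build valint valmax valmax_idealr.

Definition valmax_ideal : idealr valint := valmax.
Definition resfield : Type := {ideal_quot valmax_ideal}.

HB.instance Definition _ := GRing.ComNzRing.on resfield.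

Definition residue : valint -> resfield := \pi_{ideal_quot valmax_ideal}.

HB.instance Definition _ := GRing.RMorphism.on residue.

Lemma reprK_residue (a : resfield) : residue (repr a) = a.
Proof. exact: reprK. Qed.

Lemma residueP (a : resfield) : exists x, a = residue x.
Proof. by exists (repr a); rewrite reprK_residue. Qed.

Lemma residue_eq0 x : (residue x == 0) = (x \in valmax).
Proof. by rewrite -(rmorph0 residue) /residue -Quotient.idealrBE subr0. Qed.

Definition resinv (a : resfield) : resfield :=
  if a == 0 then 0 else residue (insubd 0 (val (repr a))^-1).

Lemma resmulVf a : a != 0 -> resinv a * a = 1.
Proof.
move=> a0; rewrite /resinv (negPf a0); rewrite -[a in _ * a]reprK_residue.
have : repr a \notin valmax by rewrite -residue_eq0 reprK_residue.
rewrite valmaxE negb_or negbK => /andP[x0 xV].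
rewrite -rmorphM -(rmorph1 residue); congr residue; apply: val_inj.
by rewrite rmorphM /= insubdK // mulVf.
Qed.

Lemma resinv0 : resinv 0 = 0.
Proof. by rewrite /resinv eqxx. Qed.

HB.instance Definition _ := GRing.ComNzRing_isField.Build resfield resmulVf resinv0.

End ResidueField.

Section ValueGroup.
Variable K : valuedFieldType.

(* The multiplicative group of [K], written additively. *)
Record nonzero := Nonzero { nonzero_val : K; _ : nonzero_val != 0 }.

HB.instance Definition _ := [isSub for nonzero_val].
HB.instance Definition _ := [Choice of nonzero by <:].

Lemma nonzero_neq0 (x : nonzero) : val x != 0. Proof. exact: valP x. Qed.

Lemma nonzero_mul_subproof (x y : nonzero) : val x * val y != 0.
Proof. by rewrite mulf_neq0 ?nonzero_neq0. Qed.
Lemma nonzero_inv_subproof (x : nonzero) : (val x)^-1 != 0.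
Proof. by rewrite invr_neq0 ?nonzero_neq0. Qed.

Let mul x y := Nonzero (nonzero_mul_subproof x y).
Let inv x := Nonzero (nonzero_inv_subproof x).
Let one := Nonzero (oner_neq0 K).
Let mulA : associative mul.
Proof. by move=> x y z; apply: val_inj; rewrite /= mulrA. Qed.
Let mulC : commutative mul.
Proof. by move=> x y; apply: val_inj; rewrite /= mulrC. Qed.
Let mul1 : left_id one mul.
Proof. by move=> x; apply: val_inj; rewrite /= mul1r. Qed.
Let mulV : left_inverse one inv mul.
Proof. by move=> x; apply: val_inj; rewrite /= mulVf ?nonzero_neq0. Qed.

HB.instance Definition _ := GRing.isZmodule.Build nonzero mulA mulC mul1 mulV.

Lemma nonzero_valD (x y : nonzero) : val (x + y) = val x * val y.
Proof. by []. Qed.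
Lemma nonzero_valN (x : nonzero) : val (- x) = (val x)^-1.
Proof. by []. Qed.
Lemma nonzero_val0 : val (0 : nonzero) = 1.
Proof. by []. Qed.

Lemma nonzero_div_trans (y : nonzero) (a b : K) : a / val y * (val y / b) = a / b.
Proof. by rewrite mulrA divfK ?nonzero_neq0. Qed.

(* The units of the valuation ring. *)
Definition valunit : {pred nonzero} :=
  [pred x | (val x \in valring) && ((val x)^-1 \in valring)].

Lemma valunitE (x : nonzero) :
  (x \in valunit) = (val x \in valring) && ((val x)^-1 \in valring).
Proof. by []. Qed.

Lemma valunit_zmod : zmod_closed valunit.
Proof.
split=> [|x y]; first by rewrite valunitE nonzero_val0 invr1 rpred1.
rewrite !valunitE nonzero_valD nonzero_valN invfM invrK => /andP[xV xV'] /andP[yV yV'].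
by rewrite !rpredM.
Qed.

HB.instance Definition _ := GRing.isZmodClosed.Build nonzero valunit valunit_zmod.

Definition valunit_zmodClosed : zmodClosed nonzero := valunit.

(* The value group is the quotient of the multiplicative group by the units of
   the valuation ring. *)
Definition valgroup : Type := {ideal_quot valunit_zmodClosed}.

HB.instance Definition _ := GRing.Zmodule.on valgroup.

Definition valuation : nonzero -> valgroup := \pi_{ideal_quot valunit_zmodClosed}.

HB.instance Definition _ := GRing.Additive.on valuation.

Lemma reprK_valuation (g : valgroup) : valuation (repr g) = g.
Proof. exact: reprK. Qed.

Lemma valuationP (g : valgroup) : exists x, g = valuation x.
Proof. by exists (repr g); rewrite reprK_valuation. Qed.

Lemma eq_valuation x y :
  (valuation x == valuation y) =
    (val x / val y \in valring) && (val y / val x \in valring).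
Proof.
by rewrite -Quotient.idealrBE valunitE nonzero_valD nonzero_valN invf_div.
Qed.

Definition valgroup_le (g h : valgroup) : bool :=
  val (repr h) / val (repr g) \in valring.

Lemma valgroup_leE x y :
  valgroup_le (valuation x) (valuation y) = (val y / val x \in valring).
Proof.
rewrite /valgroup_le.
have /andP[xV xV'] : (val (repr (valuation x)) / val x \in valring) &&
      (val x / val (repr (valuation x)) \in valring).
  by rewrite -eq_valuation reprK_valuation.
have /andP[yV yV'] : (val (repr (valuation y)) / val y \in valring) &&
      (val y / val (repr (valuation y)) \in valring).
  by rewrite -eq_valuation reprK_valuation.
apply/idP/idP => h.
  by have := rpredM (rpredM yV' h) xV; rewrite !nonzero_div_trans.
by have := rpredM (rpredM yV h) xV'; rewrite !nonzero_div_trans.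
Qed.

Lemma valgroup_le_refl : reflexive valgroup_le.
Proof.
by move=> g; rewrite /valgroup_le divff ?rpred1 ?nonzero_neq0.
Qed.

Lemma valgroup_le_anti : antisymmetric valgroup_le.
Proof.
move=> g h; case: (valuationP g) (valuationP h) => [x ->] [y ->].
by rewrite !valgroup_leE andbC -eq_valuation => /eqP.
Qed.

Lemma valgroup_le_trans : transitive valgroup_le.
Proof.
move=> g f h; case: (valuationP f) (valuationP g) (valuationP h).
move=> x -> [y ->] [z ->]; rewrite !valgroup_leE => xy yz.
by have := rpredM yz xy; rewrite nonzero_div_trans.
Qed.

HB.instance Definition _ := Order.Le_isPOrder.Build ring_display valgroup
  valgroup_le_refl valgroup_le_anti valgroup_le_trans.

Lemma le_valuation (x y : nonzero) :
  (valuation x <= valuation y) = (val y / val x \in valring).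
Proof. exact: valgroup_leE. Qed.

Lemma valgroup_le_total : total (<=%R : rel valgroup).
Proof.
move=> g h; case: (valuationP g) (valuationP h) => [x ->] [y ->].
rewrite !le_valuation; have [//|/valringV] := boolP (val y / val x \in valring).
by rewrite invf_div.
Qed.

Lemma valgroup_leD2l (f g h : valgroup) : g <= h -> f + g <= f + h.
Proof.
case: (valuationP f) (valuationP g) (valuationP h) => x -> [y ->] [z ->].
rewrite -!raddfD !le_valuation !nonzero_valD.
by rewrite -mulf_div divff ?mul1r ?nonzero_neq0.
Qed.

HB.instance Definition _ :=
  isOrderedZmod.Build valgroup valgroup_le_total valgroup_leD2l.

End ValueGroup.

Lemma valuation_order_compat (K : rcvfType) (x y : nonzero K) :
  0 < val x -> val x < val y -> valuation y <= valuation x.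
Proof.
move=> x0 xy; have y0 := lt_trans x0 xy.
rewrite le_valuation; apply: (@valring_convex K _ 1); last exact: rpred1.
  by rewrite divr_ge0 ?ltW.
by rewrite ler_pdivrMr // mul1r ltW.
Qed.

Section InducedMaps.
Variables (K L : valuedFieldType) (f : {vmorphism K -> L}).

Lemma valint_map_subproof (x : valint K) : f (val x) \in valring.
Proof. by rewrite valring_mono (valP x). Qed.

Definition valint_map (x : valint K) : valint L := ValInt (valint_map_subproof x).

Lemma nonzero_map_subproof (x : nonzero K) : f (val x) != 0.
Proof. by rewrite fmorph_eq0 nonzero_neq0. Qed.

Definition nonzero_map (x : nonzero K) : nonzero L :=
  Nonzero (nonzero_map_subproof x).

Definition resmap (a : resfield K) : resfield L := residue (valint_map (repr a)).

Definition valmap (g : valgroup K) : valgroup L :=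
  valuation (nonzero_map (repr g)).

Lemma resmapE x : resmap (residue x) = residue (valint_map x).
Proof.
apply/eqP; rewrite -subr_eq0 -rmorphB residue_eq0 valmaxE.
have : residue (repr (residue x) - x) == 0.
  by rewrite rmorphB subr_eq0; apply/eqP/reprK_residue.
rewrite residue_eq0 valmaxE !rmorphB /= -rmorphB.
by rewrite -fmorphV fmorph_eq0 valring_mono.
Qed.

Lemma resmap_zmod_morphism : zmod_morphism resmap.
Proof.
move=> a b; case: (residueP a) (residueP b) => [x ->] [y ->].
rewrite -rmorphB !resmapE -rmorphB; congr residue; apply: val_inj.
by rewrite /= rmorphB.
Qed.

Lemma resmap_monoid_morphism : monoid_morphism resmap.
Proof.
split=> [|a b].
  rewrite -(rmorph1 (@residue K)) resmapE -(rmorph1 (@residue L)).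
  by congr residue; apply: val_inj; rewrite /= rmorph1.
case: (residueP a) (residueP b) => [x ->] [y ->].
rewrite -rmorphM !resmapE -rmorphM; congr residue; apply: val_inj.
by rewrite /= rmorphM.
Qed.

HB.instance Definition _ :=
  GRing.isZmodMorphism.Build (resfield K) (resfield L) resmap resmap_zmod_morphism.
HB.instance Definition _ :=
  GRing.isMonoidMorphism.Build (resfield K) (resfield L) resmap resmap_monoid_morphism.

Lemma valmapE x : valmap (valuation x) = valuation (nonzero_map x).
Proof.
have : valuation (repr (valuation x)) == valuation x.
  by rewrite reprK_valuation.
rewrite eq_valuation => h; apply/eqP; rewrite eq_valuation /=.
by rewrite -!fmorph_div !valring_mono.
Qed.

Lemma valmap_zmod_morphism : zmod_morphism valmap.
Proof.
move=> a b; case: (valuationP a) (valuationP b) => [x ->] [y ->].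
rewrite -raddfB !valmapE -raddfB; congr valuation; apply: val_inj.
by rewrite /= fmorph_div.
Qed.

HB.instance Definition _ :=
  GRing.isZmodMorphism.Build (valgroup K) (valgroup L) valmap valmap_zmod_morphism.

Lemma valmap_le : {mono valmap : g h / g <= h}.
Proof.
move=> a b; case: (valuationP a) (valuationP b) => [x ->] [y ->].
by rewrite !valmapE !le_valuation /= -fmorph_div valring_mono.
Qed.

End InducedMaps.

HB.mixin Record isLeMono (G H : orderedZmodType) (f : G -> H) := {
  le_mono_subproof : {mono f : x y / x <= y}
}.

HB.structure Definition OrderedEmbedding (G H : orderedZmodType) :=
  { f of @Algebra.Additive G H f & @isLeMono G H f }.

Notation "{ 'oembedding' G -> H }" := (OrderedEmbedding.type G%type H%type)
  (at level 0, G at level 98, H at level 99,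
   format "{ 'oembedding'  G  ->  H }") : type_scope.

Section OrderedEmbeddingTheory.
Variables (G H : orderedZmodType) (f : {oembedding G -> H}).

Lemma oe_le : {mono f : x y / x <= y}. Proof. exact: le_mono_subproof. Qed.

Lemma oe_inj : injective f.
Proof. by move=> x y fxy; apply: le_anti; rewrite -!oe_le fxy lexx. Qed.

End OrderedEmbeddingTheory.

HB.instance Definition _ (K L : valuedFieldType) (f : {vmorphism K -> L}) :=
  isLeMono.Build (valgroup K) (valgroup L) (valmap f) (valmap_le f).

Local Open Scope classical_set_scope.

Section WellOrdered.
Variable G : orderedZmodType.
Implicit Types (S T A : set G) (g h : G).

(* The same notion as [wo_chain <=%R], for Prop-valued sets; see [wo_setP]. *)
Definition wo_set S := forall A, A `<=` S -> A !=set0 ->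
  exists2 m, A m & forall x, A x -> m <= x.

Lemma wo_setP (p : {pred G}) : wo_chain <=%R p <-> wo_set [set` p].
Proof.
split=> [wop A Ap [x Ax]|wop].
  have subp : {subset [pred x | `[< A x >]] <= p} by move=> y /asboolP/Ap.
  have [|m [[/asboolP Am mA] _]] := wop [pred x | `[< A x >]] subp.
    by exists x; apply/asboolP.
  by exists m => // y Ay; apply: mA; apply/asboolP.
apply: antisymmetric_wo_chain => [x y _ _|A Ap [x xA]]; first exact: le_anti.
have [||m Am mA] := wop [set` A]; [by move=> y /Ap|by exists x|].
by exists m; split.
Qed.

Lemma wo_sub S T : S `<=` T -> wo_set T -> wo_set S.
Proof. by move=> ST woT A AS; apply: woT => x /AS/ST. Qed.

Lemma wo_set1 g : wo_set [set g].
Proof. by move=> A Ag [x Ax]; exists x => // y /Ag ->; rewrite (Ag x Ax). Qed.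

Lemma wo_setU S T : wo_set S -> wo_set T -> wo_set (S `|` T).
Proof.
move=> woS woT A AST [x Ax].
have [[s [As Ss]]|nS] := pselect (exists s, A s /\ S s); last first.
  have AT : A `<=` T.
    by move=> y Ay; have [Sy|//] := AST y Ay; case: nS; exists y.
  by apply: woT => //; exists x.
have [|s0 [As0 Ss0] s0min] := woS (A `&` S) (@subIsetr _ A S); first by exists s.
have [[t [At Tt]]|nT] := pselect (exists t, A t /\ T t); last first.
  exists s0 => // y Ay; apply: s0min; split=> //.
  by have [//|Ty] := AST y Ay; case: nT; exists y.
have [|t0 [At0 Tt0] t0min] := woT (A `&` T) (@subIsetr _ A T); first by exists t.
exists (Order.min s0 t0); first by case: leP.
move=> y Ay; rewrite ge_min; apply/orP.
by have [?|?] := AST y Ay; [left; apply: s0min|right; apply: t0min].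
Qed.

Lemma wo_setD S T : wo_set S -> wo_set T ->
  wo_set [set g | exists s t, [/\ S s, T t & g = s + t]].
Proof.
move=> woS woT B BST [b Bb].
pose P s t := [/\ S s, T t & B (s + t)].
have tmin (Q : G -> G -> Prop) : (exists s t, P s t /\ Q s t) ->
    exists s t, [/\ P s t, Q s t & forall s' t', P s' t' -> Q s' t' -> t <= t'].
  move=> [s [t [Pst Qst]]].
  have [||t0 [s0 [Pst0 Qst0]] t0min] :=
      woT [set t | exists s, P s t /\ Q s t].
  - by move=> u [v [[]]].
  - by exists t, s.
  by exists s0, t0; split=> // s' t' P' Q'; apply: t0min; exists s'.
have [||s [t [Pst tle]] smin] := woS [set s | exists t, P s t /\
    forall s' t', P s' t' -> s' + t' <= s + t -> t <= t'].
- by move=> u [v [[]]].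
- have [|s [t [Pst _ h]]] := tmin (fun _ _ => True).
    by have [s [t [Ss Tt bE]]] := BST _ Bb; exists s, t; rewrite /P -bE.
  by exists s, t; split=> // s' t' P' _; exact: (h s' t').
exists (s + t); first by case: Pst.
move=> c Bc; rewrite leNgt; apply/negP => cst.
have [|s1 [t1 [Pst1 lt1 t1min]]] := tmin (fun s' t' => s' + t' < s + t).
  by have [s' [t' [Ss' Tt' cE]]] := BST _ Bc; exists s', t'; rewrite /P -cE.
have tt1 : t <= t1 by apply: (tle s1) => //; exact: ltW.
have : s <= s1.
  apply: smin; exists t1; split=> // s' t' P' le'; apply: (t1min s') => //.
  exact: le_lt_trans le' lt1.
move=> ss1; have : s + t <= s1 + t1.
  by apply: (@le_trans _ _ (s1 + t)); rewrite ?oz_leD2r ?oz_leD2l.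
by rewrite leNgt lt1.
Qed.

Lemma wo_finite S T g : wo_set S -> wo_set T ->
  finite_set [set h | S h /\ T (g - h)].
Proof.
move=> woS woT; set A := [set h | _].
have Amax B : B `<=` A -> B !=set0 -> exists2 m, B m & forall x, B x -> x <= m.
  move=> BA [x Bx]; have [||m Bm mmin] := woT [set t | B (g - t)].
  - by move=> t /BA[_]; rewrite opprB addrC subrK.
  - by exists (g - x); rewrite /= opprB addrC subrK.
  exists (g - m) => // y By; rewrite -oz_leN2 -(oz_leD2l g (- (g - m))).
  rewrite opprB addrC subrK; apply: mmin.
  by rewrite /= opprB addrC subrK.
pose I x := A `&` [set y | y <= x].
have Ifin x : A x -> finite_set (I x).
  move=> Ax; apply: contrapT => Ix.
  have [||m [Am Im] mmin] := woS [set x | A x /\ ~ finite_set (I x)].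
  - by move=> y [[]].
  - by exists x.
  apply: Im; have IE : I m `<=` m |` (A `&` [set y | y < m]).
    move=> y [Ay /=]; rewrite le_eqVlt => /orP[/eqP->|ym]; [by left|by right].
  apply: sub_finite_set IE _; rewrite finite_setU; split; first exact: finite_set1.
  have [->|/set0P J0] := eqVneq (A `&` [set y | y < m]) set0; first exact: finite_set0.
  have [|p [Ap pm] pmax] := Amax _ _ J0; first by move=> y [].
  have : finite_set (I p).
    apply: contrapT => Ip; have := mmin p (conj Ap Ip).
    by rewrite leNgt pm.
  apply: sub_finite_set => y [Ay ym]; split=> //=; exact: pmax.
have [->|/set0P A0] := eqVneq A set0; first exact: finite_set0.
have [m Am mmax] := Amax A (fun _ => id) A0.
by apply: sub_finite_set (Ifin m Am) => x Ax; split=> //=; apply: mmax.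
Qed.

End WellOrdered.

Section HahnSeries.
Variables (k : fieldType) (G : orderedZmodType).

Definition wo_support : {pred G -> k} :=
  fun a => `[< wo_chain <=%R [pred g | a g != 0] >].

Lemma wo_supportP (a : G -> k) : reflect (wo_set [set g | a g != 0]) (a \in wo_support).
Proof.
apply: (iffP (asboolP _)) => [/wo_setP //|h]; exact/wo_setP.
Qed.

(* Hahn series over [k] with exponents in [G], as coefficient functions. *)
Record hahn := Hahn { hahn_coef :> G -> k; _ : hahn_coef \in wo_support }.

HB.instance Definition _ := [isSub for hahn_coef].
HB.instance Definition _ := [Choice of hahn by <:].

Lemma hahn_wo (a : hahn) : wo_set [set g | a g != 0].
Proof. by apply/wo_supportP; case: a. Qed.

Arguments hahn_wo : clear implicits.

Lemma hahnP (a b : hahn) : a =1 b -> a = b.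
Proof. by move=> ab; apply: val_inj; apply/funext. Qed.

Lemma wo_support_zmod : zmod_closed wo_support.
Proof.
split=> [|a b /wo_supportP woa /wo_supportP wob]; apply/wo_supportP.
  by move=> A A0 [x /A0 /=]; rewrite eqxx.
apply: wo_sub _ (wo_setU woa wob) => g /=; apply: contra_neqP => /not_orP[].
by move=> /negP/negPn/eqP ag /negP/negPn/eqP bg; rewrite !fctE ag bg subr0.
Qed.

HB.instance Definition _ :=
  GRing.isZmodClosed.Build (G -> k) wo_support wo_support_zmod.
HB.instance Definition _ := [SubChoice_isSubZmodule of hahn by <:].

Lemma hahn0E g : (0 : hahn) g = 0. Proof. by []. Qed.
Lemma hahnDE (a b : hahn) g : (a + b) g = a g + b g. Proof. by []. Qed.
Lemma hahnNE (a : hahn) g : (- a) g = - a g. Proof. by []. Qed.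
Lemma hahnBE (a b : hahn) g : (a - b) g = a g - b g. Proof. by []. Qed.

Lemma hahn_mono_subproof (g : G) (c : k) :
  (fun h => if h == g then c else 0) \in wo_support.
Proof.
apply/wo_supportP; apply: wo_sub _ (@wo_set1 _ g) => h /=.
by case: (h =P g) => // _; rewrite eqxx.
Qed.

Definition hahn_mono g c : hahn := Hahn (hahn_mono_subproof g c).

Lemma hahn_monoE g c h : hahn_mono g c h = if h == g then c else 0.
Proof. by []. Qed.

(* The Cauchy product. [\sum_(h \in A)] is the sum of the nonzero terms if there
   are finitely many (and 0 otherwise); by [wo_finite] there always are. *)
Definition hahn_conv (a b : G -> k) (g : G) : k :=
  \sum_(h \in [set: G]) a h * b (g - h).

Lemma hahn_convE (a b : G -> k) g (X : {fset G}) :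
    (forall h, a h != 0 -> b (g - h) != 0 -> h \in X) ->
  hahn_conv a b g = \sum_(h <- X) a h * b (g - h).
Proof.
move=> sX; apply: fsbigTE => h; apply: contraNeq.
by rewrite mulf_eq0 negb_or => /andP[]; apply: sX.
Qed.

Lemma hahn_conv_neq0 (a b : G -> k) g : hahn_conv a b g != 0 ->
  exists h1 h2, [/\ a h1 != 0, b h2 != 0 & g = h1 + h2].
Proof.
apply: contra_neqP => nh; rewrite (@hahn_convE _ _ _ fset0) ?big_seq_fset0 //.
by move=> h ah bh; case: nh; exists h, (g - h); split=> //; rewrite addrC subrK.
Qed.

Lemma wo_fset (S T : set G) g : wo_set S -> wo_set T ->
  exists X : {fset G}, forall h, S h -> T (g - h) -> h \in X.
Proof.
move=> woS woT; have fX := wo_finite g woS woT.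
exists (fset_set [set h | S h /\ T (g - h)]) => h Sh Th.
by rewrite in_fset_set // inE.
Qed.

Lemma hahn_mul_subproof (a b : hahn) : hahn_conv a b \in wo_support.
Proof.
apply/wo_supportP; apply: (wo_sub _ (wo_setD (hahn_wo a) (hahn_wo b))).
by move=> g /hahn_conv_neq0 [h1 [h2 []]]; exists h1, h2.
Qed.

Definition hahn_mul (a b : hahn) : hahn := Hahn (hahn_mul_subproof a b).

Lemma hahn_mulE (a b : hahn) g (X : {fset G}) :
    (forall h, a h != 0 -> b (g - h) != 0 -> h \in X) ->
  hahn_mul a b g = \sum_(h <- X) a h * b (g - h).
Proof. exact: hahn_convE. Qed.

Lemma big_fset_reindex (X : {fset G}) (f f' : G -> G) (F : G -> k) :
    cancel f f' ->
  \sum_(h <- [fset f x | x in X]%fset) F h = \sum_(h <- X) F (f h).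
Proof. by move=> ff'; rewrite big_imfset //= => x y _ _ /(can_inj ff'). Qed.

Lemma hahn_mulC : commutative hahn_mul.
Proof.
move=> a b; apply: hahnP => g.
have [X sX] := wo_fset g (hahn_wo a) (hahn_wo b).
rewrite (@hahn_mulE _ _ _ X) // (@hahn_mulE _ _ _ [fset g - x | x in X]%fset).
  have subK : cancel (fun x => g - x) (fun x => g - x).
    by move=> x; rewrite opprB addrC subrK.
  rewrite (big_fset_reindex _ _ subK); apply: eq_bigr => h _.
  by rewrite subK mulrC.
move=> h bh ah; apply/imfsetP; exists (g - h).
  by apply: sX => //=; rewrite opprB addrC subrK.
by rewrite opprB addrC subrK.
Qed.

Lemma hahn_mulA : associative hahn_mul.
Proof.
move=> a b c; apply: hahnP => g.
have wobc := wo_setD (hahn_wo b) (hahn_wo c).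
have woab := wo_setD (hahn_wo a) (hahn_wo b).
have [U sU] := wo_fset g (hahn_wo a) wobc.
have [X sX] := wo_fset g woab (hahn_wo c).
rewrite (@hahn_mulE a _ _ U); last first.
  by move=> h ah /hahn_conv_neq0 bch; apply: sU.
rewrite (@hahn_mulE _ c _ X); last first.
  by move=> h /hahn_conv_neq0 abh ch; apply: sX.
transitivity (\sum_(u <- U) \sum_(h <- X) a u * (b (h - u) * c (g - h))).
  apply: eq_bigr => u _; rewrite -mulr_sumr.
  have [->|au] := eqVneq (a u) 0; first by rewrite !mul0r.
  have subK : cancel (fun x => x - u) (fun x => x + u).
    by move=> x; rewrite subrK.
  congr (_ * _); rewrite (@hahn_mulE _ _ _ [fset x - u | x in X]%fset).
    rewrite (big_fset_reindex _ _ subK); apply: eq_bigr => h _.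
    by rewrite opprB addrA subrK.
  move=> h bh ch; apply/imfsetP; exists (h + u); rewrite ?addrK //=.
  apply: sX; first by exists u, h; rewrite addrC.
  by rewrite /= opprD addrA [g - h - u]addrAC.
rewrite exchange_big /=; apply: eq_bigr => h _.
have [->|ch] := eqVneq (c (g - h)) 0.
  by rewrite mulr0 big1 // => u _; rewrite !mulr0.
rewrite (@hahn_convE _ _ _ U); last first.
  move=> u au bu; apply: sU => //; exists (h - u), (g - h); split=> //.
  by rewrite [RHS]addrC addrA subrK.
by rewrite mulr_suml; apply: eq_bigr => u _; rewrite mulrA.
Qed.

Lemma hahn_mono_mulE g c (a : hahn) h :
  hahn_mul (hahn_mono g c) a h = c * a (h - g).
Proof.
rewrite (@hahn_mulE _ _ _ [fset g]%fset) ?big_seq_fset1 ?hahn_monoE ?eqxx //.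
by move=> u; rewrite hahn_monoE inE; case: (u =P g) => // _; rewrite eqxx.
Qed.

Lemma hahn_mul1 : left_id (hahn_mono 0 1) hahn_mul.
Proof. by move=> a; apply: hahnP => g; rewrite hahn_mono_mulE mul1r subr0. Qed.

Lemma hahn_mulDl : left_distributive hahn_mul +%R.
Proof.
move=> a b c; apply: hahnP => g; rewrite hahnDE.
have [X sX] := wo_fset g (wo_setU (hahn_wo a) (hahn_wo b)) (hahn_wo c).
rewrite !(@hahn_mulE _ _ _ X).
- by rewrite -big_split /=; apply: eq_bigr => h _; rewrite mulrDl.
- by move=> h bh; apply: sX; right.
- by move=> h ah; apply: sX; left.
move=> h; rewrite hahnDE => abh; apply: sX => /=.
by have [a0|] := eqVneq (a h) 0; [right; rewrite a0 add0r in abh|left].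
Qed.

Lemma hahn_one_neq0 : hahn_mono 0 1 != 0.
Proof.
apply/eqP => /(congr1 (fun a : hahn => a 0)); rewrite hahn_monoE eqxx hahn0E.
by apply/eqP; exact: oner_neq0.
Qed.

HB.instance Definition _ := GRing.Zmodule_isComNzRing.Build hahn
  hahn_mulA hahn_mulC hahn_mul1 hahn_mulDl hahn_one_neq0.

Lemma hahn1E g : (1 : hahn) g = if g == 0 then 1 else 0.
Proof. by []. Qed.

(* The least element of the support, with junk value 0 at the zero series. *)
Definition hahn_val (a : hahn) : G :=
  xget 0 [set g | a g != 0 /\ forall h, a h != 0 -> g <= h].

Lemma hahn_val_neq0 (a : hahn) : a != 0 -> a (hahn_val a) != 0.
Proof.
move=> a0; rewrite /hahn_val; case: xgetP => [g _ []//|nog].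
have [||m am mmin] := @hahn_wo a [set g | a g != 0] => //.
  apply/set0P; apply: contra_neq a0 => as0; apply: hahnP => g; apply/eqP.
  by apply/negPn/negP => ag; have : set0 g by rewrite -as0.
by case: (nog m).
Qed.

Lemma hahn_val_le (a : hahn) g : a g != 0 -> hahn_val a <= g.
Proof.
move=> ag; rewrite /hahn_val; case: xgetP => [h _ [_]|nog]; first exact.
have [||m am mmin] := @hahn_wo a [set g | a g != 0] => //; first by exists g.
by case: (nog m).
Qed.

Lemma hahn_lt_val (a : hahn) g : g < hahn_val a -> a g = 0.
Proof.
by move=> ga; apply/eqP/negPn/negP => /hahn_val_le; rewrite leNgt ga.
Qed.

Lemma hahn_mul_low (a b : hahn) x y :
    (forall h, h < x -> a h = 0) -> (forall h, h < y -> b h = 0) ->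
  (a * b) (x + y) = a x * b y /\ forall h, h < x + y -> (a * b) h = 0.
Proof.
move=> ax yb; split=> [|h hxy].
  rewrite (@hahn_mulE _ _ _ [fset x]%fset) ?big_seq_fset1 /=.
    by rewrite addrAC subrr add0r.
  move=> u au bu; rewrite inE eq_le !leNgt; apply/andP; split; apply/negP => h.
    rewrite yb ?eqxx // in bu; rewrite -(oz_ltD2r u) subrK addrC.
    by rewrite oz_ltD2l.
  by rewrite ax ?eqxx // in au.
apply/eqP/negPn/negP => /hahn_conv_neq0 [u [v [au bv hE]]].
have xu : x <= u by rewrite leNgt; apply: contra au => /ax->.
have yv : y <= v by rewrite leNgt; apply: contra bv => /yb->.
move: hxy; rewrite hE ltNge => /negP; apply.
by apply: (@le_trans _ _ (u + y)); rewrite ?oz_leD2r ?oz_leD2l.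
Qed.

Lemma hahn_mul_val (a b : hahn) : a != 0 -> b != 0 ->
  a * b != 0 /\ hahn_val (a * b) = hahn_val a + hahn_val b.
Proof.
move=> a0 b0; have [e low] := hahn_mul_low (@hahn_lt_val a) (@hahn_lt_val b).
have ab0 : (a * b) (hahn_val a + hahn_val b) != 0.
  by rewrite e mulf_neq0 ?hahn_val_neq0.
have abn0 : a * b != 0 by apply: contra ab0 => /eqP ->.
split=> //; apply: le_anti; rewrite hahn_val_le //= leNgt; apply/negP => /low.
by apply/eqP; rewrite hahn_val_neq0.
Qed.

Lemma hahn_inv_exists (a : hahn) : a != 0 -> exists b, b * a = 1.
Proof.
move=> a0; pose al := hahn_val a.
pose good (b : hahn) (d : G) := forall h : G, h < al + d -> (b * a) h = (1 : hahn) h.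
have good_uniq (b c : hahn) (d h : G) : good b d -> good c d -> h < d -> b h = c h.
  move=> gb gc hd; apply/eqP; rewrite -subr_eq0 -hahnBE; apply/negPn/negP.
  move=> bch; have bc0 : b - c != 0 by apply: contra bch => /eqP->.
  have [p0 pv] := hahn_mul_val bc0 a0.
  have lt : hahn_val ((b - c) * a) < al + d.
    rewrite pv addrC oz_ltD2l; apply: le_lt_trans hd; exact: hahn_val_le.
  have := hahn_val_neq0 p0; rewrite mulrBl hahnBE.
  by rewrite mulrBl in lt; rewrite gb // gc // subrr eqxx.
have good_le (b : hahn) (d d' : G) : d' <= d -> good b d -> good b d'.
  by move=> dd gb h hd; apply: gb; apply: lt_le_trans hd _; rewrite oz_leD2l.
have good_eq (b c : hahn) (d : G) : good b d -> (forall h, h < d -> b h = c h) -> good c d.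
  move=> gb bc h hd; rewrite -(gb h hd); apply/eqP; rewrite eq_sym -subr_eq0.
  rewrite -hahnBE -mulrBl mulrC.
  have [//|_ low] := @hahn_mul_low a (b - c) al d (@hahn_lt_val a).
    by move=> u ud; rewrite hahnBE bc // subrr.
  by rewrite low.
pose D (d : G) := exists b, good b d.
pose be (h : G) := xget 0 [set b : hahn | exists2 d, h < d & good b d].
pose B (h : G) := be h h.
have BE (b : hahn) (d h : G) : h < d -> good b d -> B h = b h.
  move=> hd gb; rewrite /B /be; case: xgetP => [c _ [d' hd' gc]|nog].
    apply: (@good_uniq _ _ (Order.min d d')); last by rewrite lt_min hd.
      by apply: good_le gc; rewrite ge_min lexx orbT.
    by apply: good_le gb; rewrite ge_min lexx.
  by case: (nog b); exists d.
have B0 (h : G) : B h != 0 -> exists2 d, h < d & D d.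
  rewrite /B /be; case: xgetP => [c _ [d hd gc] _|_]; first by exists d => //; exists c.
  by rewrite hahn0E eqxx.
have woB : B \in wo_support.
  apply/wo_supportP => A AB [x Ax]; have [d xd [b gb]] := B0 x (AB _ Ax).
  have [||m [Am mx] mmin] := @hahn_wo b (A `&` [set y | y <= x]).
  - move=> y [Ay yx] /=; rewrite -(BE b d) //; first exact: AB.
    exact: le_lt_trans xd.
  - by exists x; split=> //=.
  exists m => // y Ay; have [yx|xy] := leP y x; first by apply: mmin.
  exact: le_trans (ltW xy).
pose b0 : hahn := Hahn woB.
have gb0 (d : G) : D d -> good b0 d.
  by move=> [b gb]; apply: (good_eq _ _ _ gb) => h hd; rewrite [RHS](BE b d).
pose e (b : hahn) : hahn := 1 - b * a.
have good_e (b : hahn) : e b != 0 -> good b (hahn_val (e b) - al).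
  move=> eb h; rewrite addrC subrK => /hahn_lt_val; rewrite hahnBE => /eqP.
  by rewrite subr_eq0 eq_sym => /eqP.
have e_good (b : hahn) (d : G) : e b != 0 -> good b d -> al + d <= hahn_val (e b).
  move=> eb gb; rewrite leNgt; apply/negP => /gb; apply/eqP.
  by rewrite eq_sym -subr_eq0 -hahnBE hahn_val_neq0.
have [eb0|eb0] := eqVneq (e b0) 0.
  by exists b0; apply/eqP; rewrite eq_sym -subr_eq0; apply/eqP.
set eta := hahn_val (e b0).
pose c := e b0 eta / a al.
pose b1 := b0 + hahn_mono (eta - al) c.
have [eb1|eb1] := eqVneq (e b1) 0.
  by exists b1; apply/eqP; rewrite eq_sym -subr_eq0; apply/eqP.
have e1E : e b1 = e b0 - hahn_mono (eta - al) c * a.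
  by rewrite /e /b1 mulrDl opprD addrA.
have e1low (h : G) : h <= eta -> e b1 h = 0.
  rewrite e1E hahnBE [X in _ - X]hahn_mono_mulE le_eqVlt => /orP[/eqP->|hlt].
    have -> : eta - (eta - al) = al by rewrite opprB addrC subrK.
    by rewrite /c divfK ?subrr // hahn_val_neq0.
  rewrite hahn_lt_val // sub0r hahn_lt_val ?mulr0 ?oppr0 //.
  rewrite opprB addrCA -/al -[X in _ < X]addr0 oz_ltD2l.
  by rewrite -(oz_ltD2r eta (h - eta)) subrK add0r.
have eta1 : eta < hahn_val (e b1).
  by rewrite ltNge; apply/negP => /e1low/eqP; rewrite (negPf (hahn_val_neq0 eb1)).
have : D (hahn_val (e b1) - al) by exists b1; apply: good_e.
move=> /gb0 /(e_good _ _ eb0); rewrite addrC subrK leNgt.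
by rewrite -/eta eta1.
Qed.

Definition hahn_inv (a : hahn) : hahn := xget 0 [set b | b * a = 1].

Lemma hahn_mulVf a : a != 0 -> hahn_inv a * a = 1.
Proof.
move=> /hahn_inv_exists [b ba]; rewrite /hahn_inv; case: xgetP => [c _ //|noi].
by case: (noi b).
Qed.

Lemma hahn_inv0 : hahn_inv 0 = 0.
Proof.
rewrite /hahn_inv; case: xgetP => [c _ /= /eqP|//].
by rewrite mulr0 eq_sym oner_eq0.
Qed.

HB.instance Definition _ := GRing.ComNzRing_isField.Build hahn hahn_mulVf hahn_inv0.

Definition hahn_valring : {pred hahn} :=
  fun a => (a == 0) || (0 <= hahn_val a).

Lemma hahn_valringP (a : hahn) :
  reflect (forall g, g < 0 -> a g = 0) (a \in hahn_valring).
Proof.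
apply: (iffP orP) => [[/eqP->//|a0] g g0|h].
  by rewrite hahn_lt_val // (lt_le_trans g0).
have [|a0] := eqVneq a 0; [by left|right; rewrite leNgt].
by apply: contra (hahn_val_neq0 a0) => /h->.
Qed.

Lemma hahn_valring_subring : subring_closed hahn_valring.
Proof.
split=> [|a b /hahn_valringP a0 /hahn_valringP b0|a b /hahn_valringP a0 /hahn_valringP b0].
- by apply/hahn_valringP => g g0; rewrite hahn1E lt_eqF.
- by apply/hahn_valringP => g g0; rewrite hahnBE a0 // b0 // subrr.
have [_ low] := hahn_mul_low a0 b0.
by apply/hahn_valringP => g g0; apply: low; rewrite addr0.
Qed.

Lemma hahn_valringV (a : hahn) : a \notin hahn_valring -> a^-1 \in hahn_valring.
Proof.
rewrite negb_or => /andP[a0]; rewrite -ltNge => va.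
have [_ v] := hahn_mul_val a0 (invr_neq0 a0).
have one0 : hahn_val 1 = 0.
  apply/eqP/negPn/negP => v1; have := hahn_val_neq0 (oner_neq0 hahn).
  by rewrite hahn1E (negPf v1) eqxx.
apply/orP; right; rewrite leNgt; apply/negP => va'.
have : hahn_val a + hahn_val a^-1 < 0.
  by apply: lt_trans va; rewrite -[X in _ < X]addr0 oz_ltD2l.
by rewrite -v divff // one0 ltxx.
Qed.

HB.instance Definition _ :=
  isValuedField.Build hahn hahn_valring_subring hahn_valringV.

End HahnSeries.

Arguments hahn_wo {k G} a.

Section HahnMap.
Variables (k l : fieldType) (G H : orderedZmodType).
Variables (f : {rmorphism k -> l}) (phi : {oembedding G -> H}).

(* Transports coefficients along [f] and exponents along [phi], padding with zero
   outside the image of [phi]. This is the inclusion of k((G)) in l((H)). *)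
Definition hahn_map_fun (a : G -> k) (h : H) : l :=
  if pselect (exists g, phi g = h) is left ex then f (a (sval (cid ex))) else 0.

Lemma hahn_map_funE a g : hahn_map_fun a (phi g) = f (a g).
Proof.
rewrite /hahn_map_fun; case: pselect => [ex|[]]; last by exists g.
by case: cid => g' /= /oe_inj ->.
Qed.

Lemma hahn_map_fun_out a h : (forall g, phi g <> h) -> hahn_map_fun a h = 0.
Proof.
by move=> hout; rewrite /hahn_map_fun; case: pselect => // ex; have [g /hout] := ex.
Qed.

Lemma hahn_map_fun_neq0 a h : hahn_map_fun a h != 0 -> exists2 g, phi g = h & a g != 0.
Proof.
have [[g <-]|nh] := pselect (exists g, phi g = h).
  by rewrite hahn_map_funE fmorph_eq0; exists g.
by rewrite hahn_map_fun_out ?eqxx // => g gh; apply: nh; exists g.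
Qed.

Lemma hahn_map_subproof (a : hahn k G) : hahn_map_fun a \in @wo_support l H.
Proof.
apply/wo_supportP => A Aa [x Ax].
have [||m Am mmin] := @hahn_wo _ _ a [set g | A (phi g)].
- by move=> g /Aa /=; rewrite hahn_map_funE fmorph_eq0.
- by have [g gx _] := hahn_map_fun_neq0 (Aa _ Ax); exists g; rewrite /= gx.
exists (phi m) => // y Ay; have [g gy _] := hahn_map_fun_neq0 (Aa _ Ay).
by rewrite -gy oe_le; apply: mmin; rewrite /= gy.
Qed.

Definition hahn_map (a : hahn k G) : hahn l H := Hahn (hahn_map_subproof a).

Lemma hahn_mapE a g : hahn_map a (phi g) = f (a g).
Proof. exact: hahn_map_funE. Qed.

Lemma hahn_map_out a h : (forall g, phi g <> h) -> hahn_map a h = 0.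
Proof. exact: hahn_map_fun_out. Qed.

Lemma hahn_map_eq (a : hahn k G) (b : hahn l H) :
  (forall g, b (phi g) = f (a g)) -> (forall h, (forall g, phi g <> h) -> b h = 0) ->
  hahn_map a = b.
Proof.
move=> ba b0; apply: hahnP => h; have [[g <-]|nh] := pselect (exists g, phi g = h).
  by rewrite hahn_mapE ba.
have hout g : phi g <> h by move=> gh; apply: nh; exists g.
by rewrite hahn_map_out ?b0.
Qed.

Lemma hahn_map_zmod_morphism : zmod_morphism hahn_map.
Proof.
move=> a b; apply: hahn_map_eq => [g|h hout].
  by rewrite hahnBE !hahn_mapE hahnBE rmorphB.
by rewrite hahnBE !hahn_map_out ?subrr.
Qed.

Lemma hahn_map_monoid_morphism : monoid_morphism hahn_map.
Proof.
split=> [|a b]; apply: hahn_map_eq => [g|h hout].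
- by rewrite !hahn1E -(raddf0 phi) (inj_eq (@oe_inj _ _ phi)); case: eqP; rewrite ?rmorph1 ?rmorph0.
- by rewrite hahn1E; case: eqP => // h0; case: (hout 0); rewrite raddf0 h0.
- have [X sX] := wo_fset g (hahn_wo a) (hahn_wo b).
  rewrite (@hahn_mulE _ _ _ _ _ X) // rmorph_sum.
  rewrite (@hahn_mulE _ _ _ _ _ [fset phi x | x in X]%fset) /=.
    rewrite big_imfset /=; last by move=> x y _ _ /oe_inj.
    by apply: eq_bigr => u _; rewrite rmorphM -raddfB !hahn_map_funE.
  move=> u /hahn_map_fun_neq0 [x <- ax]; rewrite -raddfB hahn_map_funE fmorph_eq0 => bx.
  by apply/imfsetP; exists x => //; apply: sX.
apply/eqP/negPn/negP => /hahn_conv_neq0 [u [v []]].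
move=> /hahn_map_fun_neq0 [x <- _] /hahn_map_fun_neq0 [y <- _] hE.
by apply: (hout (x + y)); rewrite raddfD hE.
Qed.

HB.instance Definition _ :=
  GRing.isZmodMorphism.Build (hahn k G) (hahn l H) hahn_map hahn_map_zmod_morphism.
HB.instance Definition _ :=
  GRing.isMonoidMorphism.Build (hahn k G) (hahn l H) hahn_map hahn_map_monoid_morphism.

Lemma hahn_map_valring a : (hahn_map a \in valring) = (a \in valring).
Proof.
apply/hahn_valringP/hahn_valringP => a0 g g0.
  by apply/eqP; rewrite -(fmorph_eq0 f) -hahn_mapE a0 // -(raddf0 phi) (leW_mono (@oe_le _ _ phi)).
apply/eqP/negPn/negP => /hahn_map_fun_neq0 [x xg ax]; move: ax; rewrite a0 ?eqxx //.
by rewrite -(leW_mono (@oe_le _ _ phi)) raddf0 xg.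
Qed.

HB.instance Definition _ :=
  isValuedMorphism.Build (hahn k G) (hahn l H) hahn_map hahn_map_valring.

End HahnMap.

(* Main.v *)
(** The residue map and the valuation of a real closed valued field L have
    sections c and s that are morphisms, and those of K can be extended to L.
    Both are obtained from Zorn's lemma; the residue section needs Hensel's
    lemma in L, which is the intermediate value theorem.

    With k real closed and G divisible, the field H of Hahn series is real
    closed for the lexicographic order: by Hensel's lemma, proved with a fixed
    point argument, a monic polynomial of degree at least 2 over H either
    factors or is positive everywhere.

    An embedding of L into H is the graph of a subring of L x H on which the
    signs of the two components agree.  Start from the subring generated by
    (c r, r), (s g, x^g) and the graph of the embedding of K: cancelling leading
    terms shows that signs agree there.  A maximal sign-matching subring is a
    graph defined on all of L.  First, an algebraic element of either side has a
    partner on the other side, by induction on the degree: the roots of the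
    derivative are already matched, so sign changes correspond.  Then, for any x
    in L, the coefficients of an element y of H in the same cut are read off from
    the residues of (x - a) / s g, for a in the domain.  Since the graph contains
    all (c r, r) and (s g, x^g), matching signs forces matching valuations. *)

Require Import Defs.
From HB Require Import structures.
From mathcomp Require Import all_boot all_order all_algebra.
From mathcomp Require Import boolp classical_sets.
From mathcomp Require Import polyrcf ring zify.

Set Implicit Arguments.
Unset Strict Implicit.
Unset Printing Implicit Defensive.

Import Order.TTheory GRing.Theory Num.Theory.

Local Open Scope classical_set_scope.
Local Open Scope ring_scope.

(** * Fixed points and Hensel's lemma for Hahn series *)

(** Embeddings chosen independently for K and L need not commute with the inclusion, so that of L is
    built over that of K, by one statement used twice: the given subfield is the residue field,
    embedded as constants, for K, and K itself for L. The crux is that the sections of L prolong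
    those of K. Each nonzero element of K then shares its leading monomial with another element of K
    whose two images are exactly this monomial. Hence a vanishing sum of leading terms lifts to an
    exact linear relation with coefficients in K, and multiples of it eliminate summands.

    A partial embedding is a subring of the product rather than a map with a domain. This treats
    both sides symmetrically, makes unions of chains harmless, and turns the adjunction of one
    element into a condition on polynomial values. Sign agreement makes such a subring the graph of
    an injection, because only 0 has sign 0. The price is a ring with zero divisors, so division is
    by monic polynomials only, and polynomials are compared with their two projections. *)

Section OrderedZmodMore.
Variable G : orderedZmodType.
Implicit Types g h : G.

Lemma oz_leD g g' h h' : g <= g' -> h <= h' -> g + h <= g' + h'.
Proof.
by move=> gg hh; apply: (@le_trans _ _ (g + h')); rewrite ?oz_leD2r ?oz_leD2l.
Qed.

Lemma oz_ltleD g g' h h' : g < g' -> h <= h' -> g + h < g' + h'.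
Proof.
by move=> gg hh; apply: (@le_lt_trans _ _ (g + h')); rewrite ?oz_ltD2r ?oz_leD2l.
Qed.

Lemma oz_subr_gt0 g h : (0 < h - g) = (g < h).
Proof. by rewrite -(oz_ltD2r g 0) add0r subrK. Qed.

Lemma oz_lt_mulrn n g h : (0 < n)%N -> (g *+ n < h *+ n) = (g < h).
Proof.
case: n => // n _; have mono g' h' : g' <= h' -> g' *+ n <= h' *+ n.
  by move=> gh; elim: n => [|n IHn]; rewrite ?mulr0n // !mulrS oz_leD.
have [gh|hg] := ltP g h; first by rewrite !mulrS oz_ltleD ?mono ?ltW.
by apply/negbTE; rewrite -leNgt !mulrS oz_leD ?mono.
Qed.

Lemma oz_le_mulrn n g h : (0 < n)%N -> (g *+ n <= h *+ n) = (g <= h).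
Proof. by move=> n0; rewrite !leNgt oz_lt_mulrn. Qed.

Lemma oz_mulrn_inj n g h : (0 < n)%N -> g *+ n = h *+ n -> g = h.
Proof.
move=> n0 e; apply/eqP.
by rewrite eq_le -(oz_le_mulrn g h n0) -(oz_le_mulrn h g n0) e lexx.
Qed.

Lemma wo_set_finU (I : finType) (S : I -> set G) :
  (forall i, wo_set (S i)) -> wo_set [set g | exists i, S i g].
Proof.
move=> woS; suff woseq (s : seq I) : wo_set [set g | exists2 i, i \in s & S i g].
  apply: wo_sub (woseq (enum I)) => g [i Sig] /=.
  by exists i => //; rewrite mem_enum.
elim: s => [|i s IHs]; first by move=> A A0 [x /A0[]].
apply: wo_sub (wo_setU (woS i) IHs) => g /= [j].
by rewrite inE => /orP[/eqP->|js] Sjg; [left|right; exists j].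
Qed.

End OrderedZmodMore.

Section HahnMore.
Variables (k : fieldType) (G : orderedZmodType).
Implicit Types (a b : hahn k G) (g h : G) (r : k).

(** Order at least [g], phrased through coefficients so that the zero series belongs to it whatever
    the junk value of [hahn_val 0]. *)
Definition hahn_ge g : {pred hahn k G} := fun a => `[< forall h, h < g -> a h = 0 >].

Lemma hahn_geP g a : reflect (forall h, h < g -> a h = 0) (a \in hahn_ge g).
Proof. exact: asboolP. Qed.

Lemma hahn_ge_zmod g : zmod_closed (hahn_ge g).
Proof.
split=> [|a b /hahn_geP ag /hahn_geP bg]; apply/hahn_geP => h hg //.
by rewrite hahnBE ag ?bg ?subrr.
Qed.

HB.instance Definition _ g :=
  GRing.isZmodClosed.Build (hahn k G) (hahn_ge g) (hahn_ge_zmod g).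

Lemma hahn_ge_valring : hahn_ge 0 =i valring.
Proof. by move=> a; apply/hahn_geP/hahn_valringP. Qed.

Lemma hahn_ge_le g h a : g <= h -> a \in hahn_ge h -> a \in hahn_ge g.
Proof.
move=> gh /hahn_geP ah; apply/hahn_geP => x xg; apply: ah; exact: lt_le_trans gh.
Qed.

Lemma hahn_ge_val a : a \in hahn_ge (hahn_val a).
Proof. by apply/hahn_geP => h; apply: hahn_lt_val. Qed.

Lemma hahn_ge_lt g a : a != 0 -> (a \in hahn_ge g) = (g <= hahn_val a).
Proof.
move=> a0; apply/idP/idP => [/hahn_geP ag|gv]; last exact: hahn_ge_le gv (hahn_ge_val a).
by rewrite leNgt; apply/negP => /ag; apply/eqP/hahn_val_neq0.
Qed.

Lemma hahn_val_unique a g : a \in hahn_ge g -> a g != 0 -> hahn_val a = g.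
Proof.
move=> ag ag0; have a0 : a != 0 by apply: contra_neq ag0 => ->.
by apply: le_anti; rewrite hahn_val_le //= -hahn_ge_lt.
Qed.

Lemma hahn_mul_coef g h a b : a \in hahn_ge g -> b \in hahn_ge h ->
  (a * b) (g + h) = a g * b h.
Proof. by move=> /hahn_geP ag /hahn_geP bh; have [] := hahn_mul_low ag bh. Qed.

Lemma hahn_geM g h a b : a \in hahn_ge g -> b \in hahn_ge h ->
  a * b \in hahn_ge (g + h).
Proof.
by move=> /hahn_geP ag /hahn_geP bh; apply/hahn_geP; have [] := hahn_mul_low ag bh.
Qed.

Lemma hahn_monoM g h r (s : k) :
  hahn_mono g r * hahn_mono h s = hahn_mono (g + h) (r * s) :> hahn k G.
Proof.
apply: hahnP => x; rewrite [LHS]hahn_mono_mulE !hahn_monoE.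
have -> : (x - g == h) = (x == g + h).
  by rewrite -(inj_eq (addIr g)) subrK addrC.
by case: eqP; rewrite ?mulr0.
Qed.

Lemma hahn_mono_ge g r : hahn_mono g r \in hahn_ge g.
Proof. by apply/hahn_geP => h hg; rewrite hahn_monoE lt_eqF. Qed.

Lemma hahn_mono_eq0 g r : (hahn_mono g r == 0 :> hahn k G) = (r == 0).
Proof.
apply/eqP/eqP => [/(congr1 (fun a : hahn k G => a g))|->].
  by rewrite hahn_monoE eqxx.
by apply: hahnP => h; rewrite hahn_monoE; case: eqP.
Qed.

Definition hahn_const r : hahn k G := hahn_mono 0 r.

Lemma hahn_const_zmod_morphism : zmod_morphism hahn_const.
Proof.
move=> r s; apply: hahnP => g; rewrite hahnBE !hahn_monoE.
by case: eqP; rewrite ?subrr.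
Qed.

Lemma hahn_const_monoid_morphism : monoid_morphism hahn_const.
Proof. by split=> // r s; rewrite /hahn_const hahn_monoM addr0. Qed.

HB.instance Definition _ :=
  GRing.isZmodMorphism.Build k (hahn k G) hahn_const hahn_const_zmod_morphism.
HB.instance Definition _ :=
  GRing.isMonoidMorphism.Build k (hahn k G) hahn_const hahn_const_monoid_morphism.

Lemma hahn_const_ge r : hahn_const r \in hahn_ge 0.
Proof. exact: hahn_mono_ge. Qed.

Lemma hahn_const0 r : hahn_const r 0 = r.
Proof. by rewrite /hahn_const hahn_monoE eqxx. Qed.

(* Gluing: approximations that are fixed up to [g] agree up to [g], and the
   series glued from all of them is the fixed point. *)
Lemma hahn_fixpoint (I : finType) (T : (I -> hahn k G) -> I -> hahn k G) :
  let D (f : I -> hahn k G) := forall i h, h <= 0 -> f i h = 0 in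
  (forall f, D f -> D (T f)) ->
  (forall f f' g, D f -> D f' -> (forall i h, h < g -> f i h = f' i h) ->
    forall i, T f i g = T f' i g) ->
  exists2 f, D f & forall i, T f i = f i.
Proof.
move=> D TD contr.
pose good (f : I -> hahn k G) g := D f /\ forall i h, h <= g -> f i h = T f i h.
have mindiff (f f' : I -> hahn k G) i : f i <> f' i -> exists2 g,
    (exists i, f i g <> f' i g) & forall i h, h < g -> f i h = f' i h.
  move=> ff'.
  have wod : wo_set [set g | exists i, (f i - f' i) g != 0].
    by apply: wo_set_finU => j; exact: hahn_wo.
  have [|m [j fm] mmin] := wod _ (@subset_refl _ _).
    have [h fh] : exists h, (f i - f' i) h != 0.
      apply: contra_notP ff' => nh; apply: hahnP => h; apply/eqP.
      rewrite -subr_eq0 -hahnBE; apply/negPn/negP => fh; apply: nh; by exists h.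
    by exists h, i.
  exists m; first by exists j; apply/eqP; rewrite -subr_eq0 -hahnBE.
  move=> l h hm; apply/eqP; rewrite -subr_eq0 -hahnBE; apply/negPn/negP => fh.
  by have := mmin h (ex_intro _ l fh); rewrite leNgt hm.
have good_le f g h : h <= g -> good f g -> good f h.
  by move=> hg [Df fg]; split=> // i x xh; apply: fg; apply: le_trans hg.
(* At the first exponent of disagreement the two families agree below, so contraction makes their
   images under [T] agree there, and goodness identifies them. *)
have uniq f f' g i : good f g -> good f' g -> f i g = f' i g.
  move=> [Df fg] [Df' fg']; apply: contrapT => ne.
  have [|m [j fm] low] := @mindiff f f' i; first by move=> e; apply: ne; rewrite e.
  have mg : m <= g by rewrite leNgt; apply/negP => gm; apply: ne; apply: low.
  by apply: fm; rewrite fg // fg' //; apply: contr.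
(* The default 0 adds nothing to the support and keeps the glued family in [D]. *)
pose z h := xget (fun=> 0) [set f | good f h].
have zE f h i : good f h -> z h i h = f i h.
  move=> gf; rewrite /z; case: xgetP => [f' _ gf'|nf]; first exact: uniq.
  by case: (nf f).
have woz i : (fun h => z h i h) \in @wo_support k G.
  apply/wo_supportP => A AZ [x Ax].
  have [f gf] : exists f, good f x.
    have := AZ x Ax; rewrite /= /z; case: xgetP => [f _ gf _|_]; first by exists f.
    by rewrite hahn0E eqxx.
  have [||m [Am mx] mmin] := @hahn_wo _ _ (f i) (A `&` [set y | y <= x]).
  - by move=> y [Ay yx] /=; rewrite -zE; [exact: AZ|exact: good_le gf].
  - by exists x; split=> //=.
  exists m => // y Ay; have [yx|xy] := leP y x; first by apply: mmin.
  exact: le_trans (ltW xy).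
pose Z i : hahn k G := Hahn (woz i).
have DZ : D Z.
  move=> i h h0; rewrite /= /z; case: xgetP => [f _ [Df _]|_]; first exact: Df.
  exact: hahn0E.
(* Approximations are not known beforehand to reach every exponent. At the first exponent [m] where
   [T Z] and [Z] differ, however, [T Z] is itself good up to [m], so the glued family takes its
   value there. *)
exists Z => // i; apply: contrapT => /(@mindiff (T Z) Z i)[m [j Tm] low].
apply: Tm; rewrite [RHS](zE (T Z)) //; split; first exact: TD.
move=> l h hm; apply: contr => // [|l' x xh]; first exact: TD.
by rewrite low // (lt_le_trans xh).
Qed.

End HahnMore.

Ltac size_lia :=
  repeat match goal with |- context [size (polyseq ?p)] =>
    move: (size (polyseq p)) => ? end; lia.

Section HahnHensel.
Variables (k : fieldType) (G : orderedZmodType).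
Implicit Types (a b : hahn k G) (g h : G) (r : k).

Definition hahn_at g a : k := a g.

Lemma hahn_at_zmod_morphism g : zmod_morphism (hahn_at g).
Proof. by move=> a b; apply: hahnBE. Qed.

HB.instance Definition _ g :=
  GRing.isZmodMorphism.Build (hahn k G) k (hahn_at g) (hahn_at_zmod_morphism g).

Lemma hahn_atE g a : a g = hahn_at g a. Proof. by []. Qed.

Definition hahn_gt g : {pred hahn k G} := fun a => `[< forall h, h <= g -> a h = 0 >].

Lemma hahn_gtP g a : reflect (forall h, h <= g -> a h = 0) (a \in hahn_gt g).
Proof. exact: asboolP. Qed.

Lemma hahn_gt_zmod g : zmod_closed (hahn_gt g).
Proof.
split=> [|a b /hahn_gtP ag /hahn_gtP bg]; apply/hahn_gtP => h hg //.
by rewrite hahnBE ag ?bg ?subrr.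
Qed.

HB.instance Definition _ g :=
  GRing.isZmodClosed.Build (hahn k G) (hahn_gt g) (hahn_gt_zmod g).

Lemma hahn_gtE g a : (a \in hahn_gt g) = (a \in hahn_ge g) && (a g == 0).
Proof.
apply/hahn_gtP/andP => [ag|[/hahn_geP ag /eqP ag0] h].
  by split; [apply/hahn_geP => h /ltW/ag|rewrite ag].
by rewrite le_eqVlt => /orP[/eqP->|/ag].
Qed.

Lemma hahn_gtW g a : a \in hahn_gt g -> a \in hahn_ge g.
Proof. by rewrite hahn_gtE => /andP[]. Qed.

Lemma hahn_ge_gt g h a : g < h -> a \in hahn_ge h -> a \in hahn_gt g.
Proof.
move=> gh /hahn_geP ah; apply/hahn_gtP => x xg; apply: ah; exact: le_lt_trans gh.
Qed.

Lemma hahn_gtMr g h a b : a \in hahn_ge g -> b \in hahn_gt h -> a * b \in hahn_gt (g + h).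
Proof.
rewrite !hahn_gtE => ag /andP[bh /eqP b0].
by rewrite hahn_geM // (hahn_mul_coef ag bh) b0 mulr0 eqxx.
Qed.

Lemma hahn_gtMl g h a b : a \in hahn_gt g -> b \in hahn_ge h -> a * b \in hahn_gt (g + h).
Proof. by move=> ag bh; rewrite mulrC addrC hahn_gtMr. Qed.

Lemma hahn_geM0 g a b : a \in hahn_ge g -> b \in hahn_ge 0 -> a * b \in hahn_ge g.
Proof. by move=> ag b0; rewrite -[g]addr0 hahn_geM. Qed.

Lemma hahn_mul_coef0 g a b : a \in hahn_ge g -> b \in hahn_ge 0 ->
  (a * b) g = a g * b 0.
Proof. by move=> ag b0; rewrite -(hahn_mul_coef ag b0) addr0. Qed.

Lemma hahn_gtM0 g a b : a \in hahn_ge g -> b \in hahn_gt 0 -> a * b \in hahn_gt g.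
Proof. by move=> ag b0; rewrite -[g]addr0 hahn_gtMr. Qed.

Lemma hahn_gtMl0 g a b : a \in hahn_gt g -> b \in hahn_ge 0 -> a * b \in hahn_gt g.
Proof. by move=> ag b0; rewrite -[g]addr0 hahn_gtMl. Qed.

Lemma hahn_geX g a n : a \in hahn_ge g -> a ^+ n \in hahn_ge (g *+ n).
Proof.
move=> ag; elim: n => [|n IHn]; last by rewrite exprS mulrS hahn_geM.
by rewrite expr0 mulr0n; exact: (hahn_const_ge G 1).
Qed.

Lemma hahn_coefX g a n : a \in hahn_ge g -> (a ^+ n) (g *+ n) = a g ^+ n.
Proof.
move=> ag; elim: n => [|n IHn]; last by rewrite !exprS mulrS hahn_mul_coef ?hahn_geX ?IHn.
by rewrite !expr0 mulr0n hahn1E eqxx.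
Qed.

(** Reduction modulo the maximal ideal when all coefficients have order at least 0; on other
    polynomials merely additive. *)
Definition hahn_polyres (p : {poly hahn k G}) : {poly k} := map_poly (hahn_at 0) p.

Lemma coef_polyres p i : (hahn_polyres p)`_i = p`_i 0.
Proof. by rewrite coef_map. Qed.

Lemma size_monic_polyres p : p \is monic -> size (hahn_polyres p) = size p.
Proof.
move=> /monicP pm; apply: size_map_poly_id0.
by rewrite pm /hahn_at hahn1E eqxx oner_neq0.
Qed.

Lemma monic_polyres p : p \is monic -> hahn_polyres p \is monic.
Proof.
move=> pm; apply/monicP.
rewrite lead_coefE size_monic_polyres // coef_polyres -lead_coefE (monicP pm).
by rewrite hahn1E eqxx.
Qed.

Lemma horner_polyres p x : p \is a polyOver (hahn_ge 0) -> x \in hahn_ge 0 ->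
  p.[x] \in hahn_ge 0 /\ p.[x] 0 = (hahn_polyres p).[x 0].
Proof.
move=> /polyOverP pV xV; rewrite horner_coef.
have termV (i : nat) : p`_i * x ^+ i \in hahn_ge 0.
  by apply: hahn_geM0 => //; have := hahn_geX i xV; rewrite mul0rn.
split; first exact: rpred_sum.
have sz : (size (hahn_polyres p) <= size p)%N by exact: size_poly.
rewrite (horner_coef_wide _ sz) hahn_atE raddf_sum; apply: eq_bigr => i _.
have xi : x ^+ i \in hahn_ge 0 by have := hahn_geX i xV; rewrite mul0rn.
rewrite [LHS](hahn_mul_coef0 (pV i) xi) coef_polyres.
by have := hahn_coefX i xV; rewrite mul0rn => ->.
Qed.

(** Reduce one Bezout cofactor modulo [g0] and move the quotient into the other; the degree of the
    latter is then forced by [g0 * w = f - h0 * u], as [g0] is monic. *)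
Lemma coprime_bezout_size (g0 h0 f : {poly k}) : g0 \is monic -> h0 \is monic ->
  coprimep g0 h0 -> (size f <= (size g0).-1 + (size h0).-1)%N ->
  exists wu : {poly k} * {poly k}, [/\ f = g0 * wu.1 + h0 * wu.2, (size wu.1 <= (size h0).-1)%N
    & (size wu.2 <= (size g0).-1)%N].
Proof.
move=> g0m h0m /Bezout_eq1_coprimepP[[u1 u2] /= bez] szf.
have g00 := monic_neq0 g0m; have h00 := monic_neq0 h0m.
have sg0 : (0 < size g0)%N by rewrite size_poly_gt0.
have sh0 : (0 < size h0)%N by rewrite size_poly_gt0.
pose u := (f * u2) %% g0; pose w := f * u1 + ((f * u2) %/ g0) * h0.
have fE : f = g0 * w + h0 * u.
  rewrite -[LHS]mulr1 -bez mulrDr !mulrA {1}(divp_eq (f * u2) g0) -/u /w.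
  by rewrite !mulrDr !mulrDl; ring.
have su : (size u <= (size g0).-1)%N by rewrite -ltnS prednK // ltn_modp.
exists (w, u); split=> //=; have [->|w0] := eqVneq w 0; first by rewrite size_poly0.
have : (size (g0 * w)%R <= (size g0).-1 + (size h0).-1)%N.
  have -> : g0 * w = f - h0 * u by rewrite fE addrK.
  apply: leq_trans (size_polyD _ _) _; rewrite geq_max szf size_polyN.
  apply: leq_trans (size_polyMleq _ _) _.
  move: su sg0 sh0; size_lia.
by rewrite size_monicM //; move: sg0 sh0; size_lia.
Qed.

(** The factors are sought as [g0 + U] and [h0 + W] with [U], [W] infinitesimal of lower degree.
    With [e = p - g0 * h0] the equation is [g0 * W + h0 * U = e - U * W]. Bezout over [k]
    parametrises [U] and [W] linearly by the coefficients of the left side, so these coefficients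
    solve a fixed point equation, which contracts because [U * W] is a product of infinitesimals. *)
Lemma hahn_hensel (p : {poly hahn k G}) (g0 h0 : {poly k}) :
    p \is monic -> p \is a polyOver (hahn_ge 0) ->
    g0 \is monic -> h0 \is monic -> coprimep g0 h0 -> hahn_polyres p = g0 * h0 ->
  exists q1 q2, [/\ p = q1 * q2, size q1 = size g0 & size q2 = size h0].
Proof.
move=> pm pV g0m h0m cop pE.
have g00 := monic_neq0 g0m; have h00 := monic_neq0 h0m.
have sg0 : (0 < size g0)%N by rewrite size_poly_gt0.
have sh0 : (0 < size h0)%N by rewrite size_poly_gt0.
pose N := ((size g0).-1 + (size h0).-1)%N.
have szp : size p = N.+1.
  by rewrite -size_monic_polyres // pE size_monicM // /N; move: sg0 sh0; size_lia.
have bez (j : 'I_N) : exists wu : {poly k} * {poly k}, [/\ 'X^j = g0 * wu.1 + h0 * wu.2,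
    (size wu.1 <= (size h0).-1)%N & (size wu.2 <= (size g0).-1)%N].
  by apply: coprime_bezout_size => //; rewrite size_polyXn.
pose wu j := sval (cid (bez j)).
have wuP (j : 'I_N) : [/\ 'X^j = g0 * (wu j).1 + h0 * (wu j).2,
    (size (wu j).1 <= (size h0).-1)%N & (size (wu j).2 <= (size g0).-1)%N].
  exact: (svalP (cid (bez j))).
pose C := map_poly (@hahn_const k G).
pose lin (v : 'I_N -> {poly k}) (f : 'I_N -> hahn k G) : {poly hahn k G} := \sum_j f j *: C (v j).
have linB v f f' : lin v f - lin v f' = lin v (fun j => f j - f' j).
  by rewrite /lin -sumrB; apply: eq_bigr => j _; rewrite scalerBl.
have lin_size (v : 'I_N -> {poly k}) d f : (forall j, (size (v j) <= d)%N) -> (size (lin v f) <= d)%N.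
  move=> vd; apply: leq_trans (size_sum _ _ _) _; apply/bigmax_leqP => j _.
  by apply: leq_trans (size_scale_leq _ _) _; rewrite size_map_poly.
have lin_ge v f g : (forall j, f j \in hahn_ge g) -> lin v f \is a polyOver (hahn_ge g).
  move=> fg; apply/polyOverP => i; rewrite coef_sum; apply: rpred_sum => j _.
  by rewrite coefZ coef_map hahn_geM0 ?hahn_const_ge.
have lin_gt v f g : (forall j, f j \in hahn_gt g) -> lin v f \is a polyOver (hahn_gt g).
  move=> fg; apply/polyOverP => i; rewrite coef_sum; apply: rpred_sum => j _.
  by rewrite coefZ coef_map hahn_gtMl0 ?hahn_const_ge.
pose W := lin (fun j => (wu j).1); pose U := lin (fun j => (wu j).2).
have solve f : C g0 * W f + C h0 * U f = \poly_(j < N) (if insub j is Some i then f i else 0).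
  rewrite poly_def /W /U /lin !mulr_sumr -big_split /=; apply: eq_bigr => j _.
  rewrite -!scalerAr -scalerDr /C -!rmorphM -rmorphD /=.
  by have [<- _ _] := wuP j; rewrite map_polyXn valK.
pose e := p - C g0 * C h0.
have Cg0m : C g0 \is monic by rewrite map_monic.
have Ch0m : C h0 \is monic by rewrite map_monic.
have sze : (size e <= N)%N.
  have lc : lead_coef (C g0 * C h0) = 1 by apply/monicP; rewrite monicMl.
  have szgh : size (C g0 * C h0) = N.+1.
    by rewrite size_monicM ?monic_neq0 // !size_map_poly /N; move: sg0 sh0; size_lia.
  apply/leq_sizeP => j; rewrite leq_eqVlt => /orP[/eqP <-|Nj].
    rewrite coefB; have := monicP pm; rewrite lead_coefE szp /= => ->.
    by move: lc; rewrite lead_coefE szgh /= => ->; rewrite subrr.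
  by rewrite nth_default // (leq_trans (size_polyD _ _)) // size_polyN szp szgh maxnn.
have eV : e \is a polyOver (hahn_gt 0).
  apply/polyOverP => i; rewrite hahn_gtE; apply/andP; split.
    by rewrite coefB rpredB ?(polyOverP pV) // -rmorphM coef_map; exact: hahn_const_ge.
  rewrite coefB hahnBE -rmorphM coef_map -coef_polyres pE /=.
  by rewrite [X in _ - X]hahn_const0 subrr.
pose T f (i : 'I_N) := (e - U f * W f)`_i.
have gtM g (P Q : {poly hahn k G}) : P \is a polyOver (hahn_ge g) ->
    Q \is a polyOver (hahn_gt 0) -> P * Q \is a polyOver (hahn_gt g).
  move=> /polyOverP Pg /polyOverP Q0; apply/polyOverP => i; rewrite coefM.
  by apply: rpred_sum => j _; rewrite hahn_gtM0.
have [f|f f' g Df Df' ff' i|f Df Tf] := @hahn_fixpoint k G _ T.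
- move=> Df i h h0'; suff : T f i \in hahn_gt 0 by move=> /hahn_gtP; apply.
  have fV j : f j \in hahn_gt 0 by apply/hahn_gtP => x; apply: Df.
  rewrite /T coefB rpredB ?(polyOverP eV) // (polyOverP (gtM 0 _ _ _ _)) //.
    by apply: lin_ge => j; apply: hahn_gtW.
  exact: lin_gt.
- apply/eqP; rewrite eq_sym -subr_eq0 -hahnBE /T -coefB.
  suff /polyOverP/(_ i)/hahn_gtP -> // :
    e - U f' * W f' - (e - U f * W f) \is a polyOver (hahn_gt g) by [].
  (* Each summand has one factor of order at least [g], coming from [f - f'], and one infinitesimal
     factor, so its coefficients at [g] vanish. *)
  have -> : e - U f' * W f' - (e - U f * W f) =
     (U f - U f') * W f + (W f - W f') * U f' by ring.
  have dV j : f j - f' j \in hahn_ge g.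
    by apply/hahn_geP => x xg; rewrite hahnBE ff' ?subrr.
  have fV j : f j \in hahn_gt 0 by apply/hahn_gtP => x; apply: Df.
  have fV' j : f' j \in hahn_gt 0 by apply/hahn_gtP => x; apply: Df'.
  by rewrite rpredD // gtM // ?linB ?lin_ge ?lin_gt.
have sW : (size (W f) <= (size h0).-1)%N by apply: lin_size => j; have [] := wuP j.
have sU : (size (U f) <= (size g0).-1)%N by apply: lin_size => j; have [] := wuP j.
exists (C g0 + U f), (C h0 + W f); split.
- suff fE : C g0 * W f + C h0 * U f = e - U f * W f.
    transitivity (C g0 * C h0 + (C g0 * W f + C h0 * U f) + U f * W f); last by ring.
    by rewrite fE /e; ring.
  rewrite solve; apply/polyP => i; rewrite coef_poly; case: ltnP => iN.
    by rewrite insubT /= -[LHS]Tf.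
  rewrite nth_default //; apply: leq_trans iN.
  apply: leq_trans (size_polyD _ _) _; rewrite geq_max sze size_polyN.
  apply: leq_trans (size_polyMleq _ _) _; rewrite /N; move: sU sW sg0 sh0; size_lia.
- by rewrite size_polyDl size_map_poly //; move: sU sg0; case: (size g0).
- by rewrite size_polyDl size_map_poly //; move: sW sh0; case: (size h0).
Qed.

End HahnHensel.

(** * The lexicographic order on Hahn series *)

Section HahnOrder.
Variables (k : realFieldType) (G : orderedZmodType).
Implicit Types (a b : hahn k G) (g h : G) (r : k).

(** It determines the sign of a series. The junk exponent [hahn_val 0] is harmless, since the zero
    series vanishes at every exponent. *)
Definition hahn_lc a : k := a (hahn_val a).

Lemma hahn_lc0 : hahn_lc 0 = 0. Proof. exact: hahn0E. Qed.

Lemma hahn_lc_eq0 a : (hahn_lc a == 0) = (a == 0).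
Proof.
have [->|a0] := eqVneq a 0; first by rewrite hahn_lc0 eqxx.
by apply/negbTE/hahn_val_neq0.
Qed.

Lemma hahn_lc_unique a g : a \in hahn_ge g -> a g != 0 -> hahn_lc a = a g.
Proof. by move=> ag ag0; rewrite /hahn_lc (hahn_val_unique ag). Qed.

Lemma hahn_lcN a : hahn_lc (- a) = - hahn_lc a.
Proof.
have [->|a0] := eqVneq a 0; first by rewrite oppr0 hahn_lc0 oppr0.
rewrite (@hahn_lc_unique _ (hahn_val a)) ?hahnNE //.
  by rewrite rpredN hahn_ge_val.
by rewrite oppr_eq0 hahn_val_neq0.
Qed.

Lemma hahn_lcM a b : hahn_lc (a * b) = hahn_lc a * hahn_lc b.
Proof.
have [->|a0] := eqVneq a 0; first by rewrite mul0r hahn_lc0 mul0r.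
have [->|b0] := eqVneq b 0; first by rewrite mulr0 hahn_lc0 mulr0.
rewrite -[RHS](hahn_mul_coef (hahn_ge_val a) (hahn_ge_val b)).
by rewrite /hahn_lc; have [_ ->] := hahn_mul_val a0 b0.
Qed.

Definition hahn_le a b := 0 <= hahn_lc (b - a).
Definition hahn_lt a b := (b != a) && hahn_le a b.
Definition hahn_norm a := if 0 <= hahn_lc a then a else - a.

Let le0E a : hahn_le 0 a = (0 <= hahn_lc a).
Proof. by rewrite /hahn_le subr0. Qed.

Let leE0 a : hahn_le a 0 = (hahn_lc a <= 0).
Proof. by rewrite /hahn_le sub0r hahn_lcN oppr_ge0. Qed.

Lemma hahn_le0_add a b : hahn_le 0 a -> hahn_le 0 b -> hahn_le 0 (a + b).
Proof.
rewrite !le0E; wlog vab : a b / hahn_val a <= hahn_val b.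
  by move=> IH; have [/IH//|/ltW/IH ba a0 b0] := leP (hahn_val a) (hahn_val b);
    rewrite addrC ba.
have [->|a0] := eqVneq a 0; first by rewrite add0r.
move=> la lb; have la0 : 0 < hahn_lc a by rewrite lt_neqAle la eq_sym hahn_lc_eq0 a0.
have bva : 0 <= b (hahn_val a).
  move: vab; rewrite le_eqVlt => /orP[/eqP->//|vab]; by rewrite hahn_lt_val.
have abva : 0 < (a + b) (hahn_val a) by rewrite hahnDE ltr_wpDr.
rewrite (@hahn_lc_unique _ (hahn_val a)) ?ltW ?gt_eqF //.
by rewrite rpredD ?hahn_ge_val // (hahn_ge_le vab (hahn_ge_val b)).
Qed.

Lemma hahn_le0_mul a b : hahn_le 0 a -> hahn_le 0 b -> hahn_le 0 (a * b).
Proof. by rewrite !le0E hahn_lcM; exact: mulr_ge0. Qed.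

Lemma hahn_le0_anti a : hahn_le 0 a -> hahn_le a 0 -> a = 0.
Proof.
by rewrite le0E leE0 => a0 a0'; apply/eqP; rewrite -hahn_lc_eq0 eq_le a0 a0'.
Qed.

Lemma hahn_sub_ge0 a b : hahn_le 0 (b - a) = hahn_le a b.
Proof. by rewrite le0E. Qed.

Lemma hahn_le0_total a : hahn_le 0 a || hahn_le a 0.
Proof. by rewrite le0E leE0 le_total. Qed.

Lemma hahn_normN a : hahn_norm (- a) = hahn_norm a.
Proof.
rewrite /hahn_norm hahn_lcN oppr_ge0 opprK.
case: ltgtP => // /eqP; rewrite hahn_lc_eq0 => /eqP->; by rewrite oppr0.
Qed.

Lemma hahn_ge0_norm a : hahn_le 0 a -> hahn_norm a = a.
Proof. by rewrite le0E /hahn_norm => ->. Qed.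

Lemma hahn_lt_def a b : hahn_lt a b = (b != a) && hahn_le a b.
Proof. by []. Qed.

HB.instance Definition _ := Num.IntegralDomain_isLeReal.Build (hahn k G)
  hahn_le0_add hahn_le0_mul hahn_le0_anti hahn_sub_ge0 hahn_le0_total
  hahn_normN hahn_ge0_norm hahn_lt_def.

Lemma hahn_ge0E a : (0 <= a) = (0 <= hahn_lc a).
Proof. exact: le0E. Qed.

Lemma hahn_gt0E a : (0 < a) = (0 < hahn_lc a).
Proof. by rewrite !lt_def hahn_ge0E hahn_lc_eq0. Qed.

Lemma hahn_lt0E a : (a < 0) = (hahn_lc a < 0).
Proof. by rewrite -oppr_gt0 hahn_gt0E hahn_lcN oppr_gt0. Qed.

Lemma hahn_gt0_coef a g : a \in hahn_ge g -> 0 < a g -> 0 < a.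
Proof. by move=> ag a0; rewrite hahn_gt0E (hahn_lc_unique ag) ?gt_eqF. Qed.

Lemma hahn_lt0_coef a g : a \in hahn_ge g -> a g < 0 -> a < 0.
Proof. by move=> ag a0; rewrite hahn_lt0E (hahn_lc_unique ag) ?lt_eqF. Qed.

Lemma hahn_mono_gt0 g r : (0 < hahn_mono g r :> hahn k G) = (0 < r).
Proof.
have [->|r0] := eqVneq r 0.
  by rewrite (_ : hahn_mono g 0 = 0) ?ltxx //; apply/eqP; rewrite hahn_mono_eq0.
rewrite hahn_gt0E (@hahn_lc_unique _ g) ?hahn_mono_ge ?hahn_monoE ?eqxx //.
Qed.

End HahnOrder.

(** In characteristic zero this shows that a power of ['X - r%:P] without a term of degree [n.-1]
    has [r = 0], and it fixes the shift that removes this term from a polynomial. *)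
Lemma coef_pred_XsubC_exp (R : comNzRingType) (r : R) n : (0 < n)%N ->
  (('X - r%:P) ^+ n)`_n.-1 = - (r *+ n).
Proof.
move=> n0; have -> : ('X - r%:P) ^+ n = \prod_(x <- nseq n r) ('X - x%:P).
  by rewrite big_nseq -Monoid.iteropE.
have := @coefPn_prod_XsubC _ (nseq n r); rewrite size_nseq => -> //; last by rewrite -lt0n.
by rewrite big_nseq iter_addr_0.
Qed.

(** * Real closedness of the field of Hahn series *)

Section HahnRealClosed.
Variables (k : rcfType) (G : orderedZmodType).
Local Notation H := (hahn k G).
Implicit Types (p : {poly H}).

Lemma rcf_noroot_gt0 (q : {poly k}) : q \is monic -> (forall x, ~~ root q x) ->
  forall x, 0 < q.[x].
Proof.
move=> /monicP qm nr x; rewrite -sgr_cp0 (@sgp_pinftyP _ x) ?in_itv /= ?lexx //.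
by rewrite /sgp_pinfty qm sgr1.
Qed.

(** What an induction on the degree needs for the intermediate value property: a sign change passes
    to a factor, and a positive polynomial has none. *)
Definition splits_or_pos p :=
  (exists q1 q2, [/\ p = q1 * q2, (1 < size q1)%N & (1 < size q2)%N]) \/
  (forall x, 0 < p.[x]).

(** If the reduction has a root [r], its full power of ['X - r%:P] is split off and lifted. Only a
    pure power resists: the missing subleading coefficient forces [r = 0], against the nonzero
    coefficient of degree [j]. Without roots the reduction is positive and of even degree, so [p] is
    positive at [x] of order at least 0 by its residue, and at [x] of negative order because
    [x ^+ n] dominates. *)
Lemma splits_or_pos_normal p (n := (size p).-1) : p \is monic -> (1 < n)%N ->
  p \is a polyOver (hahn_ge 0) -> p`_n.-1 = 0 ->
  (exists2 j, (j < n)%N & p`_j 0 != 0) -> splits_or_pos p.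
Proof.
move=> pm n1 pV pn1 [j jn pj].
have pbm := monic_polyres pm; have spb := size_monic_polyres pm.
have sp : size p = n.+1 by rewrite /n; move: n1; rewrite /n; case: (size p).
have [[r]|nr] := pselect (exists r, root (hahn_polyres p) r).
  have [m [q qr pE]] := multiplicity_XsubC (hahn_polyres p) r.
  rewrite (monic_neq0 pbm) /= in qr; rewrite pE => rr.
  have m0 : (0 < m)%N.
    by rewrite lt0n; apply: contraL rr => /eqP->; rewrite expr0 mulr1.
  have qm : q \is monic by move: pbm; rewrite pE monicMr // monic_exp ?monicXsubC.
  have [q1|q1] := ltnP 1 (size q).
    have cop : coprimep q (('X - r%:P) ^+ m).
      by rewrite coprimep_expr // coprimep_XsubC.
    have [|u [v [-> su sv]]] := hahn_hensel pm pV qm _ cop pE.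
      by rewrite monic_exp ?monicXsubC.
    by left; exists u, v; rewrite su sv q1 size_exp_XsubC; split.
  have q1E : q = 1.
    by move: qm; rewrite (size1_polyC q1) monicE lead_coefC => /eqP->.
  rewrite q1E mul1r in pE.
  have mn : m = n by apply/eqP; rewrite -eqSS -sp -spb pE size_exp_XsubC.
  have : (hahn_polyres p)`_n.-1 = 0 by rewrite coef_polyres pn1 hahn0E.
  rewrite pE mn coef_pred_XsubC_exp 1?ltnW // => /eqP.
  rewrite oppr_eq0 mulrn_eq0 => /orP[/eqP n0|/eqP r0]; first by rewrite n0 in n1.
  by move: pj; rewrite -coef_polyres pE r0 subr0 mn coefXn ltn_eqF ?eqxx.
have {}nr x : ~~ root (hahn_polyres p) x by apply/negP => rx; apply: nr; exists x.
have odd_sp : odd (size p).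
  by rewrite -spb; apply/negPn/negP => /odd_poly_root[x]; rewrite (negPf (nr x)).
right=> x; have [xV|xV] := boolP (x \in hahn_ge 0).
  have [pxV px0] := horner_polyres pV xV.
  by apply: (hahn_gt0_coef pxV); rewrite px0; apply: rcf_noroot_gt0.
have x0 : x != 0 by apply: contra xV => /eqP->; apply: rpred0.
pose g := hahn_val x; have g0 : g < 0 by rewrite ltNge -hahn_ge_lt.
rewrite horner_coef sp big_ord_recr /=.
have -> : p`_n = 1 by apply/eqP; move: pm; rewrite monicE lead_coefE.
rewrite mul1r.
have low : \sum_(i < n) p`_i * x ^+ i \in hahn_gt (g *+ n).
  apply: rpred_sum => i _; have xi := hahn_geX i (hahn_ge_val x).
  apply: (@hahn_ge_gt _ _ _ (g *+ i)); last first.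
    by rewrite mulrC; apply: hahn_geM0 => //; apply: (polyOverP pV).
  have -> : g *+ n = g *+ (n - i) + g *+ i by rewrite -mulrnDr subnK // ltnW.
  rewrite -[X in _ < X]add0r oz_ltD2r.
  by rewrite -[X in _ < X](mul0rn _ (n - i)) oz_lt_mulrn // subn_gt0.
have xn := hahn_geX n (hahn_ge_val x).
apply: (@hahn_gt0_coef _ _ _ (g *+ n)); first by rewrite rpredD // hahn_gtW.
rewrite hahnDE; move: low; rewrite hahn_gtE => /andP[_ /eqP->].
rewrite add0r hahn_coefX ?hahn_ge_val // exprn_even_gt0 ?hahn_val_neq0 ?orbT //.
by move: odd_sp; rewrite sp.
Qed.

Lemma splits_or_pos_affine p (u w : H) : u != 0 ->
  splits_or_pos (p \Po (u *: 'X + w%:P)) -> splits_or_pos p.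
Proof.
move=> u0; pose r : {poly H} := u^-1 *: 'X - (u^-1 * w)%:P.
have rK : (u *: 'X + w%:P) \Po r = 'X.
  rewrite comp_polyD comp_polyZ comp_polyX comp_polyC /r scalerBr scalerA divff //.
  by rewrite scale1r -mul_polyC -polyCM mulVKf // subrK.
have pK : p = (p \Po (u *: 'X + w%:P)) \Po r by rewrite -comp_polyA rK comp_polyXr.
have sr : size r = 2.
  rewrite size_polyDl size_scale ?invr_eq0 // ?size_polyX // size_polyN.
  by rewrite (leq_ltn_trans (size_polyC_leq1 _)).
case=> [[q1 [q2 [qE s1 s2]]]|pos].
  left; exists (q1 \Po r), (q2 \Po r); rewrite -comp_polyM -qE -pK.
  by split; rewrite // size_comp_poly2.
by right=> x; rewrite pK horner_comp.
Qed.

Lemma splits_or_pos_scale p (c : H) : 0 < c -> splits_or_pos (c *: p) -> splits_or_pos p.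
Proof.
move=> c0; case=> [[q1 [q2 [qE s1 s2]]]|pos].
  left; exists (c^-1 *: q1), q2; rewrite -scalerAl -qE scalerA mulVf ?gt_eqF //.
  by rewrite scale1r size_scale ?invr_eq0 ?gt_eqF.
by right=> x; have := pos x; rewrite hornerZ pmulr_rgt0.
Qed.

Hypothesis divG : forall n (g : G), (0 < n)%N -> exists h, h *+ n = g.

Lemma coef_comp_scaleX (R : comNzRingType) (q : {poly R}) (c : R) j :
  (q \Po (c *: 'X))`_j = q`_j * c ^+ j.
Proof.
have -> : q \Po (c *: 'X) = \poly_(i < size q) (q`_i * c ^+ i).
  by rewrite comp_polyE poly_def; apply: eq_bigr => i _; rewrite exprZn scalerA.
by rewrite coef_poly; case: ltnP => // qj; rewrite nth_default ?mul0r.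
Qed.

(** A Newton polygon argument: with [d] the least slope [v(p_j) / (n - j)], which exists in [G] by
    divisibility, replacing ['X] by [x^d * 'X] and renormalising makes all coefficients integral and
    the one at the minimising index a unit. *)
Lemma splits_or_pos_depressed p (n := (size p).-1) : p \is monic -> (1 < n)%N ->
  p`_n.-1 = 0 -> splits_or_pos p.
Proof.
move=> pm n1 pn1.
have sp : size p = n.+1 by rewrite /n; move: n1; rewrite /n; case: (size p).
have pn : p`_n = 1 by apply/eqP; move: pm; rewrite monicE lead_coefE.
have [pX|[j0 pj0]] : p = 'X^n \/ exists j : 'I_n, p`_j != 0.
  have [[j pj]|nj] := pselect (exists j : 'I_n, p`_j != 0); first by right; exists j.
  left; apply/polyP => i; rewrite coefXn; case: (ltngtP i n) => [iN|iN|->] //.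
    by apply/eqP/negPn/negP => pi; apply: nj; exists (Ordinal iN).
  by rewrite nth_default // sp.
  have n'n : n.-1.+1 = n by rewrite prednK // ltnW.
  by left; exists 'X, 'X^(n.-1); rewrite -exprS n'n size_polyX size_polyXn n'n pX.
have slope (j : 'I_n) : exists h, h *+ (n - j) = hahn_val (p`_j).
  by apply: divG; rewrite subn_gt0.
pose de j := sval (cid (slope j)).
have deE j : de j *+ (n - j) = hahn_val (p`_j) := svalP (cid (slope j)).
have [j1 pj1 minj1] := @arg_minP _ _ _ j0 (fun j : 'I_n => p`_j != 0) de pj0.
pose d := de j1; pose c : H := hahn_mono d 1; pose q := c ^- n *: (p \Po (c *: 'X)).
have c0 : 0 < c by rewrite hahn_mono_gt0.
apply: (@splits_or_pos_affine _ c 0); first by rewrite gt_eqF.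
rewrite addr0; apply: (@splits_or_pos_scale _ (c ^- n)).
  by rewrite invr_gt0 exprn_gt0.
rewrite -/q.
have cX i : c ^+ i = hahn_mono (d *+ i) 1.
  elim: i => [|i IHi]; first by apply: hahnP => x; rewrite expr0 mulr0n.
  by rewrite exprS IHi /c hahn_monoM mulr1 mulrS.
have qE i : q`_i = p`_i * (c ^+ i / c ^+ n).
  by rewrite coefZ coef_comp_scaleX mulrCA [c ^- n * _]mulrC.
have qlow (i : 'I_n) : q`_i = p`_i * hahn_mono (- (d *+ (n - i))) 1.
  rewrite qE; congr (_ * _); apply: (mulIf (expf_neq0 n (lt0r_neq0 c0))).
  rewrite divfK ?expf_neq0 ?gt_eqF // !cX hahn_monoM mulr1; congr hahn_mono.
  have -> : d *+ n = d *+ (n - i) + d *+ i by rewrite -mulrnDr subnK // ltnW.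
  by rewrite addKr.
have qn : q`_n = 1 by rewrite qE pn mul1r divff // expf_neq0 ?gt_eqF.
have szq : size q = n.+1.
  rewrite size_scale ?invr_eq0 ?expf_neq0 ?gt_eqF // size_comp_poly2 //.
  by rewrite size_scale ?gt_eqF // size_polyX.
have qm : q \is monic by rewrite monicE lead_coefE szq /= qn.
have pge i : p`_i \in hahn_ge (hahn_val (p`_i)) := hahn_ge_val _.
have qpos : splits_or_pos q.
  apply: splits_or_pos_normal; rewrite ?szq //=.
  - apply/polyOverP => i; have [iN|] := ltnP i n; last first.
      rewrite leq_eqVlt => /orP[/eqP<-|ni]; last by rewrite nth_default ?szq ?rpred0.
      rewrite qn; exact: (hahn_const_ge G 1).
    rewrite (qlow (Ordinal iN)) /=; have [->|pi] := eqVneq (p`_i) 0.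
      by rewrite mul0r rpred0.
    apply: hahn_ge_le (hahn_geM (pge i) (hahn_mono_ge _ _)).
    rewrite oz_subr_ge0 -(deE (Ordinal iN)) oz_le_mulrn ?subn_gt0 //.
    exact: minj1.
  - have n'n : (n.-1 < n)%N by rewrite prednK // ltnW.
    by rewrite (qlow (Ordinal n'n)) /= pn1 mul0r.
  exists j1 => //; rewrite qlow.
  have := hahn_mul_coef (pge j1) (hahn_mono_ge (- (d *+ (n - j1))) 1).
  rewrite -deE subrr => ->; rewrite hahn_monoE eqxx mulr1 deE.
  exact: hahn_val_neq0.
exact: qpos.
Qed.

Lemma monic_splits_or_pos p (n := (size p).-1) : p \is monic -> (1 < n)%N ->
  splits_or_pos p.
Proof.
move=> pm n1.
have sp : size p = n.+1 by rewrite /n; move: n1; rewrite /n; case: (size p).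
have pn : p`_n = 1 by apply/eqP; move: pm; rewrite monicE lead_coefE.
pose a := p`_n.-1 / n%:R.
pose r : {poly H} := 1 *: 'X + (- a)%:P.
apply: (@splits_or_pos_affine _ 1 (- a)); first exact: oner_neq0.
rewrite -/r; have rE : r = 'X - a%:P by rewrite /r scale1r polyCN.
have szr : size r = 2 by rewrite rE size_XsubC.
have szq : size (p \Po r) = n.+1 by rewrite size_comp_poly2.
have n'n : n.-1.+1 = n by rewrite prednK // ltnW.
pose s := \poly_(i < n.-1) p`_i.
have pE : p = s + p`_n.-1 *: 'X^(n.-1) + 'X^n.
  apply/polyP => i; rewrite !coefD coefZ !coefXn coef_poly.
  have [in1|] := ltnP i n.-1.
    by rewrite !ltn_eqF ?mulr0 ?addr0 // (leq_trans in1) ?leq_pred.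
  rewrite leq_eqVlt => /orP[/eqP<-|].
    by rewrite eqxx mulr1 add0r ltn_eqF ?addr0 // n'n.
  rewrite n'n leq_eqVlt => /orP[/eqP<-|ni].
    by rewrite eqxx gtn_eqF ?mulr0 ?add0r // n'n.
  rewrite nth_default ?sp // !gtn_eqF ?mulr0 ?addr0 // (leq_ltn_trans (leq_pred _)) //.
have qcoef i : (p \Po r)`_i =
    (s \Po r)`_i + p`_n.-1 * (('X - a%:P) ^+ n.-1)`_i + (('X - a%:P) ^+ n)`_i.
  rewrite {1}pE !comp_polyD comp_polyZ !comp_Xn_poly rE !coefD coefZ //.
have szs : (size (s \Po r) <= n.-1)%N.
  by rewrite size_comp_poly2 // size_poly.
have lead1 (R : comNzRingType) (x : R) m : (('X - x%:P) ^+ m)`_m = 1.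
  have /monicP := monic_exp m (monicXsubC x).
  by rewrite lead_coefE size_exp_XsubC.
have qn : (p \Po r)`_n = 1.
  rewrite qcoef lead1 nth_default ?add0r; last by rewrite (leq_trans szs) ?leq_pred.
  by rewrite [X in _ * X]nth_default ?mulr0 ?add0r // size_exp_XsubC n'n.
have qm : p \Po r \is monic by rewrite monicE lead_coefE szq /= qn.
apply: splits_or_pos_depressed; rewrite ?szq //=.
rewrite qcoef (nth_default _ szs) add0r lead1 mulr1 coef_pred_XsubC_exp 1?ltnW //.
rewrite -[a *+ n]mulr_natr /a divfK ?subrr // pnatr_eq0 -lt0n ltnW //.
Qed.

(** Dividing by the leading coefficient changes the product of the end values by a square only. For
    a factorisation, this product is negative for one of the factors, of smaller degree. *)
Lemma hahn_ivt p (a b : H) : a < b -> p.[a] * p.[b] < 0 ->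
  exists2 x, a < x < b & root p x.
Proof.
move: {2}(size p) (leqnn (size p)) => n; elim: n p => [|n IHn] p szp ab pab.
  move: szp; rewrite leqn0 size_poly_eq0 => /eqP p0.
  by move: pab; rewrite p0 !horner0 mul0r ltxx.
wlog pm : p szp pab / p \is monic.
  move=> IH; have p0 : p != 0.
    by apply: contraTneq pab => ->; rewrite !horner0 mul0r ltxx.
  have l0 : (lead_coef p)^-1 != 0 by rewrite invr_eq0 lead_coef_eq0.
  have [|||x axb] := IH ((lead_coef p)^-1 *: p).
  - by rewrite size_scale.
  - by rewrite !hornerZ mulrACA pmulr_rlt0 // -expr2 exprn_even_gt0 ?l0.
  - by rewrite monicE lead_coefZ mulVf // lead_coef_eq0.
  by rewrite rootZ //; exists x.
have [sp1|sp1] := leqP (size p) 1.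
  by move: pab; rewrite (size1_polyC sp1) !hornerC -expr2 ltNge sqr_ge0.
have [sp2|sp2] := leqP (size p) 2.
  have [c pE] : exists c, p = 'X - c%:P.
    exists (- p`_0); apply/polyP => i; rewrite coefB coefX coefC.
    case: i => [|[|i]] /=; rewrite ?sub0r ?opprK ?subr0 //.
      have /eqP := monicP pm; rewrite lead_coefE.
      by have -> : size p = 2; [apply/eqP; rewrite eqn_leq sp2|move/eqP].
    by rewrite oppr0 nth_default // (leq_trans sp2).
  exists c; last by rewrite pE root_XsubC.
  move: pab; rewrite pE !hornerXsubC => pab.
  have [ac|ac|ac] := ltgtP a c; last by move: pab; rewrite ac subrr mul0r ltxx.
    by move: pab; rewrite nmulr_rlt0 ?subr_lt0 // subr_gt0.
  move: pab; rewrite pmulr_rlt0 ?subr_gt0 // subr_lt0 => bc.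
  by have := lt_trans bc ac; rewrite ltNge (ltW ab).
have [|[q1 [q2 [pE s1 s2]]]|pos] := monic_splits_or_pos pm.
- by move: sp2; case: (size p).
- have q10 : q1 != 0 by rewrite -size_poly_gt0 ltnW.
  have q20 : q2 != 0 by rewrite -size_poly_gt0 ltnW.
  have sz : size p = (size q1 + size q2).-1 by rewrite pE size_mul.
  move: pab; rewrite pE !hornerM mulrACA => pab.
  have [neg|nneg] := ltP (q1.[a] * q1.[b]) 0.
    have [|x axb rx] := IHn q1 _ ab neg; last by exists x => //; rewrite rootM rx.
    by move: szp sz s2; size_lia.
  have [|pos|z0] := ltgtP (q1.[a] * q1.[b]) 0; last by move: pab; rewrite z0 mul0r ltxx.
    by rewrite ltNge nneg.
  move: pab; rewrite pmulr_rlt0 // => neg.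
  have [|x axb rx] := IHn q2 _ ab neg; last by exists x => //; rewrite rootM rx orbT.
  by move: szp sz s1; size_lia.
by move: pab; rewrite ltNge ltW // mulr_gt0.
Qed.

Lemma hahn_real_closed : Num.real_closed_axiom H.
Proof.
move=> p a b; rewrite le_eqVlt => /orP[/eqP<- /andP[pa0 pa1]|ab /andP[pa pb]].
  exists a; first by rewrite lexx.
  by rewrite /root eq_le pa0 pa1.
have [pa0|pa0] := eqVneq p.[a] 0.
  by exists a; [rewrite lexx ltW|rewrite /root pa0 eqxx].
have [pb0|pb0] := eqVneq p.[b] 0.
  by exists b; [rewrite lexx ltW|rewrite /root pb0 eqxx].
have [|x /andP[ax xb] rx] := @hahn_ivt p a b ab.
  by rewrite nmulr_rlt0 lt_neqAle ?pa0 ?pa // eq_sym pb0.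
by exists x; rewrite // !ltW.
Qed.

End HahnRealClosed.

(** * Sections of the residue map and of the valuation *)

(** All sets are enlarged by [A0]: the result then contains [A0], and the empty chain, on which the
    hypothesis is silent, is bounded by [A0] itself. *)
Lemma zorn_pred (T : Type) (P : {pred T} -> Prop) (A0 : {pred T}) : P A0 ->
  (forall F : {pred T} -> Prop, (forall X, F X -> P X) -> (exists X, F X) ->
    (forall X Y, F X -> F Y -> {subset X <= Y} \/ {subset Y <= X}) ->
    P [pred x | `[< exists2 X, F X & x \in X >]]) ->
  exists A : {pred T}, [/\ {subset A0 <= A}, P A &
    forall B : {pred T}, {subset A <= B} -> P B -> {subset B <= A}].
Proof.
move=> PA0 Pchain; pose toP (X : set T) : {pred T} := [pred x | (x \in A0) || `[< X x >]].
have toPE X x : (x \in toP X) = (x \in A0) || `[< X x >] by [].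
have [F FP Ftot|A [PA Amax]] := @Zorn_bigcup T (fun X => P (toP X)).
  have [[X0 FX0]|nF] := pselect (exists X, F X); last first.
    suff -> : toP (\bigcup_(X in F) X) = A0 by [].
    apply/funext => x; rewrite /toP /=; case: asboolP => [[X FX _]|_]; last by rewrite orbF.
    by case: nF; exists X.
  have -> : toP (\bigcup_(X in F) X) =
      [pred x | `[< exists2 Y, (exists2 X, F X & Y = toP X) & x \in Y >]].
    apply/funext => x; apply/idP/asboolP => /=.
      rewrite /toP /= => /orP[xA|/asboolP[X FX Xx]].
        by exists (toP X0); [exists X0|rewrite inE xA].
      by exists (toP X); [exists X|rewrite inE; apply/orP; right; apply/asboolP].
    move=> [_ [X FX ->]]; rewrite toPE => /orP[xA|/asboolP Xx]; apply/orP; first by left.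
    by right; apply/asboolP; exists X.
  apply: Pchain => [_ [X FX ->]||_ _ [X FX ->] [Y FY ->]]; first exact: FP.
    by exists (toP X0), X0.
  have [XY|YX] := Ftot _ _ FX FY; [left|right] => x; rewrite !toPE;
    by move=> /orP[xA|/asboolP Xx]; apply/orP; [left|right; apply/asboolP; auto].
exists (toP A); split=> // [x xA|B AB PB x xB]; first by rewrite inE xA.
apply: contrapT => nx; apply: (Amax [set y | y \in B]).
  split=> [y Ay|/(_ x xB) Ax]; first by apply: AB; rewrite inE; apply/orP; right; apply/asboolP.
  by apply: nx; rewrite inE; apply/orP; right; apply/asboolP.
suff -> : toP [set y | y \in B] = B by [].
apply/funext => y; rewrite /toP /=; apply/orP/idP => [[yA|/asboolP//]|yB]; last first.
  by right; apply/asboolP.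
by apply: AB; rewrite inE yA.
Qed.

Lemma chain_subring (T : comNzRingType) (F : {pred T} -> Prop) :
  (forall X, F X -> subring_closed X) -> (exists X, F X) ->
  (forall X Y, F X -> F Y -> {subset X <= Y} \/ {subset Y <= X}) ->
  subring_closed [pred x | `[< exists2 X, F X & x \in X >]].
Proof.
move=> FS [X0 FX0] tot.
have both (x y : T) X Y : F X -> F Y -> x \in X -> y \in Y ->
    exists2 Z, F Z & x \in Z /\ y \in Z.
  move=> FX FY xX yY; have [XY|YX] := tot _ _ FX FY.
    by exists Y => //; split=> //; apply: XY.
  by exists X => //; split=> //; apply: YX.
split=> [|x y /asboolP[X FX xX] /asboolP[Y FY yY]|x y /asboolP[X FX xX] /asboolP[Y FY yY]].
- by apply/asboolP; exists X0 => //; have [] := FS _ FX0.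
- have [Z FZ [xZ yZ]] := both _ _ _ _ FX FY xX yY; apply/asboolP; exists Z => //.
  by have [_ + _] := FS _ FZ; apply.
have [Z FZ [xZ yZ]] := both _ _ _ _ FX FY xX yY; apply/asboolP; exists Z => //.
by have [_ _] := FS _ FZ; apply.
Qed.

(** Maximality in elementwise form: the values at [x] of polynomials over [A] form the ring
    generated by [A] and [x], so [x] belongs to [A] as soon as [Q] holds on them. *)
Lemma zorn_subring (T : comNzRingType) (Q : T -> Prop) (A0 : {pred T}) :
  subring_closed A0 -> {in A0, forall x, Q x} ->
  exists A : subringClosed T, [/\ {subset A0 <= A}, {in A, forall x, Q x} &
    forall x, (forall P : {poly T}, P \is a polyOver A -> Q P.[x]) -> x \in A].
Proof.
move=> A0S A0Q.
have [|F FP neF tot|A [A0A [AS AQ] Amax]] :=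
    @zorn_pred T (fun A => subring_closed A /\ {in A, forall x, Q x}) A0.
- by [].
- split; first by apply: chain_subring => // X /FP[].
  by move=> x /asboolP[X FX xX]; have [_] := FP _ FX; apply.
pose A' : subringClosed T := HB.pack A (GRing.isSubringClosed.Build T A AS).
exists A'; split=> // x xQ.
pose B : {pred T} := [pred y | `[< exists2 P, P \is a polyOver A' & y = P.[x] >]].
apply: (Amax B).
- by move=> y yA; apply/asboolP; exists y%:P; rewrite ?polyOverC ?hornerC.
- split; last by move=> _ /asboolP[P PA ->]; apply: xQ.
  split=> [|_ _ /asboolP[P PA ->] /asboolP[R RA ->]|_ _ /asboolP[P PA ->] /asboolP[R RA ->]].
  + by apply/asboolP; exists 1; rewrite ?rpred1 ?hornerC.
  + by apply/asboolP; exists (P - R); rewrite ?rpredB // !hornerE.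
  by apply/asboolP; exists (P * R); rewrite ?rpredM // hornerM.
by apply/asboolP; exists 'X; rewrite ?polyOverX ?hornerX.
Qed.

(** Euclidean division by a monic polynomial stays over [A]. Checking an element killed by [P]
    against the maximality of [A] is thereby reduced to polynomials of degree less than that of
    [P]. *)
Lemma polyOver_horner_reduce (T : comNzRingType) (A : subringClosed T) (P R : {poly T}) x :
  P \is monic -> P \is a polyOver A -> P.[x] = 0 -> R \is a polyOver A ->
  exists R', [/\ R' \is a polyOver A, (size R' < size P)%N & R'.[x] = R.[x]].
Proof.
move=> Pm PA Px; move: {2}(size R) (leqnn (size R)) => n.
have sP : (0 < size P)%N by rewrite size_poly_gt0 monic_neq0.
elim: n R => [|n IHn] R szR RA.
  move: szR; rewrite leqn0 size_poly_eq0 => /eqP->; exists 0.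
  by rewrite rpred0 size_poly0.
have [lt|ge] := ltnP (size R) (size P); first by exists R.
pose c := R`_(size R).-1; pose d := (size R - size P)%N.
pose R1 := R - (c *: 'X^d) * P.
have R1A : R1 \is a polyOver A.
  rewrite rpredB // rpredM // polyOverZ ?(polyOverP RA) //.
  by rewrite rpredX // polyOverX.
have [|R' [R'A szR' R'x]] := IHn R1 _ R1A.
  apply/leq_sizeP => j nj; rewrite coefB -scalerAl coefZ coefXnM.
  have [jd|dj] := ltnP j d.
    by move: jd; rewrite /d ltn_subRL => jd; lia.
  have [jR|jR] := eqVneq j (size R).-1.
    have -> : (j - d)%N = (size P).-1 by rewrite jR /d; lia.
    by rewrite -[P`__]lead_coefE (monicP Pm) mulr1 jR subrr.
  have Rj : (size R <= j)%N by move/eqP: jR; lia.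
  have Pjd : (size P <= j - d)%N by rewrite /d; lia.
  by rewrite !nth_default ?mulr0 ?subr0.
exists R'; split=> //; rewrite R'x /R1 hornerD hornerN hornerM Px mulr0 subr0 //.
Qed.

(** Clears denominators, so that adjoining an inverse can be tested inside [A]. *)
Lemma horner_inv_coef (T : comNzRingType) (A : subringClosed T) (P : {poly T}) a b :
  a \in A -> a * b = 1 -> P \is a polyOver A -> P.[b] * a ^+ size P \in A.
Proof.
move=> aA ab /polyOverP PA; rewrite horner_coef mulr_suml; apply: rpred_sum => i _.
have -> : a ^+ size P = a ^+ i * a ^+ (size P - i) by rewrite -exprD subnKC // ltnW.
by rewrite -mulrA [b ^+ i * _]mulrA -exprMn [b * a]mulrC ab expr1n mul1r rpredM ?rpredX.
Qed.

(** * Residues and infinitesimals as notions on the whole field *)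

Section ResidueFunction.
Variable L : valuedFieldType.
Implicit Types x y : L.

(* The residue as a total function on the field, with junk value 0 outside the
   valuation ring. *)
Definition vres x : resfield L := residue (insubd 0 x).

(** The maximal ideal [valmax], read on the field instead of on the subtype [valint]. *)
Definition vsmall x := (x == 0) || (x^-1 \notin valring).

Lemma vsmall_valring x : vsmall x -> x \in valring.
Proof.
case/orP => [/eqP->|xV]; first exact: rpred0.
by rewrite -[x]invrK valringV.
Qed.

Lemma vsmall0 : vsmall 0. Proof. by rewrite /vsmall eqxx. Qed.

Lemma vresE x (xV : x \in valring) : vres x = residue (ValInt xV).
Proof. by congr residue; apply: val_inj; rewrite insubdK. Qed.

Lemma vres_val (u : valint L) : vres (val u) = residue u.
Proof. by congr residue; apply: val_inj; rewrite insubdK // (valP u). Qed.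

Lemma vresB x y : x \in valring -> y \in valring -> vres (x - y) = vres x - vres y.
Proof.
move=> xV yV; rewrite (vresE xV) (vresE yV) -rmorphB; congr residue; apply: val_inj.
by rewrite insubdK // rpredB.
Qed.

Lemma vresD x y : x \in valring -> y \in valring -> vres (x + y) = vres x + vres y.
Proof.
move=> xV yV; rewrite (vresE xV) (vresE yV) -rmorphD; congr residue; apply: val_inj.
by rewrite insubdK // rpredD.
Qed.

Lemma vresM x y : x \in valring -> y \in valring -> vres (x * y) = vres x * vres y.
Proof.
move=> xV yV; rewrite (vresE xV) (vresE yV) -rmorphM; congr residue; apply: val_inj.
by rewrite insubdK // rpredM.
Qed.

Lemma vres1 : vres 1 = 1.
Proof.
rewrite -(rmorph1 (@residue L)); congr residue; apply: val_inj.
by rewrite insubdK // rpred1.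
Qed.

Lemma vres0 : vres 0 = 0.
Proof. by rewrite -[0 in LHS](subrr 1) vresB ?rpred1 // subrr. Qed.

Lemma vres_eq0 x : x \in valring -> (vres x == 0) = vsmall x.
Proof. by move=> xV; rewrite (vresE xV) residue_eq0 valmaxE. Qed.

Lemma vres_surj r : exists2 x, x \in valring & vres x = r.
Proof.
have [u ->] := residueP r; exists (val u); first exact: (valP u).
exact: vres_val.
Qed.

Lemma vsmallMl x y : x \in valring -> vsmall y -> vsmall (x * y).
Proof.
move=> xV yS; have yV := vsmall_valring yS.
by rewrite -vres_eq0 ?rpredM // vresM //; move: yS; rewrite -vres_eq0 // => /eqP->; rewrite mulr0.
Qed.

Lemma vsmallMr x y : vsmall x -> y \in valring -> vsmall (x * y).
Proof. by move=> xS yV; rewrite mulrC vsmallMl. Qed.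

Lemma vsmallD x y : vsmall x -> vsmall y -> vsmall (x + y).
Proof.
move=> xS yS; have xV := vsmall_valring xS; have yV := vsmall_valring yS.
rewrite -vres_eq0 ?rpredD // vresD //.
by move: xS yS; rewrite -!vres_eq0 // => /eqP-> /eqP->; rewrite addr0.
Qed.

Lemma vsmallN x : vsmall (- x) = vsmall x.
Proof. by rewrite /vsmall oppr_eq0 invrN rpredN. Qed.

Lemma vres_eqP x y : x \in valring -> y \in valring -> vres x = vres y <-> vsmall (x - y).
Proof.
move=> xV yV; rewrite -vres_eq0 ?rpredB // vresB // subr_eq0.
by split => /eqP.
Qed.

Lemma valunitVr x : x \in valring -> ~~ vsmall x -> x^-1 \in valring.
Proof. by move=> xV; rewrite negb_or negbK => /andP[]. Qed.

End ResidueFunction.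

(** * Hensel's lemma for a convex valuation, and sections of the residue map *)

Section ConvexValuation.
Variable L : rcvfType.
Implicit Types x y e : L.

Lemma valring_norm x : (`|x| \in valring) = (x \in valring).
Proof. by case: ger0P => // _; rewrite rpredN. Qed.

Lemma valring_le_norm x y : `|x| <= `|y| -> y \in valring -> x \in valring.
Proof.
by move=> xy; rewrite -valring_norm -[x \in _]valring_norm; apply: valring_convex.
Qed.

Lemma vsmall_le_norm x y : `|x| <= `|y| -> vsmall y -> vsmall x.
Proof.
move=> xy; have [->|x0] := eqVneq x 0; first by rewrite vsmall0.
have y0 : y != 0 by rewrite -normr_gt0 (lt_le_trans _ xy) // normr_gt0.
rewrite /vsmall (negPf x0) (negPf y0) /=; apply: contra.
by apply: valring_le_norm; rewrite !normfV lef_pV2 ?posrE ?normr_gt0.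
Qed.

Lemma vsmall_lt1 x : vsmall x -> `|x| < 1.
Proof.
move=> xS; rewrite ltNge; apply/negP => x1.
have : vsmall (1 : L) by apply: vsmall_le_norm xS; rewrite normr1.
by rewrite /vsmall oner_eq0 invr1 rpred1.
Qed.

Lemma valring_nat n : (n%:R : L) \in valring.
Proof. exact: rpred_nat. Qed.

Lemma vsmall_nat n : vsmall (n.+1%:R : L) = false.
Proof.
apply/negP => /vsmall_lt1; rewrite normr_nat ltNge.
by rewrite -[X in X <= _](mulr1n 1) ler_nat.
Qed.

Lemma polyOver_taylor2 (P : {poly L}) x e : P \is a polyOver (@valring L) ->
    x \in valring -> e \in valring ->
  exists2 R, R \in valring & P.[x + e] = P.[x] + P^`().[x] * e + R * e ^+ 2.
Proof.
elim/poly_ind: P => [|P c IHP] PV xV eV.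
  by exists 0; rewrite ?rpred0 // deriv0 !horner0 !mul0r !addr0.
have PV' : P \is a polyOver (@valring L).
  apply/polyOverP => i; have := polyOverP PV i.+1.
  by rewrite coefD coefMX coefC addr0.
have [R RV RE] := IHP PV' xV eV.
exists (R * (x + e) + P^`().[x]).
  by rewrite rpredD ?rpredM ?rpredD // rpred_horner // polyOver_deriv.
rewrite derivD derivM derivX derivC addr0 mulr1 !hornerD !hornerM !hornerX !hornerC RE.
ring.
Qed.

Lemma vres_horner_cong (P : {poly L}) x y : P \is a polyOver (@valring L) ->
  x \in valring -> y \in valring -> vres x = vres y -> vres P.[x] = vres P.[y].
Proof.
move=> PV xV yV /(vres_eqP xV yV) xy; apply/vres_eqP; rewrite ?rpred_horner //.
have [|R RV RE] := @polyOver_taylor2 P y (x - y) PV yV; first by rewrite rpredB.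
move: RE; rewrite addrC subrK => ->.
have -> : P.[y] + P^`().[y] * (x - y) + R * (x - y) ^+ 2 - P.[y] =
  (P^`().[y] + R * (x - y)) * (x - y) by ring.
by apply: vsmallMl; rewrite ?rpredD ?rpredM ?rpredB // rpred_horner // polyOver_deriv.
Qed.

Lemma rcvf_hensel (P : {poly L}) x : P \is a polyOver (@valring L) ->
    x \in valring -> vsmall P.[x] -> ~~ vsmall P^`().[x] ->
  exists y, [/\ y \in valring, vres y = vres x & P.[y] = 0].
Proof.
move=> PV xV Px P'x; have [Px0|Px0] := eqVneq P.[x] 0; first by exists x.
have P'V : P^`().[x] \in valring by rewrite rpred_horner // polyOver_deriv.
have P'x0 : P^`().[x] != 0 by apply: contra P'x => /eqP->; exact: vsmall0.
(* Twice the Newton step: it overshoots the root, turning the value [P.[x]] into [- P.[x]] up to a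
   factor infinitely close to 1. The root found in between is closer to [x] than the infinitesimal
   [e]. *)
pose e := - (2 * (P^`().[x])^-1 * P.[x]).
have eS : vsmall e.
  by rewrite vsmallN vsmallMl // rpredM ?valring_nat // valunitVr.
have eV := vsmall_valring eS.
have [R RV RE] := polyOver_taylor2 PV xV eV.
pose m := R * (2 / P^`().[x]) ^+ 2 * P.[x].
have mS : vsmall m.
  by rewrite vsmallMl // rpredM // rpredX // rpredM ?valring_nat // valunitVr.
have PE : P.[x + e] = - P.[x] * (1 - m).
  by rewrite RE /e /m; field.
have neg : P.[x] * P.[x + e] < 0.
  rewrite PE mulrA mulrN -expr2 mulNr oppr_lt0 mulr_gt0 //.
    by rewrite exprn_even_gt0.
  by rewrite subr_gt0 (le_lt_trans (ler_norm _)) // vsmall_lt1.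
have [y ye Py] : exists2 y, `|y - x| <= `|e| & P.[y] = 0.
  have [e0|e0] := leP 0 e.
    have [|y] := polyrcf.poly_ivt _ (ltW neg); first by rewrite lerDl.
    rewrite in_itv /= => /andP[xy ye] /eqP; exists y => //.
    by rewrite !ger0_norm ?subr_ge0 // lerBlDl.
  have [||y] := @polyrcf.poly_ivt _ P (x + e) x; first by rewrite gerDl ltW.
    by rewrite mulrC ltW.
  rewrite in_itv /= => /andP[ey yx] /eqP; exists y => //.
  by rewrite !ler0_norm ?subr_le0 // ?(ltW e0) // lerN2 lerBrDl.
have yxS := vsmall_le_norm ye eS.
have yV : y \in valring by rewrite -[y](subrK x) rpredD // vsmall_valring.
by exists y; split=> //; apply/vres_eqP.
Qed.

(* The section is a subfield of the valuation ring, maximal among those that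
   contain [A0]: if a residue were missing, a root of a polynomial of minimal
   degree killing it, or an arbitrary lift, could be adjoined. *)
Lemma residue_section (A0 : {pred L}) : subring_closed A0 ->
    {in A0, forall x, x \in valring /\ (vsmall x -> x = 0)} ->
  exists c : {rmorphism resfield L -> L},
    [/\ forall r, c r \in valring, forall r, vres (c r) = r &
      {in A0, forall x, c (vres x) = x}].
Proof.
move=> A0S A0Q.
have [A [A0A AQ Amax]] := zorn_subring A0S A0Q.
have AV x : x \in A -> x \in valring by move=> /AQ[].
have AS x : x \in A -> vsmall x -> x = 0 by move=> /AQ[_]; apply.
have Ainj x y : x \in A -> y \in A -> vres x = vres y -> x = y.
  move=> xA yA /(vres_eqP (AV _ xA) (AV _ yA)) xy; apply/eqP; rewrite -subr_eq0.
  by apply/eqP/AS; rewrite ?rpredB.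
have AinV x : x \in A -> x^-1 \in A.
  move=> xA; have [->|x0] := eqVneq x 0; first by rewrite invr0 rpred0.
  have xS : ~~ vsmall x by apply: contra x0 => /(AS _ xA)/eqP.
  have xV' : x^-1 \in valring by rewrite valunitVr // AV.
  apply: Amax => P PA.
  have := horner_inv_coef xA (divff x0) PA; set n := size P => PnA.
  have PE : P.[x^-1] = P.[x^-1] * x ^+ n * x^-1 ^+ n.
    by rewrite exprVn mulfK // expf_neq0.
  split; first by rewrite PE rpredM ?rpredX // AV.
  move=> PS; apply: (mulIf (expf_neq0 n x0)); rewrite mul0r.
  by apply: AS => //; rewrite vsmallMr // rpredX // AV.
have PAV (P : {poly L}) : P \is a polyOver A -> P \is a polyOver (@valring L).
  by move=> /polyOverP PA; apply/polyOverP => i; apply: AV.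
have Asurj r : exists2 x, x \in A & vres x = r.
  have [x xV xr] := vres_surj r.
  have [xA|/existsNP[P /not_implyP[PA nQ]]] :=
      pselect (forall P, P \is a polyOver A -> P.[x] \in valring /\ (vsmall P.[x] -> P.[x] = 0)).
    by exists x => //; apply: Amax.
  pose kill n := `[< exists P : {poly L}, [/\ P \is a polyOver A, P != 0, vsmall P.[x] & size P = n] >].
  have [|n /asboolP[{nQ}{PA}P [PA P0 PS sPn]] nmin] := @ex_minnP kill.
    exists (size P); apply/asboolP; exists P; split=> //.
      apply: contra_notN nQ => /eqP->; rewrite horner0 rpred0; by split.
    apply: contra_notT nQ => nS; split; last by rewrite (negPf nS).
    by rewrite rpred_horner // PAV.
  have small_kill (R : {poly L}) : R \is a polyOver A -> R != 0 -> vsmall R.[x] ->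
      (size P <= size R)%N.
    by move=> RA R0 RS; rewrite sPn; apply: nmin; apply/asboolP; exists R.
  wlog Pm : P PA P0 PS sPn small_kill / P \is monic.
    move=> IH; have l0 : (lead_coef P)^-1 != 0 by rewrite invr_eq0 lead_coef_eq0.
    have lA : (lead_coef P)^-1 \in A by rewrite AinV // (polyOverP PA).
    apply: (IH ((lead_coef P)^-1 *: P)).
    - by rewrite polyOverZ.
    - by rewrite scaler_eq0 (negPf l0) (negPf P0).
    - by rewrite hornerZ vsmallMl // AV.
    - by rewrite size_scale.
    - by rewrite size_scale.
    by rewrite monicE lead_coefZ mulVf // lead_coef_eq0.
  have sP1 : (1 < size P)%N.
    rewrite ltnNge; apply/negP => sP; move: PS P0 PA.
    rewrite (size1_polyC sP) hornerC polyC_eq0 => cS c0 /polyOverP/(_ 0%N).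
    by rewrite coefC /= => /AS/(_ cS)/eqP; rewrite (negPf c0).
  have sP' : (size P^`() < size P)%N by rewrite lt_size_deriv.
  have P'0 : P^`() != 0.
    apply/eqP => /polyP/(_ (size P).-2); rewrite coef_deriv coef0.
    have -> : (size P).-2.+1 = (size P).-1 by move: sP1; case: (size P) => [|[]].
    rewrite -lead_coefE (monicP Pm) => /eqP; rewrite pnatr_eq0.
    by move: sP1; case: (size P) => [|[]].
  (* A nonzero polynomial of smaller degree with infinitesimal value would contradict minimality, so
     the approximate root is simple and lifts. *)
  have P'S : ~~ vsmall P^`().[x].
    apply/negP => /small_kill; rewrite polyOver_deriv // => /(_ isT P'0).
    by rewrite leqNgt sP'.
  have [y [yV yx Py]] := rcvf_hensel (PAV _ PA) xV PS P'S.
  exists y; last by rewrite yx.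
  (* On [A[y]] it suffices to look at polynomials of degree less than that of [P]. If such a one is
     infinitesimal at [y], it is so at [x], and by minimality it is 0. *)
  apply: Amax => R RA; have [R' [R'A sR' <-]] := polyOver_horner_reduce Pm PA Py RA.
  split; first by rewrite rpred_horner // PAV.
  have [->|R'0] := eqVneq R' 0; first by rewrite horner0.
  rewrite -vres_eq0 ?rpred_horner ?PAV // (vres_horner_cong _ yV xV) ?PAV //.
  rewrite vres_eq0 ?rpred_horner ?PAV // => /small_kill.
  by move=> /(_ R'A R'0); rewrite leqNgt sR'.
pose c r := s2val (cid2 (Asurj r)).
have cA r : c r \in A := s2valP (cid2 (Asurj r)).
have cr r : vres (c r) = r := s2valP' (cid2 (Asurj r)).
have cV r : c r \in valring by apply: AV.
have cZ : zmod_morphism c.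
  by move=> r s; apply: Ainj; rewrite ?rpredB // vresB // !cr.
have cM : monoid_morphism c.
  split=> [|r s]; apply: Ainj; rewrite ?rpred1 ?rpredM // ?vresM // !cr ?vres1 //.
pose cR : {rmorphism resfield L -> L} := HB.pack c
  (GRing.isZmodMorphism.Build _ _ c cZ) (GRing.isMonoidMorphism.Build _ _ c cM).
exists cR; split=> // x /A0A xA; apply: Ainj => //; exact: cr.
Qed.

End ConvexValuation.

Lemma zorn_zmod (T : zmodType) (Q : T -> Prop) (A0 : {pred T}) :
  zmod_closed A0 -> {in A0, forall x, Q x} ->
  exists A : zmodClosed T, [/\ {subset A0 <= A}, {in A, forall x, Q x} &
    forall x, (forall z (m : int), z \in A -> Q (z + x *~ m)) -> x \in A].
Proof.
move=> A0S A0Q.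
have [|F FP [X0 FX0] tot|A [A0A [AS AQ] Amax]] :=
    @zorn_pred T (fun A => zmod_closed A /\ {in A, forall x, Q x}) A0.
- by [].
- split; last by move=> x /asboolP[X FX xX]; have [_] := FP _ FX; apply.
  split=> [|x y /asboolP[X FX xX] /asboolP[Y FY yY]].
    by apply/asboolP; exists X0 => //; have [[]] := FP _ FX0.
  apply/asboolP; have [XY|YX] := tot _ _ FX FY.
    by exists Y => //; have [[_ + _]] := FP _ FY; apply=> //; apply: XY.
  by exists X => //; have [[_ + _]] := FP _ FX; apply=> //; apply: YX.
pose A' : zmodClosed T := HB.pack A (GRing.isZmodClosed.Build T A AS).
exists A'; split=> // x xQ.
pose B : {pred T} := [pred y | `[< exists z (m : int), z \in A' /\ y = z + x *~ m >]].
apply: (Amax B).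
- by move=> y yA; apply/asboolP; exists y, 0; rewrite mulr0z addr0.
- split; last by move=> _ /asboolP[z [m [zA ->]]]; apply: xQ.
  split=> [|_ _ /asboolP[z [m [zA ->]]] /asboolP[z' [m' [zA' ->]]]].
    by apply/asboolP; exists 0, 0; rewrite mulr0z addr0 rpred0.
  apply/asboolP; exists (z - z'), (m - m'); rewrite rpredB //; split=> //.
  by rewrite mulrzBr opprD addrACA.
by apply/asboolP; exists 0, 1; rewrite mulr1z add0r rpred0.
Qed.

(** * Sections of the valuation *)

Section ValueSection.
Variable L : rcvfType.
Implicit Types (x y z : nonzero L) (g : valgroup L).

Lemma valuationB x y : valuation (x - y) = valuation x - valuation y.
Proof. exact: raddfB. Qed.

Lemma valuationD x y : valuation (x + y) = valuation x + valuation y.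
Proof. exact: raddfD. Qed.

Lemma valuationN x : valuation (- x) = - valuation x.
Proof. exact: raddfN. Qed.

Lemma valuationMn x n : valuation (x *+ n) = valuation x *+ n.
Proof. exact: raddfMn. Qed.

Lemma valuationMz x (m : int) : valuation (x *~ m) = valuation x *~ m.
Proof. exact: raddfMz. Qed.

Lemma nonzero_valMn x n : val (x *+ n) = val x ^+ n.
Proof. by elim: n => [|n IHn]; rewrite ?mulr0n // mulrS nonzero_valD IHn exprS. Qed.

Lemma nonzero_valMz_gt0 x (m : int) : 0 < val x -> 0 < val (x *~ m).
Proof.
move=> x0; case: m => n; first by rewrite -pmulrn nonzero_valMn exprn_gt0.
by rewrite NegzE mulrNz -pmulrn nonzero_valN nonzero_valMn invr_gt0 exprn_gt0.
Qed.

Lemma valuation_surj_gt0 g : exists2 x, 0 < val x & valuation x = g.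
Proof.
have [x ->] := valuationP g.
have nx : - val x != 0 by rewrite oppr_eq0 nonzero_neq0.
have [x0|x0] := ltP 0 (val x); first by exists x.
exists (Nonzero nx); first by rewrite /= oppr_gt0 lt_neqAle nonzero_neq0.
apply/eqP; rewrite eq_valuation /= mulNr invrN mulrN divff ?nonzero_neq0 //.
by rewrite rpredN rpred1.
Qed.

Lemma nonzero_root x n : 0 < val x -> (0 < n)%N -> exists2 y : nonzero L, 0 < val y & y *+ n = x.
Proof.
case: n => // n x0 _; have [y y0 yx] := nth_root n x0.
exists (Nonzero (lt0r_neq0 y0)) => //.
by apply: val_inj; rewrite nonzero_valMn.
Qed.

Lemma valgroup_divisible n g : (0 < n)%N -> exists h, h *+ n = g.
Proof.
move=> n0; have [x x0 <-] := valuation_surj_gt0 g.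
by have [y _ <-] := nonzero_root x0 n0; exists (valuation y); rewrite -valuationMn.
Qed.

(** The section inverts the valuation on a maximal group of positive elements that meets the units
    trivially. If no positive multiple of [g] is a value on this group, any positive lift of [g] can
    be adjoined. Otherwise one adjoins the positive [n]-th root of an element of value [g *+ n],
    with [n] minimal; positivity is imposed so that this root exists. *)
Lemma value_section (A0 : {pred nonzero L}) : zmod_closed A0 ->
    {in A0, forall x, 0 < val x /\ (valuation x = 0 -> x = 0)} ->
  exists s : {additive valgroup L -> nonzero L},
    [/\ forall g, 0 < val (s g), forall g, valuation (s g) = g &
      {in A0, forall x, s (valuation x) = x}].
Proof.
move=> A0S A0Q; have [A [A0A AQ Amax]] := zorn_zmod A0S A0Q.
have A_gt0 x : x \in A -> 0 < val x by move=> /AQ[].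
have A_eq0 x : x \in A -> valuation x = 0 -> x = 0 by move=> /AQ[_]; apply.
have Ainj x y : x \in A -> y \in A -> valuation x = valuation y -> x = y.
  move=> xA yA xy; apply/eqP; rewrite -subr_eq0; apply/eqP/A_eq0.
    by rewrite rpredB.
  by rewrite valuationB xy subrr.
have Asurj g : exists2 x, x \in A & valuation x = g.
  pose hit n := `[< (0 < n)%N /\ exists2 z, z \in A & valuation z = g *+ n >].
  have [[n0 hn0]|nhit] := pselect (exists n, hit n); last first.
    have [x x0 xg] := valuation_surj_gt0 g; exists x => //.
    apply: Amax => z m zA; split.
      by rewrite nonzero_valD; apply: mulr_gt0; [exact: A_gt0|exact: nonzero_valMz_gt0].
    rewrite valuationD valuationMz xg; case: m => n; last first.
      rewrite NegzE mulrNz -pmulrn => /eqP; rewrite subr_eq0 => /eqP zg.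
      by case: nhit; exists n.+1; apply/asboolP; split=> //; exists z.
    rewrite -!pmulrn; case: n => [|n] /eqP; first by rewrite !mulr0n !addr0 => /eqP/A_eq0->.
    rewrite addrC addr_eq0 => /eqP gz; case: nhit; exists n.+1; apply/asboolP.
    by split=> //; exists (- z); rewrite ?rpredN // valuationN gz.
  have [n /asboolP[n_gt0 [z zA zg]] nmin] := ex_minnP (ex_intro hit n0 hn0).
  have [y y0 yz] := nonzero_root (A_gt0 _ zA) n_gt0.
  have yg : valuation y = g by apply: (@oz_mulrn_inj _ n) => //; rewrite -valuationMn yz.
  exists y => //; apply: Amax => z' m zA'; split.
    by rewrite nonzero_valD; apply: mulr_gt0; [exact: A_gt0|exact: nonzero_valMz_gt0].
  move=> e; suff yA : y *~ m \in A by apply: A_eq0 => //; rewrite rpredD.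
  have n_neq0 : n%:Z != 0 by rewrite eqz_nat -lt0n.
  have [r rE] : exists r : nat, (m %% n)%Z = r.
    by exists `|(m %% n)%Z|%N; rewrite gez0_abs // modz_ge0.
  have rn : (r < n)%N by rewrite -ltz_nat -rE ltz_pmod.
  (* Divide the exponent by [n]: a nonzero remainder [r] would give a smaller multiple of [g] among
     the values on [A], so [y *~ m] is a multiple of [z]. *)
  have mE : y *~ m = z *~ (m %/ n)%Z + y *+ r.
    by rewrite {1}(divz_eq m n) mulrzDr rE mulrC mulrzA -!pmulrn yz.
  have [r0|r_gt0] := posnP r; first by rewrite mE r0 mulr0n addr0 rpredMz.
  suff : hit r by move/nmin; rewrite leqNgt rn.
  apply/asboolP; split=> //; exists (- (z' + z *~ (m %/ n)%Z)).
    by rewrite rpredN rpredD ?rpredMz.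
  rewrite -yg -valuationMn valuationN; apply/eqP; rewrite eq_sym -addr_eq0 -valuationD.
  by rewrite addrC -addrA -mE e.
pose s g := s2val (cid2 (Asurj g)).
have sA g : s g \in A := s2valP (cid2 (Asurj g)).
have sg g : valuation (s g) = g := s2valP' (cid2 (Asurj g)).
have sZ : zmod_morphism s.
  by move=> g h; apply: Ainj; rewrite ?rpredB // valuationB !sg.
pose sM : {additive valgroup L -> nonzero L} :=
  HB.pack s (GRing.isZmodMorphism.Build _ _ s sZ).
exists sM; split=> // [g|x /A0A xA]; first exact: A_gt0.
by apply: Ainj => //; exact: sg.
Qed.

End ValueSection.

(** * Maximal sign-matching subrings of a product *)

(** Narrows an interval around an unattained point until no listed value is strictly inside; here
    the list consists of matched roots of a polynomial. *)
Lemma bracket (T : eqType) (E : realDomainType) (f : T -> E) (A : {pred T}) (x : E)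
    (zs : seq T) :
  (forall z, z \in A -> f z != x) -> {subset zs <= A} ->
  (exists2 a, a \in A & f a < x) -> (exists2 b, b \in A & x < f b) ->
  exists a b, [/\ a \in A, b \in A, f a < x, x < f b &
    {in zs, forall z, f z <= f a \/ f b <= f z}].
Proof.
move=> Ax + [a0 a0A a0x] [b0 b0A b0x]; elim: zs => [_|z zs IHzs zsA].
  by exists a0, b0.
have [|a [b [aA bA ax xb ab]]] := IHzs.
  by move=> z' z'zs; apply: zsA; rewrite inE z'zs orbT.
have zA : z \in A by apply: zsA; rewrite inE eqxx.
have [xz|zx|e] := ltgtP x (f z); last by have := Ax _ zA; rewrite e eqxx.
- exists a, (if f z < f b then z else b).
  case: ifPn => [zb|]; last first.
    rewrite -leNgt => bz; split=> // z'; rewrite inE => /orP[/eqP->|/ab//]; by right.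
  split=> // z'; rewrite inE => /orP[/eqP->|/ab[za|bz]]; [by right|by left|right].
  exact: le_trans (ltW zb) bz.
exists (if f a < f z then z else a), b.
case: ifPn => [az|]; last first.
  rewrite -leNgt => za; split=> // z'; rewrite inE => /orP[/eqP->|/ab//]; by left.
split=> // z'; rewrite inE => /orP[/eqP->|/ab[za|bz]]; [by left|left|by right].
exact: le_trans za (ltW az).
Qed.

Section MatchedSigns.
Variables E F : realDomainType.
Implicit Types z w : (E * F)%type.

(** Signs are taken in [int], where those from two different fields can be compared. *)
Definition sgmatch z := sgz z.1 = sgz z.2.

Lemma sgmatchM z w : sgmatch z -> sgmatch w -> sgmatch (z * w).
Proof. by rewrite /sgmatch /= !sgzM => -> ->. Qed.

Lemma sgmatchMr z w : sgmatch (z * w) -> sgmatch w -> w.1 != 0 -> sgmatch z.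
Proof.
rewrite /sgmatch /= !sgzM => zw w12; rewrite -sgz_eq0 => w0.
by apply: (mulIf w0); rewrite zw w12.
Qed.

Lemma sgmatchX z n : sgmatch z -> sgmatch (z ^+ n).
Proof.
move=> zm; elim: n => [|n IHn]; first by rewrite expr0 /sgmatch /= !sgz1.
by rewrite exprS; apply: sgmatchM.
Qed.

Lemma sgmatch_eq0 z : sgmatch z -> (z.1 == 0) = (z.2 == 0).
Proof. by rewrite -(sgz_eq0 z.1) -(sgz_eq0 z.2) => ->. Qed.

Lemma sgmatch_gt0 z : sgmatch z -> (0 < z.1) = (0 < z.2).
Proof. by rewrite -(sgz_gt0 z.1) -(sgz_gt0 z.2) => ->. Qed.

Lemma sgmatch_lt0 z : sgmatch z -> (z.1 < 0) = (z.2 < 0).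
Proof. by rewrite -(sgz_lt0 z.1) -(sgz_lt0 z.2) => ->. Qed.

Lemma sgmatch_ltB z w : sgmatch (w - z) -> (z.1 < w.1) = (z.2 < w.2).
Proof. by move=> /sgmatch_gt0; rewrite /= !subr_gt0. Qed.

End MatchedSigns.

Section MaximalSubring.
Variables (E F : rcfType) (A : subringClosed (E * F)%type).
Implicit Types (z w a b : (E * F)%type) (P R : {poly E * F}).
Hypothesis Asg : {in A, forall z, sgmatch z}.
Hypothesis Amax : forall z, (forall P, P \is a polyOver A -> sgmatch P.[z]) -> z \in A.
Hypothesis cofE : forall x : E, exists2 z, z \in A & x < z.1.
Hypothesis cofF : forall y : F, exists2 z, z \in A & y < z.2.

Let lp P : {poly E} := map_poly fst P.
Let rp P : {poly F} := map_poly snd P.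

Let lpE P z : P.[z].1 = (lp P).[z.1].
Proof. by rewrite /lp (horner_map fst). Qed.

Let rpE P z : P.[z].2 = (rp P).[z.2].
Proof. by rewrite /rp (horner_map snd). Qed.

Let Alt z w : z \in A -> w \in A -> (z.1 < w.1) = (z.2 < w.2).
Proof. by move=> zA wA; apply: sgmatch_ltB; apply: Asg; rewrite rpredB. Qed.

Let Ale z w : z \in A -> w \in A -> (z.1 <= w.1) = (z.2 <= w.2).
Proof. by move=> zA wA; rewrite !leNgt Alt. Qed.

Lemma maxpair_inv z : z \in A -> z.1 != 0 -> (z.1^-1, z.2^-1) \in A.
Proof.
move=> zA z1; have z2 : z.2 != 0 by rewrite -(sgmatch_eq0 (Asg zA)).
apply: Amax => P PA.
have zz' : z * (z.1^-1, z.2^-1) = 1 by rewrite /GRing.mul /= /mul_pair /= !divff.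
have := Asg (horner_inv_coef zA zz' PA) => /sgmatchMr; apply.
  exact/sgmatchX/Asg.
suff -> : (z ^+ size P).1 = z.1 ^+ size P by rewrite expf_neq0.
exact: (rmorphXn fst).
Qed.

Lemma maxpair_half : (2^-1, 2^-1) \in A.
Proof.
have z2A : (2%:R : E * F) \in A by rewrite rpred_nat.
have e1 : (2%:R : E * F).1 = 2 by exact: (rmorph_nat fst).
have e2 : (2%:R : E * F).2 = 2 by exact: (rmorph_nat snd).
by have := maxpair_inv z2A; rewrite e1 e2; apply; rewrite pnatr_eq0.
Qed.

Let mid_mem a b : a \in A -> b \in A ->
  ((a.1 + b.1) / 2, (a.2 + b.2) / 2) \in A.
Proof. by move=> aA bA; apply: (rpredM (rpredD aA bA) maxpair_half). Qed.

Lemma maxpair_cofN (x : E) : exists2 z, z \in A & z.1 < x.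
Proof.
have [z zA xz] := cofE (- x); exists (- z); first by rewrite rpredN.
by rewrite /= ltrNl.
Qed.

Lemma maxpair_cofN2 (y : F) : exists2 z, z \in A & z.2 < y.
Proof.
have [z zA xz] := cofF (- y); exists (- z); first by rewrite rpredN.
by rewrite /= ltrNl.
Qed.

(** On [A] both components of an element vanish together, so either projection detects every nonzero
    coefficient. *)
Lemma maxpair_lp_eq0 P : P \is a polyOver A -> (lp P == 0) = (P == 0).
Proof.
move=> PA; apply/eqP/eqP => [/polyP P0|->]; last exact: rmorph0.
apply/polyP => i; have := P0 i; rewrite coef_map !coef0 /=.
have := sgmatch_eq0 (Asg (polyOverP PA i)).
by case: (P`_i) => u v /= uv /eqP; rewrite uv => /eqP v0; move: uv; rewrite v0 eqxx => /eqP->.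
Qed.

Lemma maxpair_rp_eq0 P : P \is a polyOver A -> (rp P == 0) = (P == 0).
Proof.
move=> PA; apply/eqP/eqP => [/polyP P0|->]; last exact: rmorph0.
apply/polyP => i; have := P0 i; rewrite coef_map !coef0 /=.
have := sgmatch_eq0 (Asg (polyOverP PA i)).
by case: (P`_i) => u v /= uv /eqP; rewrite -uv => /eqP u0; move: uv; rewrite u0 eqxx => /esym/eqP->.
Qed.

(** Finitely many pairs account for the roots on both sides; finiteness is what allows an interval
    with ends in [A] to avoid them all. *)
Definition covered P := exists zs : seq (E * F), [/\ {subset zs <= A},
  forall x, root (lp P) x -> exists2 z, z \in zs & z.1 = x &
  forall y, root (rp P) y -> exists2 z, z \in zs & z.2 = y].

Lemma coveredI P : P != 0 -> P \is a polyOver A ->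
  (forall x, root (lp P) x -> exists2 z, z \in A & z.1 = x) ->
  (forall y, root (rp P) y -> exists2 z, z \in A & z.2 = y) -> covered P.
Proof.
move=> P0 PA hE hF.
have cov (T : eqType) (f : (E * F)%type -> T) (r : seq T) :
    (forall x, x \in r -> exists2 z, z \in A & f z = x) ->
    exists2 zs : seq (E * F), {subset zs <= A} &
      forall x, x \in r -> exists2 z, z \in zs & f z = x.
  elim: r => [|x r IHr] hr; first by exists [::].
  have [|zs zsA zsr] := IHr; first by move=> y yr; apply: hr; rewrite inE yr orbT.
  have [|z zA zx] := hr x; first by rewrite inE eqxx.
  exists (z :: zs) => [w|y]; rewrite inE; first by case/orP => [/eqP->|/zsA].
  case/orP => [/eqP->|/zsr[w wzs wy]]; first by exists z; rewrite ?inE ?eqxx.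
  by exists w; rewrite ?inE ?wzs ?orbT.
have lP0 : lp P != 0 by rewrite maxpair_lp_eq0.
have rP0 : rp P != 0 by rewrite maxpair_rp_eq0.
have inE' := roots_on_rootsR lP0; have inF' := roots_on_rootsR rP0.
have [|zs zsA zsE] := cov E fst (rootsR (lp P)).
  by move=> x; rewrite -inE' => /andP[_ /hE].
have [|ws wsA wsF] := cov F snd (rootsR (rp P)).
  by move=> y; rewrite -inF' => /andP[_ /hF].
exists (zs ++ ws); split=> [z|x rx|y ry].
- by rewrite mem_cat => /orP[/zsA|/wsA].
- have [|z zzs zx] := zsE x; first by rewrite -inE' rx in_itv.
  by exists z; rewrite ?mem_cat ?zzs.
have [|z zzs zx] := wsF y; first by rewrite -inF' ry in_itv.
by exists z; rewrite ?mem_cat ?zzs ?orbT.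
Qed.

Let noroots (zs : seq (E * F)) P a b : {subset zs <= A} -> a \in A -> b \in A ->
    (forall x, root (lp P) x -> exists2 z, z \in zs & z.1 = x) ->
    (forall y, root (rp P) y -> exists2 z, z \in zs & z.2 = y) ->
    {in zs, forall z, z.1 <= a.1 \/ b.1 <= z.1} ->
  {in `]a.1, b.1[, forall x, ~~ root (lp P) x} /\ {in `]a.2, b.2[, forall y, ~~ root (rp P) y}.
Proof.
move=> zsA aA bA covE covF zab; split=> x; rewrite in_itv /= => /andP[ax xb]; apply/negP.
  by move=> /covE[z zzs zx]; have := zab z zzs; rewrite zx !leNgt ax xb => -[].
move=> /covF[z zzs zx]; have zA := zsA _ zzs; have := zab z zzs.
by rewrite !Ale // zx !leNgt ax xb => -[].
Qed.

(** A narrow enough interval with ends in [A] contains the cut but no root of either projection of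
    [R]. The signs at [(x, y)] are then those at the midpoint, which lies in [A]. *)
Lemma cut_sgmatch (x : E) (y : F) R : R \is a polyOver A ->
    (forall z, z \in A -> z.1 != x) -> (forall z, z \in A -> z.2 != y) ->
    (forall z, z \in A -> (z.1 < x) = (z.2 < y)) ->
  R = 0 \/ covered R -> sgmatch R.[(x, y)].
Proof.
move=> RA Ax Ay cut [->|[zs [zsA covE covF]]].
  by rewrite horner0 /sgmatch /= !sgz0.
have [a [b [aA bA ax xb zab]]] :=
  bracket Ax zsA (maxpair_cofN x) (cofE x).
have ay : a.2 < y by rewrite -cut.
have yb : y < b.2 by rewrite ltNge le_eqVlt (negPf (Ay _ bA)) -cut //= -leNgt ltW.
have [nrE nrF] := noroots zsA aA bA covE covF zab.
have ab1 := lt_trans ax xb; have ab2 := lt_trans ay yb.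
have mA := mid_mem aA bA; have := Asg (rpred_horner RA mA).
rewrite /sgmatch !lpE !rpE /= => mm.
have m1 : (a.1 + b.1) / 2 \in `]a.1, b.1[ := mid_in_itvoo ab1.
have m2 : (a.2 + b.2) / 2 \in `]a.2, b.2[ := mid_in_itvoo ab2.
have xab : x \in `]a.1, b.1[ by rewrite in_itv /= ax.
have yab : y \in `]a.2, b.2[ by rewrite in_itv /= ay.
rewrite -[LHS]sgz_sgr -[RHS]sgz_sgr (polyrN0_itv nrE m1 xab) (polyrN0_itv nrF m2 yab).
by rewrite !sgz_sgr.
Qed.

(** Both projections are monotone on the interval, in the same direction because the signs of the
    derivatives match at the midpoint. The sign of [P] thus tells on which side of the root an
    element of [A] lies, so [x] and [y] define the same cut. Since [P] kills [(x, y)], only covered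
    polynomials of smaller degree need testing. *)
Let root_pair_mem P a b (x : E) (y : F) : P \is monic -> P \is a polyOver A ->
    (forall R, R \is a polyOver A -> (size R < size P)%N -> R = 0 \/ covered R) ->
    a \in A -> b \in A -> a.1 < x < b.1 -> a.2 < y < b.2 ->
    root (lp P) x -> root (rp P) y ->
    {in `]a.1, b.1[, forall x, ~~ root (lp P^`()) x} ->
    {in `]a.2, b.2[, forall y, ~~ root (rp P^`()) y} ->
  (x, y) \in A.
Proof.
move=> Pm PA IH aA bA /andP[ax xb] /andP[ay yb] Px Py nrE nrF.
have dl : lp P^`() = (lp P)^`() by rewrite /lp deriv_map.
have dr : rp P^`() = (rp P)^`() by rewrite /rp deriv_map.
have ab1 := lt_trans ax xb; have ab2 := lt_trans ay yb.
have mA := mid_mem aA bA; have := Asg (rpred_horner (polyOver_deriv PA) mA).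
move=> /sgmatch_lt0; rewrite lpE rpE dl dr /= => mm.
rewrite dl in nrE; rewrite dr in nrF.
have zcut_in z : z \in A -> a.1 <= z.1 <= b.1 -> sgz (z.1 - x) = sgz (z.2 - y).
  move=> zA zab; have zab2 : z.2 \in `[a.2, b.2] by rewrite in_itv /= -!Ale.
  have xab : x \in `[a.1, b.1] by rewrite in_itv /= !ltW.
  have yab : y \in `[a.2, b.2] by rewrite in_itv /= !ltW.
  have := Asg (rpred_horner PA zA); rewrite /sgmatch lpE rpE.
  rewrite -[LHS]sgz_sgr -[RHS]sgz_sgr (root_sgp ab1 nrE xab) //.
  rewrite (root_sgp ab2 nrF yab) // !sgzM !sgz_sgr mm.
  by case: (_ < 0); rewrite ?expr1 ?expr0 ?sgz1 ?sgzN1 ?mul1r // !mulN1r => /oppr_inj.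
have zcut z : z \in A -> sgz (z.1 - x) = sgz (z.2 - y).
  move=> zA; have [az|za] := leP a.1 z.1; last first.
    rewrite !ltr0_sgz // subr_lt0; last exact: lt_trans ax.
    by apply: lt_trans ay; rewrite -Alt.
  have [zb|bz] := leP z.1 b.1; first by apply: zcut_in; rewrite ?az.
  rewrite !gtr0_sgz // subr_gt0; last exact: lt_trans bz.
  by apply: lt_trans yb _; rewrite -Alt.
have [[z zA zx]|nx] := pselect (exists2 z, z \in A & z.1 = x).
  suff zy : z.2 = y by rewrite -zx -zy -surjective_pairing.
  by apply/eqP; rewrite -subr_eq0 -sgz_eq0 -zcut // zx subrr sgz0.
have [[z zA zy]|ny] := pselect (exists2 z, z \in A & z.2 = y).
  suff zx : z.1 = x by rewrite -zx -zy -surjective_pairing.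
  by apply/eqP; rewrite -subr_eq0 -sgz_eq0 zcut // zy subrr sgz0.
have Pxy : P.[(x, y)] = 0.
  by rewrite [LHS]surjective_pairing lpE rpE (rootP Px) (rootP Py).
apply: Amax => R RA; have [R' [R'A sR' <-]] := polyOver_horner_reduce Pm PA Pxy RA.
apply: cut_sgmatch => //.
- by move=> z zA; apply/eqP => zx; apply: nx; exists z.
- by move=> z zA; apply/eqP => zy; apply: ny; exists z.
- by move=> z /zcut e; rewrite -(subr_lt0 x) -(subr_lt0 y) -(sgz_lt0 (_ - x)) e sgz_lt0.
exact: IH.
Qed.

Let ends_neg P a b (x : E) : P \is a polyOver A -> a.1 < x < b.1 -> root (lp P) x ->
  {in `]a.1, b.1[, forall x, ~~ root (lp P^`()) x} -> (lp P).[a.1] * (lp P).[b.1] < 0.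
Proof.
move=> PA /andP[ax xb] Px; have -> : lp P^`() = (lp P)^`() by rewrite /lp deriv_map.
move=> nr; have ab := lt_trans ax xb.
have xab : x \in `[a.1, b.1] by rewrite in_itv /= !ltW.
rewrite -sgr_lt0 sgrM (root_sgp ab nr xab) ?in_itv /= ?lexx ?(ltW ab) //.
rewrite (root_sgp ab nr xab _ Px) ?in_itv /= ?lexx ?(ltW ab) // mulrACA -expr2 sqrr_sign mul1r.
by rewrite ltr0_sg ?subr_lt0 // gtr0_sg ?subr_gt0 // mulr1 oppr_lt0 ltr01.
Qed.

Let ends_neg2 P a b (y : F) : P \is a polyOver A -> a.2 < y < b.2 -> root (rp P) y ->
  {in `]a.2, b.2[, forall y, ~~ root (rp P^`()) y} -> (rp P).[a.2] * (rp P).[b.2] < 0.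
Proof.
move=> PA /andP[ax xb] Px; have -> : rp P^`() = (rp P)^`() by rewrite /rp deriv_map.
move=> nr; have ab := lt_trans ax xb.
have xab : y \in `[a.2, b.2] by rewrite in_itv /= !ltW.
rewrite -sgr_lt0 sgrM (root_sgp ab nr xab) ?in_itv /= ?lexx ?(ltW ab) //.
rewrite (root_sgp ab nr xab _ Px) ?in_itv /= ?lexx ?(ltW ab) // mulrACA -expr2 sqrr_sign mul1r.
by rewrite ltr0_sg ?subr_lt0 // gtr0_sg ?subr_gt0 // mulr1 oppr_lt0 ltr01.
Qed.

Let ends_match P a b : P \is a polyOver A -> a \in A -> b \in A ->
  ((lp P).[a.1] * (lp P).[b.1] < 0) = ((rp P).[a.2] * (rp P).[b.2] < 0).
Proof.
move=> PA aA bA; rewrite -!lpE -!rpE.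
have := sgmatch_lt0 (Asg (rpredM (rpred_horner PA aA) (rpred_horner PA bA))).
by [].
Qed.

(** An unmatched root is isolated by elements of [A] between which the derivative has no root. The
    end values have opposite signs on one side, hence on the other, where the intermediate value
    theorem provides the partner. *)
Lemma maxpair_covered P : P \is a polyOver A -> P = 0 \/ covered P.
Proof.
move: {2}(size P) (leqnn (size P)) => n; elim: n P => [|n IHn] P szP PA.
  by left; apply/eqP; rewrite -size_poly_eq0 -leqn0.
have [->|P0] := eqVneq P 0; [by left|right].
wlog Pm : P szP PA P0 / P \is monic.
  move=> IH; have lA : lead_coef P \in A by exact: (polyOverP PA).
  have l10 : (lead_coef P).1 != 0.
    apply: contra P0 => l0; rewrite -lead_coef_eq0.
    move: (l0); rewrite (sgmatch_eq0 (Asg lA)); move: l0.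
    by case: (lead_coef P) => u v /= /eqP-> /eqP->.
  have l20 : (lead_coef P).2 != 0 by rewrite -(sgmatch_eq0 (Asg lA)).
  have cA := maxpair_inv lA l10; set c := (_, _) in cA.
  have clc : c * lead_coef P = 1.
    by rewrite /c [lead_coef P]surjective_pairing /GRing.mul /= /mul_pair /= !mulVf.
  have cPA : c *: P \is a polyOver A by rewrite polyOverZ.
  have scP : (size (c *: P) <= size P)%N by apply: size_scale_leq.
  have cPl : (c *: P)`_(size P).-1 = 1 by rewrite coefZ -lead_coefE.
  have cP0 : c *: P != 0.
    by apply: contra_neq (oner_neq0 (E * F)%type) => cP; rewrite -cPl cP coef0.
  (* In a ring with zero divisors scaling could lower the degree; here the coefficient 1 in top
     degree prevents it. *)
  have sP : size (c *: P) = size P.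
    apply/eqP; rewrite eqn_leq scP; case: (size P) cPl => [|m] //= cPl.
    rewrite ltnNge; apply/negP => sm; move: cPl; rewrite nth_default // => /esym/eqP.
    by rewrite oner_eq0.
  have [||zs [zsA covE covF]] := IH (c *: P) _ cPA cP0.
  - by rewrite sP.
  - by rewrite monicE lead_coefE sP cPl.
  exists zs; split=> // [x rx|y ry].
    by apply: covE; rewrite /lp linearZ /= rootE hornerZ (rootP rx) mulr0.
  by apply: covF; rewrite /rp linearZ /= rootE hornerZ (rootP ry) mulr0.
have sP' : (size P^`() < size P)%N by rewrite lt_size_deriv.
have IH R : R \is a polyOver A -> (size R < size P)%N -> R = 0 \/ covered R.
  by move=> RA sR; apply: IHn => //; rewrite -ltnS; apply: leq_trans szP.
have [sP1|sP1] := leqP (size P) 1.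
  have lP1 : lp P = 1.
    have lP : P = 1.
      by move: Pm; rewrite (size1_polyC sP1) monicE lead_coefC => /eqP->.
    by rewrite lP /lp rmorph1.
  have rP1 : rp P = 1.
    have lP : P = 1.
      by move: Pm; rewrite (size1_polyC sP1) monicE lead_coefC => /eqP->.
    by rewrite lP /rp rmorph1.
  by exists [::]; split=> // x; rewrite ?lP1 ?rP1 rootE hornerC oner_eq0.
have [P'0|[zs [zsA covE covF]]] := IH _ (polyOver_deriv PA) sP'.
  have : (P^`())`_(size P).-2 = 0 by rewrite P'0 coef0.
  rewrite coef_deriv; have -> : (size P).-2.+1 = (size P).-1.
    by move: sP1; case: (size P) => [|[]].
  rewrite -lead_coefE (monicP Pm) => /(congr1 fst) /= e.
  have : (1 *+ (size P).-1 : E * F).1 = 0 by rewrite e.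
  rewrite (rmorph_nat fst) => /eqP; rewrite pnatr_eq0.
  by move: sP1; case: (size P) => [|[]].
apply: coveredI => // [x rx|y ry].
  apply: contrapT => nx.
  have Ax z : z \in A -> z.1 != x by move=> zA; apply/eqP => zx; apply: nx; exists z.
  have [a [b [aA bA ax xb zab]]] := bracket Ax zsA (maxpair_cofN x) (cofE x).
  have [nrE nrF] := noroots zsA aA bA covE covF zab.
  have axb : a.1 < x < b.1 by rewrite ax.
  have := ends_neg PA axb rx nrE; rewrite (ends_match PA aA bA) => neg.
  have [|y] := @polyrcf.poly_ivtoo _ _ _ _ _ neg.
    by rewrite -Ale // ltW // (lt_trans ax).
  rewrite in_itv /= => ayb ry; apply: nx; exists (x, y) => //.
  exact: (root_pair_mem Pm PA IH aA bA axb ayb rx ry nrE nrF).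
apply: contrapT => ny.
have Ay z : z \in A -> z.2 != y by move=> zA; apply/eqP => zy; apply: ny; exists z.
have [a [b [aA bA ay yb zab]]] := bracket Ay zsA (maxpair_cofN2 y) (cofF y).
have zab1 : {in zs, forall z, z.1 <= a.1 \/ b.1 <= z.1}.
  by move=> z zzs; have zA := zsA _ zzs; have := zab z zzs; rewrite (Ale zA aA) (Ale bA zA).
have [nrE nrF] := noroots zsA aA bA covE covF zab1.
have ayb : a.2 < y < b.2 by rewrite ay.
have := ends_neg2 PA ayb ry nrF; rewrite -(ends_match PA aA bA) => neg.
have [|x] := @polyrcf.poly_ivtoo _ _ _ _ _ neg.
  by rewrite Ale // ltW // (lt_trans ay).
rewrite in_itv /= => axb rx; apply: ny; exists (x, y) => //.
exact: (root_pair_mem Pm PA IH aA bA axb ayb rx ry nrE nrF).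
Qed.

Lemma maxpair_cut_mem (x : E) (y : F) :
  (forall z, z \in A -> sgz (x - z.1) = sgz (y - z.2)) -> exists2 z, z \in A & z.1 = x.
Proof.
move=> cut; have [//|nx] := pselect (exists2 z, z \in A & z.1 = x).
exists (x, y) => //; apply: Amax => R RA; apply: cut_sgmatch => //.
- by move=> z zA; apply/eqP => zx; apply: nx; exists z.
- move=> z zA; apply/eqP => zy; apply: nx; exists z => //; apply/eqP.
  by rewrite eq_sym -subr_eq0 -sgz_eq0 cut // zy subrr sgz0.
- by move=> z /cut e; rewrite -(subr_gt0 z.1) -(subr_gt0 z.2) -(sgz_gt0 (x - _)) e sgz_gt0.
exact: maxpair_covered.
Qed.

End MaximalSubring.

(** * Embedding into Hahn series *)

Definition hahn_rcf (k : rcfType) (G : orderedZmodType)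
    (divG : forall n (g : G), (0 < n)%N -> exists h, h *+ n = g) : rcfType :=
  HB.pack (hahn k G)
    (Num.RealField_isClosed.Build (hahn k G) (hahn_real_closed divG)).

Lemma seq_argmin (T : eqType) d (E : orderType d) (f : T -> E) (ts : seq T) : ts != [::] ->
  exists2 t0, t0 \in ts & {in ts, forall t, (f t0 <= f t)%O}.
Proof.
elim: ts => // t ts IHts _; have [->|/IHts[t0 t0ts t0min]] := eqVneq ts [::].
  by exists t; rewrite ?inE // => t'; rewrite inE => /eqP->.
have [le|lt] := leP (f t) (f t0).
  exists t; first by rewrite inE eqxx.
  by move=> t'; rewrite inE => /orP[/eqP->//|/t0min]; apply: le_trans.
exists t0; first by rewrite inE t0ts orbT.
by move=> t'; rewrite inE => /orP[/eqP->|/t0min//]; apply: ltW.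
Qed.

(** Positive elements of a real closed field are squares, so every field morphism out of it
    preserves signs. *)
Lemma rmorph_rcf_sgz (E : rcfType) (F : realDomainType) (f : {rmorphism E -> F}) x :
  sgz (f x) = sgz x.
Proof.
have pos y : 0 < y -> 0 < f y.
  move=> y0; rewrite -(sqr_sqrtr (ltW y0)) rmorphXn /= exprn_even_gt0 //=.
  by rewrite fmorph_eq0 gt_eqF // sqrtr_gt0.
have [x0|x0|->] := ltgtP x 0; last by rewrite rmorph0 !sgz0.
  by rewrite !ltr0_sgz // -oppr_gt0 -rmorphN pos // oppr_gt0.
by rewrite !gtr0_sgz // pos.
Qed.

(** * Leading terms in [L] and in the Hahn field *)

Section Lead.
Variables (L : rcvfType) (k : rcfType) (G : orderedZmodType).
Variables (c : {rmorphism k -> L}) (s : G -> L).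
Hypothesis cV : forall r, c r \in valring.
Hypothesis c_onto : forall x, x \in valring -> exists r, vsmall (x - c r).
Hypothesis sD : forall g h, s (g + h) = s g * s h.
Hypothesis s_gt0 : forall g, 0 < s g.
Hypothesis sV : forall g, (s g \in valring) = (0 <= g).
Hypothesis s_onto : forall x, x != 0 ->
  exists2 g, x / s g \in valring & ~~ vsmall (x / s g).
Implicit Types (g h : G) (r : k) (x y : L) (z w : (L * hahn k G)%type).

Let s_neq0 g : s g != 0. Proof. exact: lt0r_neq0. Qed.

Let s0 : s 0 = 1.
Proof. by apply: (mulfI (s_neq0 0)); rewrite -sD addr0 mulr1. Qed.

Let sN g : s (- g) = (s g)^-1.
Proof. by apply: (mulfI (s_neq0 g)); rewrite -sD subrr s0 divff. Qed.

Lemma section_small g : vsmall (s g) = (0 < g).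
Proof.
rewrite /vsmall (negPf (s_neq0 g)) -sN sV /= -ltNge.
by rewrite -(oz_ltD2r g (- g)) addNr add0r.
Qed.

(** The coefficient [r] may be 0, meaning order greater than [g]; this makes the relation compatible
    with sums even when leading terms cancel. *)
Definition leadL g r x := vsmall (x / s g - c r).

(* [lead g r z]: both components of [z] have the form r x^g + (higher order
   terms), where in [L] the monomial r x^g is read as [c r * s g]. *)
Definition lead g r z := leadL g r z.1 /\ (z.2 \in hahn_ge g /\ z.2 g = r).

Lemma leadL_valring g r x : leadL g r x -> x / s g \in valring.
Proof. by move=> /vsmall_valring xV; rewrite -[x / s g](subrK (c r)) rpredD. Qed.

Lemma leadL_neq0 x : x != 0 -> exists g, exists2 r, r != 0 & leadL g r x.
Proof.
move=> /s_onto[g xV xS]; have [r xr] := c_onto xV; exists g, r => //.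
by apply: contra xS => /eqP r0; move: xr; rewrite r0 rmorph0 subr0.
Qed.

Lemma leadLB g r t x y : leadL g r x -> leadL g t y -> leadL g (r - t) (x - y).
Proof.
move=> xr yt; rewrite /leadL mulrBl rmorphB opprB addrCA addrA.
rewrite (_ : _ + _ = (x / s g - c r) + - (y / s g - c t)); last by ring.
by rewrite vsmallD // vsmallN.
Qed.

Lemma leadL0 g : leadL g 0 0.
Proof. by rewrite /leadL mul0r rmorph0 subrr vsmall0. Qed.

Lemma leadLN g r x : leadL g r x -> leadL g (- r) (- x).
Proof. by move=> /(leadLB (leadL0 g)); rewrite !sub0r. Qed.

Lemma leadLD g r t x y : leadL g r x -> leadL g t y -> leadL g (r + t) (x + y).
Proof. by move=> xr /leadLN/(leadLB xr); rewrite !opprK. Qed.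

Lemma leadLM g h r t x y : leadL g r x -> leadL h t y -> leadL (g + h) (r * t) (x * y).
Proof.
move=> xr yt; rewrite /leadL sD rmorphM.
rewrite (_ : _ - _ = (x / s g - c r) * (y / s h) + c r * (y / s h - c t)); last first.
  by field; rewrite !s_neq0.
by apply: vsmallD; [apply: vsmallMr => //; exact: leadL_valring yt|exact: vsmallMl].
Qed.

Lemma leadL_lt g h r x : h < g -> leadL g r x -> leadL h 0 x.
Proof.
move=> hg xr; rewrite /leadL rmorph0 subr0.
have -> : x / s h = x / s g * s (g - h).
  by rewrite sD sN mulrA divfK.
by rewrite vsmallMl ?(leadL_valring xr) // section_small oz_subr_gt0.
Qed.

Lemma leadL_mono g r : leadL g r (c r * s g).
Proof. by rewrite /leadL mulfK // subrr vsmall0. Qed.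

(** The quotient of [x] by [c r * s g] is 1 plus an infinitesimal, hence positive, and [s g] is
    positive too. *)
Lemma leadL_sgz g r x : leadL g r x -> r != 0 -> sgz x = sgz r.
Proof.
move=> xr r0; pose u := (x / s g - c r) / c r.
have cr0 : c r != 0 by rewrite fmorph_eq0.
have uS : vsmall u by rewrite vsmallMr // -fmorphV.
have xE : x = c r * s g * (1 + u) by rewrite /u; field; rewrite cr0 s_neq0.
have u1 : 0 < 1 + u.
  by rewrite -ltrBlDl sub0r ltrNl (le_lt_trans (ler_norm _)) // normrN vsmall_lt1.
by rewrite xE !sgzM (gtr0_sgz u1) (gtr0_sgz (s_gt0 g)) !mulr1 rmorph_rcf_sgz.
Qed.

Lemma hahn_coef_sgz g (b : hahn k G) : b \in hahn_ge g -> b g != 0 -> sgz b = sgz (b g).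
Proof.
move=> bg; case: (ltgtP (b g) 0) => // b0 _; first by rewrite !ltr0_sgz // (hahn_lt0_coef bg).
by rewrite !gtr0_sgz // (hahn_gt0_coef bg).
Qed.

Lemma lead_sgmatch g r z : lead g r z -> r != 0 -> sgmatch z.
Proof.
move=> [z1 [z2g z2r]] r0; rewrite /sgmatch (leadL_sgz z1 r0).
by rewrite (hahn_coef_sgz z2g) z2r.
Qed.

Lemma lead0 g : lead g 0 0.
Proof.
by split; [exact: leadL0|split; rewrite ?rpred0].
Qed.

Lemma leadB g r t z w : lead g r z -> lead g t w -> lead g (r - t) (z - w).
Proof.
move=> [z1 [z2 z2r]] [w1 [w2 w2t]]; split; first exact: leadLB.
by split; rewrite ?rpredB // hahnBE z2r w2t.
Qed.

Lemma leadD g r t z w : lead g r z -> lead g t w -> lead g (r + t) (z + w).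
Proof.
move=> zr wt; have := leadB zr (leadB (lead0 g) wt).
by rewrite !sub0r !opprK.
Qed.

Lemma leadM g h r t z w : lead g r z -> lead h t w -> lead (g + h) (r * t) (z * w).
Proof.
move=> [z1 [z2 z2r]] [w1 [w2 w2t]]; split; first exact: leadLM.
by split; [exact: hahn_geM|rewrite hahn_mul_coef // z2r w2t].
Qed.

Lemma lead_lt g h r z : h < g -> lead g r z -> lead h 0 z.
Proof.
move=> hg [z1 [z2 _]]; split; first exact: leadL_lt hg z1.
by have := hahn_ge_gt hg z2; rewrite hahn_gtE => /andP[? /eqP].
Qed.

Definition pairmono r g : (L * hahn k G)%type := (c r * s g, hahn_mono g r).

Lemma lead_pairmono g r : lead g r (pairmono r g).
Proof.
split; first exact: leadL_mono.
by split; rewrite ?hahn_mono_ge // hahn_monoE eqxx.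
Qed.

Lemma pairmonoM r t g h : pairmono r g * pairmono t h = pairmono (r * t) (g + h).
Proof.
rewrite /pairmono -hahn_monoM rmorphM sD.
by congr pair; rewrite mulrACA.
Qed.

Lemma pairmonoD r t g : pairmono r g + pairmono t g = pairmono (r + t) g.
Proof.
rewrite /pairmono rmorphD mulrDl; congr pair.
by apply: hahnP => h; rewrite hahnDE !hahn_monoE; case: eqP; rewrite ?addr0.
Qed.

Lemma pairmono0 g : pairmono 0 g = 0.
Proof.
rewrite /pairmono rmorph0 mul0r; congr pair.
by apply/eqP; rewrite hahn_mono_eq0.
Qed.

Lemma pairmono_sum (I : Type) (us : seq I) (f : I -> k) g :
  \sum_(u <- us) pairmono (f u) g = pairmono (\sum_(u <- us) f u) g.
Proof.
elim: us => [|u us IHus]; first by rewrite !big_nil pairmono0.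
by rewrite !big_cons IHus pairmonoD.
Qed.

Lemma pairmono1 : pairmono 1 0 = 1.
Proof. by rewrite /pairmono rmorph1 s0 mulr1. Qed.

(** * The ring generated by the monomials and a given embedded subfield *)

Section Amalgam.
Variables (M : fieldType) (j : {rmorphism M -> L}) (phi : {rmorphism M -> hahn k G}).

Definition diagmap (a : M) : (L * hahn k G)%type := (j a, phi a).

(** The element [b] realises the leading monomial of [a] exactly, in [L] and in the Hahn field at
    once. Relations between leading monomials can therefore be rewritten with coefficients in
    [M]. *)
Hypothesis M_lead : forall a, a != 0 -> exists b g r,
  [/\ r != 0, diagmap b = pairmono r g & lead g r (diagmap a)].

Lemma diagmapB a b : diagmap (a - b) = diagmap a - diagmap b.
Proof. by rewrite /diagmap !rmorphB. Qed.

Lemma diagmapM a b : diagmap (a * b) = diagmap a * diagmap b.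
Proof. by rewrite /diagmap !rmorphM. Qed.

Lemma diagmap0 : diagmap 0 = 0.
Proof. by rewrite /diagmap !rmorph0. Qed.

Lemma diagmap1 : diagmap 1 = 1.
Proof. by rewrite /diagmap !rmorph1. Qed.

Definition term_val (t : M * k * G) := diagmap t.1.1 * pairmono t.1.2 t.2.

Definition terms_val (ts : seq (M * k * G)) := \sum_(t <- ts) term_val t.

(* Either the terms of least order add up to a nonzero leading term, or their
   leading monomials satisfy a linear relation that eliminates one of them. *)
Lemma terms_val_sgmatch ts : sgmatch (terms_val ts).
Proof.
move: {2}(size ts) (leqnn (size ts)) => n; elim: n ts => [|n IHn] ts szts.
  by move: szts; rewrite leqn0 => /nilP->; rewrite /terms_val big_nil /sgmatch /= !sgz0.
have perm (t : M * k * G) : t \in ts -> terms_val ts = term_val t + terms_val (rem t ts).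
  by move=> tts; rewrite /terms_val (perm_big _ (perm_to_rem tts)) big_cons.
have szrem (t : M * k * G) : t \in ts -> (size (rem t ts) <= n)%N.
  by move=> tts; rewrite size_rem // -ltnS prednK // (leq_ltn_trans _ (_ : 0 < size ts)%N) //;
    case: (ts) tts.
have [/hasP[t tts t0]|/hasPn nz] :=
    boolP (has (fun t => (t.1.1 == 0) || (t.1.2 == 0)) ts).
  rewrite (perm t) // (_ : term_val t = 0) ?add0r; first exact: IHn (szrem _ tts).
  rewrite /term_val; case/orP: t0 => /eqP->; first by rewrite diagmap0 mul0r.
  by rewrite pairmono0 mulr0.
have [ts0|ts0] := eqVneq ts [::].
  by rewrite ts0 /terms_val big_nil /sgmatch /= !sgz0.
have Bex a : exists bgr : M * G * k, a != 0 ->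
    [/\ bgr.2 != 0, diagmap bgr.1.1 = pairmono bgr.2 bgr.1.2 & lead bgr.1.2 bgr.2 (diagmap a)].
  have [->|a0] := eqVneq a 0; first by exists (0, 0, 0).
  by have [b [g [r h]]] := M_lead a0; exists (b, g, r).
pose B a := sval (cid (Bex a)).
have BP a : a != 0 -> [/\ (B a).2 != 0, diagmap (B a).1.1 = pairmono (B a).2 (B a).1.2 &
    lead (B a).1.2 (B a).2 (diagmap a)] := svalP (cid (Bex a)).
have nz1 (t : M * k * G) : t \in ts -> t.1.1 != 0 by move=> /nz; rewrite negb_or => /andP[].
have nz2 (t : M * k * G) : t \in ts -> t.1.2 != 0 by move=> /nz; rewrite negb_or => /andP[].
pose gam (t : M * k * G) := (B t.1.1).1.2 + t.2.
pose rho (t : M * k * G) := (B t.1.1).2 * t.1.2.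
have tlead (t : M * k * G) : t \in ts -> lead (gam t) (rho t) (term_val t).
  move=> tts; have [_ _ la] := BP _ (nz1 _ tts).
  exact: leadM la (lead_pairmono _ _).
have [t0 t0ts t0min] := seq_argmin gam ts0.
pose g0 := gam t0; pose top t := gam t == g0.
have sumlead (us : seq (M * k * G)) : {subset us <= ts} ->
    lead g0 (\sum_(t <- us) if top t then rho t else 0) (terms_val us).
  rewrite /terms_val; elim: us => [|t us IHus] usts; first by rewrite !big_nil; apply: lead0.
  rewrite !big_cons; apply: leadD; last by apply: IHus => t' t'us; apply: usts; rewrite inE t'us orbT.
  have tts : t \in ts by apply: usts; rewrite inE eqxx.
  case: ifP => [/eqP <-|/negbT nt]; first exact: tlead.
  by apply: lead_lt (tlead _ tts); rewrite lt_neqAle eq_sym nt t0min.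
have [sig0|] := eqVneq (\sum_(t <- ts) if top t then rho t else 0) 0; last first.
  exact: lead_sgmatch (sumlead ts (fun _ => id)).
pose mon (t : M * k * G) : (L * hahn k G)%type := pairmono t.1.2 t.2.
(* The leading coefficients add up to 0 at the common exponent [g0]. As each leading monomial comes
   from [M], this is an exact relation in the product ring, without error terms. *)
have rel : \sum_(t <- ts) (if top t then diagmap (B t.1.1).1.1 * mon t else 0) = 0.
  transitivity (pairmono (\sum_(t <- ts) if top t then rho t else 0) g0); last first.
    by rewrite sig0 pairmono0.
  rewrite -pairmono_sum.
  apply: eq_big_seq => t tts; case: ifP => [/eqP tg|_]; last by rewrite pairmono0.
  by have [_ -> _] := BP _ (nz1 _ tts); rewrite pairmonoM -tg.
pose b0 := (B t0.1.1).1.1.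
have b00 : b0 != 0.
  have [r0 bE _] := BP _ (nz1 _ t0ts); apply: contra_neq r0 => b00.
  move: bE; rewrite -/b0 b00 diagmap0 => /(congr1 snd) /= /esym/eqP.
  by rewrite hahn_mono_eq0 => /eqP.
(* The multiple [q] of the relation has the same term at [t0] as the given sum. Subtracting it
   removes [t0] and alters only the coefficients in [M] of the other terms. *)
pose q := t0.1.1 / b0.
pose new (t : M * k * G) := (t.1.1 - (if top t then q * (B t.1.1).1.1 else 0), t.1.2, t.2).
suff -> : terms_val ts = terms_val (map new (rem t0 ts)).
  by apply: IHn; rewrite size_map szrem.
rewrite (perm t0) // /terms_val big_map -[RHS]add0r.
have -> : term_val t0 = - (\sum_(t <- rem t0 ts) diagmap (if top t then q * (B t.1.1).1.1 else 0) * mon t).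
  move: rel; rewrite (perm_big _ (perm_to_rem t0ts)) big_cons /top eqxx => /eqP.
  rewrite addr_eq0 => /eqP rel.
  have -> : term_val t0 = diagmap q * (diagmap b0 * mon t0).
    by rewrite mulrA -diagmapM divfK.
  rewrite rel mulrN mulr_sumr; congr (- _); apply: eq_bigr => t _.
  by rewrite -/g0; case: ifP => _; rewrite ?mulr0 ?diagmap0 ?mul0r // mulrA -diagmapM.
rewrite add0r addrC -sumrB; apply: eq_bigr => t _.
by rewrite /term_val /= diagmapB mulrBl.
Qed.

Definition amalgam : {pred (L * hahn k G)%type} :=
  [pred z | `[< exists ts, z = terms_val ts >]].

Lemma terms_val1 (t : M * k * G) : terms_val [:: t] = term_val t.
Proof. by rewrite /terms_val big_seq1. Qed.

Lemma amalgam_subring : subring_closed amalgam.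
Proof.
split=> [|_ _ /asboolP[ts ->] /asboolP[us ->]|_ _ /asboolP[ts ->] /asboolP[us ->]].
- apply/asboolP; exists [:: (1, 1, 0)].
  by rewrite terms_val1 /term_val diagmap1 pairmono1 mulr1.
- apply/asboolP; exists (ts ++ [seq (- t.1.1, t.1.2, t.2) | t <- us]).
  rewrite /terms_val big_cat big_map -sumrN /=; congr (_ + _).
  by apply: eq_bigr => t _; rewrite /term_val /= -[- t.1.1]sub0r diagmapB diagmap0 sub0r mulNr.
apply/asboolP; exists [seq (t.1.1 * u.1.1, t.1.2 * u.1.2, t.2 + u.2) | t <- ts, u <- us].
rewrite /terms_val big_allpairs_dep mulr_suml; apply: eq_bigr => t _.
rewrite mulr_sumr; apply: eq_bigr => u _.
by rewrite /term_val /= diagmapM -pairmonoM mulrACA.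
Qed.

Lemma amalgam_pairmono r g : pairmono r g \in amalgam.
Proof.
apply/asboolP; exists [:: (1, r, g)].
by rewrite terms_val1 /term_val diagmap1 mul1r.
Qed.

Lemma amalgam_diagmap a : diagmap a \in amalgam.
Proof.
apply/asboolP; exists [:: (a, 1, 0)].
by rewrite terms_val1 /term_val pairmono1 mulr1.
Qed.

Section Embedding.
Hypothesis divG : forall n (g : G), (0 < n)%N -> exists h, h *+ n = g.
Variable A : subringClosed (L * hahn k G)%type.
Hypothesis A0A : {subset amalgam <= A}.
Hypothesis Asg : {in A, forall z, sgmatch z}.
Hypothesis Amax :
  forall z, (forall P, P \is a polyOver A -> sgmatch P.[z]) -> z \in A.

Let pairmonoA r g : pairmono r g \in A.
Proof. exact/A0A/amalgam_pairmono. Qed.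

(** After subtracting the monomial, the first component is smaller in absolute value than
    [c e * s g] for every positive [e]. Matching signs carry these bounds to the second component,
    and they force its order above [g]. *)
Lemma maxpair_lead z g r : z \in A -> leadL g r z.1 -> lead g r z.
Proof.
move=> zA z1; pose w := z - pairmono r g.
have wA : w \in A by rewrite rpredB.
have w1 : leadL g 0 w.1 by rewrite -(subrr r); apply: leadLB z1 (leadL_mono _ _).
have bound e u : 0 < e -> u \in A -> leadL g 0 u.1 -> 0 < hahn_mono g e + u.2 :> hahn k G.
  move=> e0 uA u1; have sA : pairmono e g + u \in A by rewrite rpredD.
  suff : 0 < (pairmono e g + u).1 by rewrite (sgmatch_gt0 (Asg sA)).
  rewrite -sgz_gt0 (@leadL_sgz g e) ?gt_eqF // ?gtr0_sgz //.
  by have := leadLD (leadL_mono g e) u1; rewrite addr0.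
suff dg : w.2 \in hahn_gt g.
  have zE : z = pairmono r g + w by rewrite /w addrC subrK.
  split=> //; rewrite zE; have [_ [mg mr]] := lead_pairmono g r.
  split; first by rewrite rpredD // hahn_gtW.
  by rewrite hahnDE mr; move: dg; rewrite hahn_gtE => /andP[_ /eqP->]; rewrite addr0.
have [->|d0] := eqVneq w.2 0; first exact: rpred0.
have [gv|vg] := ltP g (hahn_val w.2); first exact: hahn_ge_gt gv (hahn_ge_val _).
exfalso; set v := hahn_val w.2 in vg; pose l := w.2 v.
have l0 : l != 0 by apply: hahn_val_neq0.
(* Half of [|l|] suffices even when [v = g]; if [v] is less than [g], the monomial does not
   contribute at [v] at all. *)
pose e := `|l| / 2; have e0 : 0 < e by rewrite divr_gt0 ?normr_gt0.
have mv : hahn_mono g e \in hahn_ge v := hahn_ge_le vg (hahn_mono_ge _ _).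
have mve : hahn_mono g e v <= e by rewrite hahn_monoE; case: ifP => // _; exact: ltW.
have e_lt : e < `|l| by rewrite /e ltr_pdivrMr // ltr_pMr ?normr_gt0 // ltr1n.
have wv : w.2 \in hahn_ge v := hahn_ge_val _.
have [ln|lp] := ltP l 0.
  have := bound e w e0 wA w1; rewrite ltNge; move/negP; apply; apply: ltW.
  apply: (@hahn_lt0_coef _ _ _ v); first by rewrite rpredD.
  rewrite hahnDE -/l; apply: le_lt_trans (lerD mve (lexx l)) _.
  by rewrite -[l]opprK subr_lt0 -(ltr0_norm ln).
have w1N : leadL g 0 (- w).1 by rewrite -oppr0; apply: leadLN.
have := bound e (- w) e0 _ w1N; rewrite rpredN => /(_ wA).
rewrite ltNge; move/negP; apply; apply: ltW.
apply: (@hahn_lt0_coef _ _ _ v); first by rewrite rpredB.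
rewrite hahnBE -/l; apply: le_lt_trans (lerD mve (lexx (- l))) _.
by rewrite subr_lt0 -[X in _ < X]ger0_norm.
Qed.

Lemma maxpair_cofL x : exists2 z, z \in A & x < z.1.
Proof.
have [->|/leadL_neq0[g [r r0 xr]]] := eqVneq x 0; first by exists 1; rewrite ?rpred1 //= ltr01.
exists (pairmono (`|r| + 1) g) => //; rewrite -subr_gt0 -sgz_gt0.
have pos : 0 < `|r| + 1 - r by rewrite -addrA addrCA ltr_wpDr // subr_ge0 ler_norm.
by rewrite (leadL_sgz (leadLB (leadL_mono g (`|r| + 1)) xr)) ?gt_eqF // sgz_gt0.
Qed.

Lemma maxpair_cofH (b : hahn k G) : exists2 z, z \in A & b < z.2.
Proof.
exists (pairmono (`|b (hahn_val b)| + 1) (hahn_val b)) => //; rewrite -subr_gt0.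
apply: (@hahn_gt0_coef _ _ _ (hahn_val b)); first by rewrite rpredB ?hahn_mono_ge ?hahn_ge_val.
rewrite hahnBE hahn_monoE eqxx; set r := b _.
by rewrite -addrA addrCA ltr_wpDr // subr_ge0 ler_norm.
Qed.

(* The coefficients of the series realising the cut of [x]: whenever [z] in [A]
   approximates [x] up to order [g] with error [c r * s g], the coefficient at
   [g] is the one of [z.2] corrected by [r]. *)
Lemma maxpair_limit x : exists y : hahn k G, forall z g r, z \in A ->
  leadL g r (x - z.1) -> y - z.2 \in hahn_ge g /\ (y - z.2) g = r.
Proof.
pose near g (zr : (L * hahn k G) * k) := zr.1 \in A /\ leadL g zr.2 (x - zr.1.1).
pose yfun g := if pselect (exists zr, near g zr) is left ex
  then (sval (cid ex)).1.2 g + (sval (cid ex)).2 else 0.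
(* Two approximations of [x] differ by an element of [A] whose leading term is known in [L], hence
   also in the Hahn field. *)
have uniq g z r z' r' : near g (z, r) -> near g (z', r') -> z.2 g + r = z'.2 g + r'.
  move=> [/= zA zr] [/= zA' zr'].
  have d1 : leadL g (r' - r) (z - z').1.
    have -> : (z - z').1 = (x - z'.1) - (x - z.1) by rewrite /=; ring.
    exact: leadLB zr' zr.
  have [_ [_]] : lead g (r' - r) (z - z') by apply: maxpair_lead => //; rewrite rpredB.
  by rewrite hahnBE => e; rewrite -[z.2 g](subrK (z'.2 g)) e; ring.
have yE g z r : z \in A -> leadL g r (x - z.1) -> yfun g = z.2 g + r.
  move=> zA zr; have zn : near g (z, r) by [].
  rewrite /yfun; case: pselect => [ex|[]]; last by exists (z, r).
  by case: cid => -[z' r'] /= zn'; apply: uniq zn' zn.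
have woy : yfun \in @wo_support k G.
  apply/wo_supportP => B By [g0 Bg0].
  have [[z r] [/= zA zr]] : exists zr, near g0 zr.
    by have := By _ Bg0; rewrite /= /yfun; case: pselect => // _ /eqP.
  (* Up to [g0] the coefficients are those of this single series, so the part of the support up to
     [g0] is well-ordered. *)
  pose b := z.2 + hahn_mono g0 r.
  have bE h : h <= g0 -> yfun h = b h.
    rewrite le_eqVlt => /orP[/eqP->|hg]; rewrite hahnDE hahn_monoE.
      by rewrite eqxx; apply: yE.
    by rewrite lt_eqF // (yE h z 0) //; apply: leadL_lt hg zr.
  have [||m [Bm mx] mmin] := @hahn_wo _ _ b (B `&` [set h | h <= g0]).
  - by move=> h [Bh hg]; change (b h != 0); rewrite -bE //; apply: By.
  - by exists g0; split=> //=.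
  exists m => // h Bh; have [hg|gh] := leP h g0; first by apply: mmin.
  exact: le_trans (ltW gh).
exists (Hahn woy) => z g r zA zr; split; last by rewrite hahnBE /= (yE g z r) // addrC addKr.
apply/hahn_geP => h hg; rewrite hahnBE /= (yE h z 0) //; first by rewrite addr0 subrr.
exact: leadL_lt hg zr.
Qed.

(** The series found for [x] makes [x - z.1] and [y - z.2] share their leading coefficient, hence
    their sign, for every [z] in [A]; so [x] and [y] fill the same cut. *)
Lemma maxpair_total x : exists2 z, z \in A & z.1 = x.
Proof.
have [y yx] := maxpair_limit x.
suff cut z : z \in A -> sgz (x - z.1) = sgz (y - z.2).
  exact (@maxpair_cut_mem L (hahn_rcf k divG) A Asg Amax maxpair_cofL maxpair_cofH x y cut).
move=> zA; have [xz|xz] := eqVneq (x - z.1) 0.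
  suff yz : y - z.2 = 0 by rewrite xz yz !sgz0.
  apply: hahnP => g; have [] := yx z g 0 zA; last by rewrite hahn0E.
  by rewrite xz; have [] := lead0 g.
have [g [r r0 zr]] := leadL_neq0 xz; have [yg ygr] := yx z g r zA zr.
by rewrite (leadL_sgz zr r0) -ygr -hahn_coef_sgz // ygr.
Qed.

Lemma maxpair_fun z w : z \in A -> w \in A -> z.1 = w.1 -> z.2 = w.2.
Proof.
move=> zA wA zw; have zwA : z - w \in A by rewrite rpredB.
apply/eqP; rewrite -subr_eq0; have := sgmatch_eq0 (Asg zwA).
by rewrite /= zw subrr eqxx => <-.
Qed.

End Embedding.

Theorem hahn_embedding :
    (forall n (g : G), (0 < n)%N -> exists h, h *+ n = g) ->
  exists e : {rmorphism L -> hahn k G},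
    [/\ forall r, e (c r) = hahn_mono 0 r, forall g, e (s g) = hahn_mono g 1,
      forall a, e (j a) = phi a &
      forall x g r, leadL g r x -> e x \in hahn_ge g /\ e x g = r].
Proof.
move=> divG.
have [|A [A0A Asg Amax]] := @zorn_subring _ (@sgmatch L (hahn k G)) _ amalgam_subring.
  by move=> _ /asboolP[ts ->]; apply: terms_val_sgmatch.
have tot := maxpair_total divG A0A Asg Amax.
pose e x := (s2val (cid2 (tot x))).2.
have eA x : (x, e x) \in A.
  have zA : s2val (cid2 (tot x)) \in A := s2valP (cid2 (tot x)).
  have zx : (s2val (cid2 (tot x))).1 = x := s2valP' (cid2 (tot x)).
  by rewrite -{1}zx /e -surjective_pairing.
have eE x (y : hahn k G) : (x, y) \in A -> e x = y.
  by move=> xyA; apply: (maxpair_fun Asg (eA x) xyA).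
have eZ : zmod_morphism e.
  by move=> x y; apply: eE; exact: (rpredB (eA x) (eA y)).
have eM : monoid_morphism e.
  by split=> [|x y]; apply: eE; [exact: (rpred1 A)|exact: (rpredM (eA x) (eA y))].
pose eR : {rmorphism L -> hahn k G} := HB.pack e
  (GRing.isZmodMorphism.Build _ _ e eZ) (GRing.isMonoidMorphism.Build _ _ e eM).
exists eR; split=> [r|g|a|x g r xr].
- by apply: eE; have := A0A _ (amalgam_pairmono r 0); rewrite /pairmono s0 mulr1.
- by apply: eE; have := A0A _ (amalgam_pairmono 1 g); rewrite /pairmono rmorph1 mul1r.
- by apply: eE; exact: (A0A _ (amalgam_diagmap a)).
by have [] := maxpair_lead A0A Asg (eA x) xr.
Qed.

End Amalgam.
End Lead.

(** * The residue field as a real closed field *)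

Section ResidueOrder.
Variables (L : rcvfType) (c : {rmorphism resfield L -> L}).
Hypothesis cV : forall r, c r \in valring.
Hypothesis cK : forall r, vres (c r) = r.
Implicit Types a b r : resfield L.

(** The order is pulled back along the section, whose image is a subfield of the ordered field
    [L]. *)
Let res_le a b := c a <= c b.
Let res_lt a b := (b != a) && res_le a b.
Let res_norm a := if res_le 0 a then a else - a.

Let le0_add a b : res_le 0 a -> res_le 0 b -> res_le 0 (a + b).
Proof. by rewrite /res_le rmorph0 rmorphD; apply: addr_ge0. Qed.

Let le0_mul a b : res_le 0 a -> res_le 0 b -> res_le 0 (a * b).
Proof. by rewrite /res_le rmorph0 rmorphM; apply: mulr_ge0. Qed.

Let le0_anti a : res_le 0 a -> res_le a 0 -> a = 0.
Proof.
rewrite /res_le rmorph0 => a0 a0'; apply/eqP.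
by rewrite -(fmorph_eq0 c) eq_le a0 a0'.
Qed.

Let res_sub_ge0 a b : res_le 0 (b - a) = res_le a b.
Proof. by rewrite /res_le rmorph0 rmorphB subr_ge0. Qed.

Let le0_total a : res_le 0 a || res_le a 0.
Proof. exact: le_total. Qed.

Let res_normN a : res_norm (- a) = res_norm a.
Proof.
rewrite /res_norm /res_le rmorph0 rmorphN oppr_ge0 opprK.
case: ltgtP => // /eqP; rewrite fmorph_eq0 => /eqP->; by rewrite oppr0.
Qed.

Let res_ge0_norm a : res_le 0 a -> res_norm a = a.
Proof. by rewrite /res_norm => ->. Qed.

Definition resfield_real : realFieldType := HB.pack (resfield L)
  (Num.IntegralDomain_isLeReal.Build (resfield L) le0_add le0_mul le0_anti
    res_sub_ge0 le0_total res_normN res_ge0_norm (fun _ _ => erefl : res_lt _ _ = _)).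

Lemma resfield_real_le (a b : resfield_real) : (a <= b) = (c a <= c b).
Proof. by []. Qed.

(** Lift the polynomial by [c], find a root in [L] between [c a] and [c b], and take its residue;
    convexity keeps the root in the valuation ring. *)
Lemma resfield_real_closed : Num.real_closed_axiom resfield_real.
Proof.
move=> p a b ab /andP[pa pb]; pose P := map_poly c (p : {poly resfield L}).
have cab : c a <= c b by rewrite -resfield_real_le.
have Pa : P.[c a] <= 0 by rewrite horner_map -(rmorph0 c).
have Pb : 0 <= P.[c b] by rewrite horner_map -(rmorph0 c).
have [|x /andP[ax xb] Px] := @Num.Theory.poly_ivt _ P _ _ cab; first by rewrite Pa.
have PV : P \is a polyOver (@valring L).
  by apply/polyOverP => i; rewrite coef_map cV.
have xV : x \in valring.
  have -> : x = c a + (x - c a) by rewrite addrC subrK.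
  rewrite rpredD //; apply: (@valring_convex L _ (c b - c a)); rewrite ?rpredB //.
    by rewrite subr_ge0.
  by rewrite lerD2r.
have xr : vsmall (x - c (vres x)) by apply/vres_eqP; rewrite ?cK.
(* Distinct lifts are never infinitely close. Were the lifted residue of the root beyond an
   endpoint, their distance would be bounded by the infinitesimal [x - c (vres x)], and the two
   would coincide. *)
have strict u v : vsmall (c v - c u) -> u = v.
  by move=> /(vres_eqP (cV v) (cV u)); rewrite !cK.
exists (vres x).
  apply/andP; split; rewrite resfield_real_le.
    rewrite leNgt; apply/negP => ra.
    have e : vres x = a.
      apply: strict; apply: vsmall_le_norm xr; rewrite !ger0_norm ?subr_ge0 ?lerD2r // ?ltW //.
      exact: lt_le_trans ax.
    by move: ra; rewrite e ltxx.
  rewrite leNgt; apply/negP => br.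
  have e : b = vres x.
    apply: strict; rewrite -vsmallN in xr; apply: vsmall_le_norm xr.
    rewrite opprB !ger0_norm ?subr_ge0 ?lerD2l ?lerN2 // ltW //.
    exact: le_lt_trans br.
  by move: br; rewrite e ltxx.
have : vres P.[x] = vres P.[c (vres x)] by apply: vres_horner_cong; rewrite ?cK.
by rewrite (rootP Px) vres0 horner_map cK => e; apply/eqP.
Qed.

Definition resfield_rcf : rcfType := HB.pack (resfield L) resfield_real
  (Num.RealField_isClosed.Build resfield_real resfield_real_closed).

End ResidueOrder.

(** * Embedding a valued field over a given subfield *)

Section ValuedEmbedding.
Variables (L : rcvfType) (c : {rmorphism resfield L -> L}).
Variable s : {additive valgroup L -> nonzero L}.
Hypothesis cV : forall r, c r \in valring.
Hypothesis cK : forall r, vres (c r) = r.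
Hypothesis s_gt0 : forall g, 0 < val (s g).
Hypothesis sK : forall g, valuation (s g) = g.

Lemma section_coef_onto x : x \in valring -> exists r, vsmall (x - c r).
Proof. by move=> xV; exists (vres x); apply/vres_eqP; rewrite ?cK. Qed.

Lemma section_valD g h : val (s (g + h)) = val (s g) * val (s h).
Proof. by rewrite raddfD. Qed.

Lemma section_valring g : (val (s g) \in valring) = (0 <= g).
Proof.
have -> : (0 : valgroup L) = valuation (0 : nonzero L) by exact/esym/raddf0.
by rewrite -{2}(sK g) le_valuation nonzero_val0 divr1.
Qed.

Lemma section_onto x : x != 0 ->
  exists2 g, x / val (s g) \in valring & ~~ vsmall (x / val (s g)).
Proof.
move=> x0; pose g := valuation (Nonzero x0); exists g.
  by have := sK g; rewrite /g => /eqP; rewrite eq_valuation /= => /andP[].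
rewrite /vsmall negb_or negbK mulf_neq0 ?invr_eq0 ?nonzero_neq0 //= invf_div.
by have := sK g; rewrite /g => /eqP; rewrite eq_valuation /= => /andP[].
Qed.

Let H := hahn (resfield L) (valgroup L).

(** The order on the residue field depends on [c] and is used inside the proof only. Integral
    elements have integral images by their leading terms. If [x] is not integral, [x^-1] is
    infinitesimal, so its image has constant coefficient 0 and cannot have an integral inverse. *)
Lemma valued_embedding (M : fieldType) (j : {rmorphism M -> L}) (phi : {rmorphism M -> H}) :
    (forall a, a != 0 -> exists b g r, [/\ r != 0, j b = c r * val (s g),
       phi b = hahn_mono g r & vsmall (j a / val (s g) - c r) /\
       (phi a \in hahn_ge g /\ phi a g = r)]) ->
  exists e : {vmorphism L -> H},
    [/\ forall r, e (c r) = hahn_mono 0 r, forall g, e (val (s g)) = hahn_mono g 1,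
      forall a, e (j a) = phi a &
      forall x g r, vsmall (x / val (s g) - c r) -> e x \in hahn_ge g /\ e x g = r].
Proof.
move=> Mlead.
have [|e' [ec es ej elead]] := @hahn_embedding L (resfield_rcf cV cK) (valgroup L) c
    (fun g => val (s g)) cV section_coef_onto section_valD s_gt0 section_valring
    section_onto M j phi _ (@valgroup_divisible L).
  move=> a /Mlead[b [g [r [r0 jb pb ld]]]]; exists b, g, r; split=> //.
  by rewrite /diagmap /pairmono jb pb.
pose e : {rmorphism L -> H} := e'.
have {}elead x g r : vsmall (x / val (s g) - c r) -> e x \in hahn_ge g /\ e x g = r.
  exact: elead.
have eV x : (e x \in valring) = (x \in valring).
  have s01 : val (s 0) = 1 by rewrite raddf0.
  rewrite -hahn_ge_valring; apply/idP/idP => [exV|xV]; last first.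
    have [r xr] := section_coef_onto xV.
    by apply: (elead x 0 r _).1; rewrite s01 divr1.
  apply: contraT => xV; have x0 : x != 0 by apply: contra xV => /eqP->; exact: rpred0.
  have [|e1 e2] := elead x^-1 0 0.
    by rewrite s01 divr1 rmorph0 subr0 /vsmall invrK xV orbT.
  have : (e x * e x^-1) 0 = 0 by rewrite hahn_mul_coef0 ?e2 ?mulr0.
  by rewrite -rmorphM divff // rmorph1 hahn1E eqxx => /eqP; rewrite oner_eq0.
pose eM : {vmorphism L -> H} := HB.pack (e : L -> H) e
  (isValuedMorphism.Build L H e eV).
by exists eM; split.
Qed.

End ValuedEmbedding.

(** * Compatibility of residues and monomials with the extension *)

Section Extension.
Variables (K L : valuedFieldType) (i : {vmorphism K -> L}).

Lemma vsmall_vmorphism x : vsmall (i x) = vsmall x.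
Proof. by rewrite /vsmall fmorph_eq0 -fmorphV valring_mono. Qed.

Lemma vres_vmorphism x : x \in valring -> vres (i x) = resmap i (vres x).
Proof.
move=> xV; rewrite (vresE xV) resmapE -vres_val; congr residue.
Qed.

End Extension.

Section HahnMapMono.
Variables (k l : fieldType) (G H : orderedZmodType).
Variables (f : {rmorphism k -> l}) (phi : {oembedding G -> H}).

Lemma hahn_map_mono g r : hahn_map f phi (hahn_mono g r) = hahn_mono (phi g) (f r).
Proof.
apply: hahn_map_eq => [h|h hout]; rewrite !hahn_monoE.
  by rewrite (inj_eq (@oe_inj _ _ phi)); case: eqP; rewrite ?rmorph0.
by case: eqP => // e; case: (hout g).
Qed.

Lemma hahn_map_ge g a : a \in hahn_ge g -> hahn_map f phi a \in hahn_ge (phi g).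
Proof.
move=> /hahn_geP ag; apply/hahn_geP => h hg; apply/eqP/negPn/negP.
move=> /hahn_map_fun_neq0[x xh]; rewrite ag ?eqxx //.
by rewrite -(leW_mono (@oe_le _ _ phi)) xh.
Qed.

End HahnMapMono.

Theorem theoremA5 (K L : rcvfType) (i : {vmorphism K -> L}) :
  exists (eK : {vmorphism K -> hahn (resfield K) (valgroup K)})
         (eL : {vmorphism L -> hahn (resfield L) (valgroup L)}),
    forall x : K, eL (i x) = hahn_map (resmap i) (valmap i) (eK x).
Proof.
(* For [K] nothing is prescribed: the search starts from the smallest subring, whose nonzero
   elements are units of the valuation ring. *)
pose ints : {pred K} := [pred x | `[< exists m : int, x = m%:~R >]].
have [||cK [cKV cKK _]] := @residue_section K ints.
- split=> [|_ _ /asboolP[m ->] /asboolP[n ->]|_ _ /asboolP[m ->] /asboolP[n ->]].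
  + by apply/asboolP; exists 1.
  + by apply/asboolP; exists (m - n); rewrite rmorphB.
  by apply/asboolP; exists (m * n); rewrite rmorphM.
- move=> _ /asboolP[m ->]; split; first exact: rpred_int.
  case: m => n; last by rewrite NegzE rmorphN vsmallN /= vsmall_nat.
  by case: n => // n; rewrite /= vsmall_nat.
have [||sK [sK_gt0 sKK _]] := @value_section K (pred1 0).
- by split=> [|x y]; rewrite ?inE // => /eqP-> /eqP->; rewrite subr0.
- by move=> x /eqP->; rewrite nonzero_val0 ltr01.
have sK0 : val (sK 0) = 1 by rewrite raddf0.
(* The given subfield is the field of lifted residues, sent to constants; each element is its own
   leading monomial, of exponent 0. *)
have [|eK [eKc eKs _ eKlead]] := @valued_embedding K cK sK cKV cKK sK_gt0 sKK
    (resfield K) cK (@hahn_const (resfield K) (valgroup K)).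
  move=> a a0; exists a, 0, a; rewrite sK0 mulr1 divr1 subrr vsmall0.
  by split=> //; rewrite hahn_const_ge hahn_const0.
exists eK.
pose lifts : {pred L} := [pred x | `[< exists r, x = i (cK r) >]].
have [||cL [cLV cLK cLi]] := @residue_section L lifts.
- split=> [|_ _ /asboolP[r ->] /asboolP[t ->]|_ _ /asboolP[r ->] /asboolP[t ->]].
  + by apply/asboolP; exists 1; rewrite !rmorph1.
  + by apply/asboolP; exists (r - t); rewrite !rmorphB.
  by apply/asboolP; exists (r * t); rewrite !rmorphM.
- move=> _ /asboolP[r ->]; rewrite valring_mono cKV; split=> //.
  rewrite vsmall_vmorphism -vres_eq0 // cKK => /eqP->.
  by rewrite !rmorph0.
pose monos : {pred nonzero L} := [pred x | `[< exists g, x = nonzero_map i (sK g) >]].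
have [||sL [sL_gt0 sLK sLi]] := @value_section L monos.
- split=> [|_ _ /asboolP[g ->] /asboolP[h ->]]; apply/asboolP.
    by exists 0; apply: val_inj; rewrite /= sK0 rmorph1.
  exists (g - h); apply: val_inj.
  by rewrite nonzero_valD nonzero_valN /= raddfB nonzero_valD nonzero_valN rmorphM fmorphV.
- move=> _ /asboolP[g ->]; split.
    by rewrite -sgz_gt0 rmorph_rcf_sgz sgz_gt0.
  rewrite -valmapE sKK -(raddf0 (valmap i)) => /oe_inj->.
  by apply: val_inj; rewrite /= sK0 rmorph1.
have cLE r : cL (resmap i r) = i (cK r).
  by rewrite -[r in LHS]cKK -vres_vmorphism // cLi //; apply/asboolP; exists r.
have sLE g : val (sL (valmap i g)) = i (val (sK g)).
  by rewrite -[g in LHS]sKK valmapE sLi //; apply/asboolP; exists g.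
pose hm := hahn_map (resmap i) (valmap i).
(* Prescribing on [K] the composite of [eK] with the inclusion of Hahn fields makes the desired
   square commute. *)
have [|eL [_ _ eLi _]] := @valued_embedding L cL sL cLV cLK sL_gt0 sLK K i (hm \o eK).
  move=> a a0; pose g := valuation (Nonzero a0).
  have [g' gV gS] := section_onto sKK a0.
  have [r ar] := section_coef_onto cKV cKK gV.
  (* The monomial of [K] built from the leading data of [a]: the extended sections map it to a
     monomial of [L], and [eK] followed by [hm] to the matching monomial series. *)
  exists (cK r * val (sK g')), (valmap i g'), (resmap i r); split.
  - rewrite fmorph_eq0; apply: contra gS => /eqP r0.
    by move: ar; rewrite r0 rmorph0 subr0.
  - by rewrite rmorphM cLE sLE.
  - have eKm : eK (cK r * val (sK g')) = hahn_mono g' r.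
      transitivity (eK (cK r) * eK (val (sK g'))); first exact: rmorphM.
      by rewrite eKc eKs hahn_monoM add0r mulr1.
    by rewrite [LHS]/= eKm; apply: hahn_map_mono.
  have [eg er] := eKlead a g' r ar.
  rewrite sLE cLE -fmorph_div -rmorphB vsmall_vmorphism; split=> //.
  by split; [exact: hahn_map_ge|rewrite -er; exact: hahn_mapE].
by exists eL.
Qed.
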